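(* Let $\mathfrak n=[0,3]+[1,4]+[2,5]+[3,6]$ and let $X_{\rm an}(\mathfrak n)$ be the analytic Langlands standard module of the graded affine Hecke algebra $\mathbb H(\mathrm{GL}_{16})$ attached to $\mathfrak n$. The Jantzen filtration of $X_{\rm an}(\mathfrak n)$ depends on the regular real deformation direction, even up to an overall translation of filtration indices. That is, there exist two regular real directions $\eta,\eta'$ such that for no integer $k$ does one have $J_\eta^nX_{\rm an}(\mathfrak n)=J_{\eta'}^{n+k}X_{\rm an}(\mathfrak n)$ for all $n$.
   Context: $\mathbb H_d=\mathbb H(\mathrm{GL}_d)$ is generated by $\mathbb C[S_d]$ (basis $N_w$) and $\mathbb C[\epsilon_1,\dots,\epsilon_d]$, with $\xi N_{s_i}-N_{s_i}s_i(\xi)=\langle\xi,\alpha_i^\vee\rangle$ for every linear form $\xi$, where $\alpha_i=\epsilon_i-\epsilon_{i+1}$ and $s_i=s_{\alpha_i}$. For a segment $[a,b]$ with $b-a\in\mathbb Z_{\ge0}$ (and $a$ a complex number or an element of $\mathbb C[[t]]$), $Z_{\rm an}([a,b])$ is the rank-one $\mathbb H_{b-a+1}$-module on which $S_{b-a+1}$ acts by sign and $\epsilon_1,\dots,\epsilon_{b-a+1}$ act by $a,a+1,\dots,b$. $\operatorname{Ind}$ denotes induction $\mathbb H_{16}\otimes_{\mathbb H_4^{\otimes4}}(-)$ from the parabolic subalgebra $\mathbb H_4^{\otimes 4}$ (scalar-extended to $\mathbb C[[t]]$ for families). Put $E_i^{\rm an}=Z_{\rm an}([i-1,i+2])$,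 $1\le i\le4$, and $$X_{\rm an}(\mathfrak n)=\operatorname{Ind}(E_4^{\rm an}\boxtimes E_3^{\rm an}\boxtimes E_2^{\rm an}\boxtimes E_1^{\rm an}).$$ A real deformation direction is $\eta=(\eta_4,\eta_3,\eta_2,\eta_1)\in\mathbb R^4$; it is regular if its four entries are pairwise distinct. The deformed standard lattice is the finite free $\mathbb C[[t]]$-module $$X_t=\operatorname{Ind}\bigl(E_4^{\rm an}(t\eta_4)\boxtimes E_3^{\rm an}(t\eta_3)\boxtimes E_2^{\rm an}(t\eta_2)\boxtimes E_1^{\rm an}(t\eta_1)\bigr),\qquad E_i^{\rm an}(c)=Z_{\rm an}([i-1+c,i+2+c]),$$ with $X_t/tX_t=X_{\rm an}(\mathfrak n)$. Its contragredient is $X_t^\vee=\operatorname{Hom}_{\mathbb C[[t]]}(X_t,\mathbb C[[t]])$ with $(h\cdot f)(v)=f(h^*v)$, where $N_w^*=N_{w^{-1}}$ and $\epsilon_i^*=\epsilon_i$. Let $I_t:X_t\to X_t^\vee$ be the Hecke-linear map that is an isomorphism over $\mathbb C((t))$, normalized to be primitive (image not contained in $tX_t^\vee$); it is unique up to $\mathbb C[[t]]^\times$. The Jantzen filtration in the direction $\eta$ is $$J_\eta^nX_{\rm an}(\mathfrak n)=\frac{I_t^{-1}(t^nX_t^\vee)+tX_t}{tX_t}\quad(n\ge0),\qquad J_\eta^n=X_{\rm an}(\mathfrak n)\ (n\le0).$$ *)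

(* Defs.v *)
From HB Require Import structures.
From mathcomp Require Import boolp classical_sets reals.
From mathcomp Require Import all_boot all_order all_algebra all_fingroup.
From mathcomp Require Import generic_quotient complex ring.

Set Implicit Arguments.
Unset Strict Implicit.
Unset Printing Implicit Defensive.

Import Order.TTheory GRing.Theory Num.Theory.
Local Open Scope ring_scope.
Local Open Scope quotient_scope.

Record fps (F : Type) := Fps { fcoef : nat -> F }.

Lemma fpsP (F : Type) (p q : fps F) : fcoef p =1 fcoef q -> p = q.
Proof. by case: p q => [p] [q] /= /funext ->. Qed.

HB.instance Definition _ (F : Type) := gen_eqMixin (fps F).
HB.instance Definition _ (F : Type) := gen_choiceMixin (fps F).

Section FpsRing.
Variable F : comNzRingType.
Implicit Types p q r : fps F.

Definition fps_cst (a : F) : fps F := Fps (fun n => if n == 0%N then a else 0).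
Definition fps_t : fps F := Fps (fun n => (n == 1%N)%:R).
Definition fps_add p q : fps F := Fps (fun n => fcoef p n + fcoef q n).
Definition fps_opp p : fps F := Fps (fun n => - fcoef p n).
Definition fps_mul p q : fps F :=
  Fps (fun n => \sum_(i < n.+1) fcoef p i * fcoef q (n - i)%N).

Lemma fps_addA : associative fps_add.
Proof. by move=> p q r; apply: fpsP => n /=; rewrite addrA. Qed.
Lemma fps_addC : commutative fps_add.
Proof. by move=> p q; apply: fpsP => n /=; rewrite addrC. Qed.
Lemma fps_add0 : left_id (fps_cst 0) fps_add.
Proof. by move=> p; apply: fpsP => n /=; case: ifP; rewrite add0r. Qed.
Lemma fps_addN : left_inverse (fps_cst 0) fps_opp fps_add.
Proof. by move=> p; apply: fpsP => n /=; case: ifP; rewrite addNr. Qed.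

HB.instance Definition _ :=
  GRing.isZmodule.Build (fps F) fps_addA fps_addC fps_add0 fps_addN.

(* Truncation to polynomials: the ring laws of [fps F] are inherited from those
   of [{poly F}]. *)
Definition fps_trunc (N : nat) p : {poly F} := \poly_(i < N) fcoef p i.

Lemma fcoef_mul_trunc p q n N : (n < N)%N ->
  fcoef (fps_mul p q) n = (fps_trunc N p * fps_trunc N q)`_n.
Proof.
move=> nN; rewrite coefM; apply: eq_bigr => i _; rewrite !coef_poly.
have iN : (i < N)%N by apply: leq_ltn_trans nN; rewrite -ltnS.
by rewrite iN (leq_ltn_trans (leq_subr _ _) nN).
Qed.

Lemma fps_mulC : commutative fps_mul.
Proof.
move=> p q; apply: fpsP => n.
by rewrite !(@fcoef_mul_trunc _ _ n n.+1) // mulrC.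
Qed.

Lemma fps_mul1 : left_id (fps_cst 1) fps_mul.
Proof.
move=> p; apply: fpsP => n /=; rewrite big_ord_recl /= mul1r subn0.
by rewrite big1 ?addr0 // => i _; rewrite mul0r.
Qed.

Lemma fps_mulDl : left_distributive fps_mul fps_add.
Proof.
move=> p q r; apply: fpsP => n /=; rewrite -big_split /=.
by apply: eq_bigr => i _; rewrite mulrDl.
Qed.

Lemma fps_mulA : associative fps_mul.
Proof.
move=> p q r; apply: fpsP => n.
have E (a b c : fps F) : fcoef (fps_mul a (fps_mul b c)) n =
    (fps_trunc n.+1 a * (fps_trunc n.+1 b * fps_trunc n.+1 c))`_n.
  rewrite coefM /=; apply: eq_bigr => i _; rewrite coef_poly ltn_ord.
  by rewrite -(@fcoef_mul_trunc b c) // ltnS leq_subr.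
by rewrite [in RHS]fps_mulC !E mulrA [in RHS]mulrC.
Qed.

Lemma fps_1neq0 : fps_cst 1 != 0.
Proof.
by apply/eqP => /(congr1 (fun p => fcoef p 0)) /= /eqP; rewrite oner_eq0.
Qed.

HB.instance Definition _ := GRing.Zmodule_isComNzRing.Build (fps F)
  fps_mulA fps_mulC fps_mul1 fps_mulDl fps_1neq0.

Lemma fcoefD p q n : fcoef (p + q) n = fcoef p n + fcoef q n.
Proof. by []. Qed.
Lemma fcoefM p q n :
  fcoef (p * q) n = \sum_(i < n.+1) fcoef p i * fcoef q (n - i)%N.
Proof. by []. Qed.

Fact fps_cst_zmod : zmod_morphism fps_cst.
Proof.
move=> a b; apply: fpsP => n /=.
by case: (n == 0%N) => //; rewrite oppr0 addr0.
Qed.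
Fact fps_cst_monoid : monoid_morphism fps_cst.
Proof.
split=> // a b; apply: fpsP => -[|n]; rewrite fcoefM big_ord_recl /=.
  by rewrite big_ord0 addr0.
by rewrite mulr0 add0r big1 // => i _; rewrite mul0r.
Qed.
HB.instance Definition _ := GRing.isZmodMorphism.Build F (fps F) fps_cst
  fps_cst_zmod.
HB.instance Definition _ := GRing.isMonoidMorphism.Build F (fps F) fps_cst
  fps_cst_monoid.

Definition fps_eval0 p : F := fcoef p 0.
Fact fps_eval0_zmod : zmod_morphism fps_eval0. Proof. by []. Qed.
Fact fps_eval0_monoid : monoid_morphism fps_eval0.
Proof.
by split=> // p q; rewrite /fps_eval0 fcoefM big_ord_recl big_ord0 addr0.
Qed.
HB.instance Definition _ := GRing.isZmodMorphism.Build (fps F) F fps_eval0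
  fps_eval0_zmod.
HB.instance Definition _ := GRing.isMonoidMorphism.Build (fps F) F fps_eval0
  fps_eval0_monoid.

End FpsRing.

Section FpsDomain.
Variable F : idomainType.
Implicit Types p q : fps F.

Definition fps_unit : pred (fps F) := fun p => `[< exists q, q * p = 1 >].
Definition fps_inv p : fps F :=
  if pselect (exists q, q * p = 1) is left e then sval (cid e) else p.

Fact fps_mulVr : {in fps_unit, left_inverse 1 fps_inv *%R}.
Proof.
move=> p /asboolP pu; rewrite /fps_inv; case: pselect => // e.
by case: (cid e).
Qed.
Fact fps_unitPl p q : q * p = 1 -> fps_unit p.
Proof. by move=> e; apply/asboolP; exists q. Qed.
Fact fps_invr_out : {in [predC fps_unit], fps_inv =1 id}.
Proof.
move=> p /negP pu; rewrite /fps_inv; case: pselect => // e.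
by case: pu; apply/asboolP.
Qed.
HB.instance Definition _ := GRing.ComNzRing_hasMulInverse.Build (fps F)
  fps_mulVr fps_unitPl fps_invr_out.

Fact fps_integral : GRing.integral_domain_axiom (fps F).
Proof.
have first (p : fps F) : p != 0 ->
    exists2 n, fcoef p n != 0 & forall i, (i < n)%N -> fcoef p i = 0.
  move=> p0; have ex : exists n, fcoef p n != 0.
    apply: contrapT => np; move/eqP: p0; apply; apply: fpsP => n /=.
    by case: ifP => _; apply/eqP/negPn/negP => pn; apply: np; exists n.
  exists (ex_minn ex); case: ex_minnP => // m _ mmin i im.
  by apply/eqP/negPn/negP => /mmin; rewrite leqNgt im.
move=> p q pq0; apply/orP.
have [_|/first [m pm pmin]] := eqVneq p 0; first by left.
have [_|/first [n qn qmin]] := eqVneq q 0; first by right.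
have := congr1 (fun r => fcoef r (m + n)) pq0; rewrite fcoefM.
have mlt : (m < (m + n).+1)%N by rewrite ltnS leq_addr.
rewrite (bigD1 (Ordinal mlt)) //= addKn big1 ?addr0; last first.
  move=> i; rewrite -val_eqE /= neq_ltn => /orP[im|mi].
    by rewrite pmin ?mul0r.
  rewrite qmin ?mulr0 // ltn_subLR ?ltn_add2r //.
  by rewrite -ltnS ltn_ord.
by case: ifP => _ /eqP; rewrite mulf_eq0 (negPf pm) (negPf qn).
Qed.
HB.instance Definition _ := GRing.ComUnitRing_isIntegral.Build (fps F)
  fps_integral.

End FpsDomain.

Inductive term (A G : Type) :=
  | TCst of A
  | TGen of G
  | TAdd of term A G & term A G
  | TMul of term A G & term A G.
Arguments TCst {A G}.
Arguments TGen {A G}.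

HB.instance Definition _ (A G : Type) := gen_eqMixin (term A G).
HB.instance Definition _ (A G : Type) := gen_choiceMixin (term A G).

Section Presented.
Variables (A : comNzRingType) (G : Type).
Variable rel : term A G -> term A G -> Prop.

(* [pres] below is the associative unital [A]-algebra with generators [G] and
   relations [rel]: formal ring expressions modulo the least congruence
   containing [rel] and the axioms of [A]-algebras. *)
Inductive pcong : term A G -> term A G -> Prop :=
  | pc_rel x y of rel x y : pcong x y
  | pc_refl x : pcong x x
  | pc_sym x y of pcong x y : pcong y x
  | pc_trans x y z of pcong x y & pcong y z : pcong x z
  | pc_add x x' y y' of pcong x x' & pcong y y' :
      pcong (TAdd x y) (TAdd x' y')
  | pc_mul x x' y y' of pcong x x' & pcong y y' :
      pcong (TMul x y) (TMul x' y')
  | pc_addA x y z : pcong (TAdd x (TAdd y z)) (TAdd (TAdd x y) z)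
  | pc_addC x y : pcong (TAdd x y) (TAdd y x)
  | pc_add0 x : pcong (TAdd (TCst 0) x) x
  | pc_addN x : pcong (TAdd (TMul (TCst (-1)) x) x) (TCst 0)
  | pc_mulA x y z : pcong (TMul x (TMul y z)) (TMul (TMul x y) z)
  | pc_mul1 x : pcong (TMul (TCst 1) x) x
  | pc_mulDl x y z : pcong (TMul (TAdd x y) z) (TAdd (TMul x z) (TMul y z))
  | pc_mulDr x y z : pcong (TMul x (TAdd y z)) (TAdd (TMul x y) (TMul x z))
  | pc_cstD a b : pcong (TCst (a + b)) (TAdd (TCst a) (TCst b))
  | pc_cstM a b : pcong (TCst (a * b)) (TMul (TCst a) (TCst b))
  | pc_cstC a x : pcong (TMul (TCst a) x) (TMul x (TCst a)).

Definition pcongb x y : bool := `[< pcong x y >].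
Fact pcongb_refl : reflexive pcongb.
Proof. by move=> x; apply/asboolP/pc_refl. Qed.
Fact pcongb_sym : symmetric pcongb.
Proof. by move=> x y; apply/asboolP/asboolP => /pc_sym. Qed.
Fact pcongb_trans : transitive pcongb.
Proof.
by move=> y x z /asboolP xy /asboolP yz; apply/asboolP/(pc_trans xy yz).
Qed.
Canonical pcong_equiv := EquivRel pcongb pcongb_refl pcongb_sym pcongb_trans.

Definition pres : Type := {eq_quot pcong_equiv}.
HB.instance Definition _ := Choice.on pres.

Definition pcls (x : term A G) : pres := \pi_({eq_quot pcong_equiv}) x.
Definition prep (x : pres) : term A G := repr (x : {eq_quot pcong_equiv}).

Lemma prepK x : pcls (prep x) = x. Proof. exact: reprK. Qed.
Lemma pclsP x y : pcls x = pcls y <-> pcong x y.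
Proof.
by split=> [/eqmodP /asboolP //|xy]; apply/eqmodP/asboolP.
Qed.
Lemma pclsK x : pcong (prep (pcls x)) x.
Proof. by apply/pclsP; rewrite prepK. Qed.
Lemma presW (P : pres -> Prop) : (forall x, P (pcls x)) -> forall x, P x.
Proof. by move=> H x; rewrite -(prepK x). Qed.

Definition padd (x y : pres) : pres := pcls (TAdd (prep x) (prep y)).
Definition pmul (x y : pres) : pres := pcls (TMul (prep x) (prep y)).

Lemma paddE x y : padd (pcls x) (pcls y) = pcls (TAdd x y).
Proof. by apply/pclsP/pc_add; apply: pclsK. Qed.
Lemma pmulE x y : pmul (pcls x) (pcls y) = pcls (TMul x y).
Proof. by apply/pclsP/pc_mul; apply: pclsK. Qed.

Definition pcst (a : A) : pres := pcls (TCst a).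
Definition pgen (g : G) : pres := pcls (TGen g).
Definition popp (x : pres) : pres := pmul (pcst (-1)) x.

Fact paddA : associative padd.
Proof.
elim/presW=> x; elim/presW=> y; elim/presW=> z; rewrite !paddE.
exact/pclsP/pc_addA.
Qed.
Fact paddC : commutative padd.
Proof. by elim/presW=> x; elim/presW=> y; rewrite !paddE; apply/pclsP/pc_addC. Qed.
Fact padd0 : left_id (pcst 0) padd.
Proof. by elim/presW=> x; rewrite paddE; apply/pclsP/pc_add0. Qed.
Fact paddN : left_inverse (pcst 0) popp padd.
Proof. by elim/presW=> x; rewrite /popp pmulE paddE; apply/pclsP/pc_addN. Qed.
HB.instance Definition _ := GRing.isZmodule.Build pres paddA paddC padd0 paddN.

Fact pmulA : associative pmul.
Proof.
elim/presW=> x; elim/presW=> y; elim/presW=> z; rewrite !pmulE.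
exact/pclsP/pc_mulA.
Qed.
Fact pmul1l : left_id (pcst 1) pmul.
Proof. by elim/presW=> x; rewrite pmulE; apply/pclsP/pc_mul1. Qed.
Fact pcst_central a x : pmul (pcst a) x = pmul x (pcst a).
Proof. by elim/presW: x => x; rewrite !pmulE; apply/pclsP/pc_cstC. Qed.
Fact pmul1r : right_id (pcst 1) pmul.
Proof. by move=> x; rewrite -pcst_central pmul1l. Qed.
Fact pmulDl : left_distributive pmul padd.
Proof.
elim/presW=> x; elim/presW=> y; elim/presW=> z; rewrite !(paddE, pmulE).
exact/pclsP/pc_mulDl.
Qed.
Fact pmulDr : right_distributive pmul padd.
Proof.
elim/presW=> x; elim/presW=> y; elim/presW=> z; rewrite !(paddE, pmulE).
exact/pclsP/pc_mulDr.
Qed.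
HB.instance Definition _ := GRing.Zmodule_isPzRing.Build pres
  pmulA pmul1l pmul1r pmulDl pmulDr.

Lemma pclsD x y : pcls (TAdd x y) = pcls x + pcls y.
Proof. by rewrite -paddE. Qed.
Lemma pclsM x y : pcls (TMul x y) = pcls x * pcls y.
Proof. by rewrite -pmulE. Qed.

Fact pcst_zmod : zmod_morphism pcst.
Proof.
move=> a b; apply: (canRL (addrK _)); rewrite -pclsD.
by apply/pclsP/pc_sym; rewrite -{1}(subrK b a); apply: pc_cstD.
Qed.
Fact pcst_monoid : monoid_morphism pcst.
Proof. by split=> // a b; rewrite -pclsM; apply/pclsP/pc_cstM. Qed.
HB.instance Definition _ := GRing.isZmodMorphism.Build A pres pcst pcst_zmod.
HB.instance Definition _ := GRing.isMonoidMorphism.Build A pres pcst pcst_monoid.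

Lemma pcstC a x : pcst a * x = x * pcst a. Proof. exact: pcst_central. Qed.

Section Eval.
Variable B : pzRingType.

Fixpoint teval (c : A -> B) (g : G -> B) (x : term A G) : B :=
  match x with
  | TCst a => c a
  | TGen i => g i
  | TAdd x y => teval c g x + teval c g y
  | TMul x y => teval c g x * teval c g y
  end.

Record phom := PHom {
  phom_cst : {rmorphism A -> B};
  phom_gen : G -> B;
  phom_central : forall a i, phom_cst a * phom_gen i = phom_gen i * phom_cst a;
  phom_rel : forall x y, rel x y ->
    teval phom_cst phom_gen x = teval phom_cst phom_gen y }.

Variable h : phom.
Let ev := teval (phom_cst h) (phom_gen h).

Lemma teval_central a x : phom_cst h a * ev x = ev x * phom_cst h a.
Proof.
rewrite /ev; elim: x => [b|i|x IHx y IHy|x IHx y IHy] /=.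
- by rewrite -!rmorphM mulrC.
- exact: phom_central.
- by rewrite mulrDl mulrDr IHx IHy.
- by rewrite mulrA IHx -mulrA IHy mulrA.
Qed.

Lemma teval_cong x y : pcong x y -> ev x = ev y.
Proof.
have cC := teval_central; rewrite /ev in cC *.
elim=> {x y} //=; intros; rewrite ?rmorphD ?rmorphM ?rmorph0 ?rmorph1 ?rmorphN1;
  rewrite ?mul1r ?add0r ?mulrA ?addrA ?mulrDl ?mulrDr //.
- exact: phom_rel.
- by congruence.
- by congruence.
- by congruence.
- exact: addrC.
- by rewrite mulN1r addNr.
Qed.

Definition plift (x : pres) : B := ev (prep x).

Lemma plift_cls x : plift (pcls x) = ev x.
Proof. exact/teval_cong/pclsK. Qed.
Lemma plift_cst a : plift (pcst a) = phom_cst h a.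
Proof. exact: plift_cls. Qed.
Lemma plift_gen i : plift (pgen i) = phom_gen h i.
Proof. exact: plift_cls. Qed.

Fact plift_zmod : zmod_morphism plift.
Proof.
move=> x y; apply: (canRL (addrK _)); rewrite -{2}(subrK y x).
elim/presW: (x - y) => z; elim/presW: y => y.
by rewrite -pclsD !plift_cls.
Qed.
Fact plift_monoid : monoid_morphism plift.
Proof.
split=> [|x y]; first by rewrite plift_cst rmorph1.
by elim/presW: x => x; elim/presW: y => y; rewrite -pclsM !plift_cls.
Qed.
HB.instance Definition _ := GRing.isZmodMorphism.Build pres B plift plift_zmod.
HB.instance Definition _ := GRing.isMonoidMorphism.Build pres B plift
  plift_monoid.

End Eval.

Lemma pres_hom_ext (B : pzRingType) (f g : {rmorphism pres -> B}) :
  (forall a, f (pcst a) = g (pcst a)) -> (forall i, f (pgen i) = g (pgen i)) ->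
  f =1 g.
Proof.
move=> fgc fgg; elim/presW=> t; elim: t => [a|i|x IHx y IHy|x IHx y IHy].
- exact: fgc.
- exact: fgg.
- by rewrite pclsD !rmorphD IHx IHy.
- by rewrite pclsM !rmorphM IHx IHy.
Qed.

Lemma teval_cls x : teval pcst pgen x = pcls x.
Proof.
by elim: x => [a|i|x IHx y IHy|x IHx y IHy] //=; rewrite IHx IHy ?pclsD ?pclsM.
Qed.
Lemma pgen_rel x y : rel x y -> teval pcst pgen x = teval pcst pgen y.
Proof. by move=> xy; rewrite !teval_cls; apply/pclsP/pc_rel. Qed.

End Presented.

Definition restr (R S : pzRingType) (f : {rmorphism R -> S}) (M : lmodType S) :
  Type := M.

Section Restriction.
Variables (R S : pzRingType) (f : {rmorphism R -> S}) (M : lmodType S).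
Local Notation restr := (restr f M).

HB.instance Definition _ := GRing.Zmodule.on restr.

Definition restr_scale (a : R) (x : restr) : restr := f a *: (x : M).
Fact restr_scaleA a b x :
  restr_scale a (restr_scale b x) = restr_scale (a * b) x.
Proof. by rewrite /restr_scale scalerA rmorphM. Qed.
Fact restr_scale1 : left_id 1 restr_scale.
Proof. by move=> x; rewrite /restr_scale rmorph1 scale1r. Qed.
Fact restr_scaleDr : right_distributive restr_scale +%R.
Proof. by move=> a x y; rewrite /restr_scale scalerDr. Qed.
Fact restr_scaleDl x : {morph restr_scale^~ x : a b / a + b}.
Proof. by move=> a b; rewrite /restr_scale rmorphD scalerDl. Qed.
HB.instance Definition _ := GRing.Zmodule_isLmodule.Build R restr
  restr_scaleA restr_scale1 restr_scaleDr restr_scaleDl.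

Lemma restr_scaleE a (x : restr) : a *: x = f a *: (x : M) :> M.
Proof. by []. Qed.

End Restriction.

Inductive eterm (H L : Type) :=
  | EZero
  | EPure of H & L
  | EPlus of eterm H L & eterm H L.
Arguments EZero {H L}.

HB.instance Definition _ (H L : Type) := gen_eqMixin (eterm H L).
HB.instance Definition _ (H L : Type) := gen_choiceMixin (eterm H L).

(* [ext f L] is the left [H]-module $H \otimes_P L$, for [f : P -> H]. *)
Section Extension.
Variables (P H : pzRingType) (f : {rmorphism P -> H}) (L : lmodType P).
Local Notation eterm := (eterm H L).

Inductive econg : eterm -> eterm -> Prop :=
  | ec_refl x : econg x x
  | ec_sym x y of econg x y : econg y x
  | ec_trans x y z of econg x y & econg y z : econg x z
  | ec_plus x x' y y' of econg x x' & econg y y' :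
      econg (EPlus x y) (EPlus x' y')
  | ec_plusA x y z : econg (EPlus x (EPlus y z)) (EPlus (EPlus x y) z)
  | ec_plusC x y : econg (EPlus x y) (EPlus y x)
  | ec_plus0 x : econg (EPlus EZero x) x
  | ec_pure0 l : econg (EPure 0 l) EZero
  | ec_pureDl h h' l :
      econg (EPure (h + h') l) (EPlus (EPure h l) (EPure h' l))
  | ec_pureDr h l l' :
      econg (EPure h (l + l')) (EPlus (EPure h l) (EPure h l'))
  | ec_pureM h p l : econg (EPure (h * f p) l) (EPure h (p *: l)).

Definition econgb x y : bool := `[< econg x y >].
Fact econgb_refl : reflexive econgb.
Proof. by move=> x; apply/asboolP/ec_refl. Qed.
Fact econgb_sym : symmetric econgb.
Proof. by move=> x y; apply/asboolP/asboolP => /ec_sym. Qed.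
Fact econgb_trans : transitive econgb.
Proof.
by move=> y x z /asboolP xy /asboolP yz; apply/asboolP/(ec_trans xy yz).
Qed.
Canonical econg_equiv := EquivRel econgb econgb_refl econgb_sym econgb_trans.

Definition ext : Type := {eq_quot econg_equiv}.
HB.instance Definition _ := Choice.on ext.

Definition ecls (x : eterm) : ext := \pi_({eq_quot econg_equiv}) x.
Definition erep (x : ext) : eterm := repr (x : {eq_quot econg_equiv}).

Lemma erepK x : ecls (erep x) = x. Proof. exact: reprK. Qed.
Lemma eclsP x y : ecls x = ecls y <-> econg x y.
Proof. by split=> [/eqmodP /asboolP //|xy]; apply/eqmodP/asboolP. Qed.
Lemma eclsK x : econg (erep (ecls x)) x.
Proof. by apply/eclsP; rewrite erepK. Qed.
Lemma extW (Q : ext -> Prop) : (forall x, Q (ecls x)) -> forall x, Q x.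
Proof. by move=> HQ x; rewrite -(erepK x). Qed.

Fixpoint eact (h : H) (x : eterm) : eterm :=
  match x with
  | EZero => EZero
  | EPure h' l => EPure (h * h') l
  | EPlus x y => EPlus (eact h x) (eact h y)
  end.

Lemma eact_cong h x y : econg x y -> econg (eact h x) (eact h y).
Proof.
elim=> {x y} /=; intros; rewrite ?mulr0 ?mulrDr ?mulrA;
  by eauto using econg.
Qed.

Definition eplus (x y : ext) : ext := ecls (EPlus (erep x) (erep y)).
Definition escale (h : H) (x : ext) : ext := ecls (eact h (erep x)).
Definition eopp (x : ext) : ext := escale (-1) x.

Lemma eplusE x y : eplus (ecls x) (ecls y) = ecls (EPlus x y).
Proof. by apply/eclsP/ec_plus; apply: eclsK. Qed.
Lemma escaleE h x : escale h (ecls x) = ecls (eact h x).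
Proof. exact/eclsP/eact_cong/eclsK. Qed.

Fact eplusA : associative eplus.
Proof.
elim/extW=> x; elim/extW=> y; elim/extW=> z; rewrite !eplusE.
exact/eclsP/ec_plusA.
Qed.
Fact eplusC : commutative eplus.
Proof. by elim/extW=> x; elim/extW=> y; rewrite !eplusE; apply/eclsP/ec_plusC. Qed.
Fact eplus0 : left_id (ecls EZero) eplus.
Proof. by elim/extW=> x; rewrite eplusE; apply/eclsP/ec_plus0. Qed.
Fact escaleDl x : {morph escale^~ x : a b / a + b >-> eplus a b}.
Proof.
elim/extW: x => x a b; rewrite !escaleE eplusE; elim: x => [|h l|x IHx y IHy] /=.
- exact/eclsP/ec_sym/ec_plus0.
- by rewrite mulrDl; apply/eclsP/ec_pureDl.
- rewrite -!eplusE IHx IHy -!eplusE -!eplusA; congr eplus.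
  by rewrite !eplusA; congr eplus; rewrite eplusC.
Qed.
Fact escale0 x : escale 0 x = ecls EZero.
Proof.
elim/extW: x => x; rewrite escaleE; elim: x => [|h l|x IHx y IHy] //=.
- by rewrite mul0r; apply/eclsP/ec_pure0.
- by rewrite -eplusE IHx IHy eplus0.
Qed.
Fact escale1 : left_id 1 escale.
Proof.
elim/extW=> x; rewrite escaleE; elim: x => [|h l|x IHx y IHy] //=.
- by rewrite mul1r.
- by rewrite -!eplusE IHx IHy.
Qed.
Fact eplusN : left_inverse (ecls EZero) eopp eplus.
Proof.
by move=> x; rewrite -{2}[x]escale1 -escaleDl addNr escale0.
Qed.
HB.instance Definition _ := GRing.isZmodule.Build ext eplusA eplusC eplus0 eplusN.

Lemma eclsD x y : ecls (EPlus x y) = ecls x + ecls y.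
Proof. by rewrite -eplusE. Qed.

Fact escaleA a b x : escale a (escale b x) = escale (a * b) x.
Proof.
elim/extW: x => x; rewrite !escaleE; elim: x => [|h l|x IHx y IHy] //=.
- by rewrite mulrA.
- by rewrite -!eplusE IHx IHy.
Qed.
Fact escaleDr : right_distributive escale +%R.
Proof.
move=> h; elim/extW=> x; elim/extW=> y.
by rewrite -eclsD !escaleE -eclsD.
Qed.
HB.instance Definition _ := GRing.Zmodule_isLmodule.Build H ext
  escaleA escale1 escaleDr escaleDl.

Definition pure (h : H) (l : L) : ext := ecls (EPure h l).

Lemma pureDl h h' l : pure (h + h') l = pure h l + pure h' l.
Proof. by rewrite /pure -eclsD; apply/eclsP/ec_pureDl. Qed.
Lemma pureDr h l l' : pure h (l + l') = pure h l + pure h l'.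
Proof. by rewrite /pure -eclsD; apply/eclsP/ec_pureDr. Qed.
Lemma pureM h p l : pure (h * f p) l = pure h (p *: l).
Proof. exact/eclsP/ec_pureM. Qed.
Lemma scale_pure h h' l : h *: pure h' l = pure (h * h') l.
Proof. exact: escaleE. Qed.

Lemma ext_ind (Q : ext -> Prop) :
  Q 0 -> (forall h l, Q (pure h l)) -> (forall x y, Q x -> Q y -> Q (x + y)) ->
  forall x, Q x.
Proof.
move=> Q0 Qp QD; elim/extW=> x; elim: x => [|h l|x IHx y IHy]; [exact: Q0|exact: Qp|].
by move: (QD _ _ IHx IHy); rewrite -eclsD.
Qed.

(* The additive map $h \otimes l \mapsto \beta(h, l)$ out of $H \otimes_P L$;
   it is meaningful for balanced biadditive [beta] only. *)
Section Lift.
Variables (V : zmodType) (beta : H -> L -> V).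

Fixpoint eeval (x : eterm) : V :=
  match x with
  | EZero => 0
  | EPure h l => beta h l
  | EPlus x y => eeval x + eeval y
  end.
Definition elift (x : ext) : V := eeval (erep x).

Definition balanced : Prop :=
  [/\ forall h h' l, beta (h + h') l = beta h l + beta h' l,
      forall h l l', beta h (l + l') = beta h l + beta h l' &
      forall h p l, beta (h * f p) l = beta h (p *: l)].

Hypothesis bP : balanced.

Lemma eeval_cong x y : econg x y -> eeval x = eeval y.
Proof.
case: bP => bDl bDr bM; elim=> {x y} //=.
- by move=> y z u _ -> _ ->.
- by move=> y y' z z' _ -> _ ->.
- by move=> y z u; rewrite addrA.
- by move=> y z; rewrite addrC.
- by move=> y; rewrite add0r.
- by move=> l; apply: (addIr (beta 0 l)); rewrite -bDl !add0r.
Qed.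
Lemma elift_cls x : elift (ecls x) = eeval x.
Proof. exact/eeval_cong/eclsK. Qed.
Lemma elift_pure h l : elift (pure h l) = beta h l.
Proof. exact: elift_cls. Qed.
Lemma eliftD x y : elift (x + y) = elift x + elift y.
Proof.
by elim/extW: x => x; elim/extW: y => y; rewrite -eclsD !elift_cls.
Qed.
End Lift.

End Extension.

(* $h \otimes l \mapsto g(h) \otimes \varphi(l)$ *)
Definition ext_map (P H P' H' : pzRingType)
    (f : {rmorphism P -> H}) (f' : {rmorphism P' -> H'})
    (L : lmodType P) (L' : lmodType P') (g : H -> H') (phi : L -> L') :
  ext f L -> ext f' L' :=
  elift (fun h l => pure f' (g h) (phi l)).
Arguments ext_map {P H P' H' f f' L L'} g phi _.

Lemma ext_map_balanced (P H P' H' : pzRingType)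
    (f : {rmorphism P -> H}) (f' : {rmorphism P' -> H'})
    (L : lmodType P) (L' : lmodType P')
    (gP : P -> P') (g : {rmorphism H -> H'}) (phi : {additive L -> L'}) :
  (forall p, g (f p) = f' (gP p)) ->
  (forall p l, phi (p *: l) = gP p *: phi l) ->
  balanced f (fun h l => pure f' (g h) (phi l)).
Proof.
move=> gf phiZ; split=> [h h' l|h l l'|h p l].
- by rewrite rmorphD pureDl.
- by rewrite raddfD pureDr.
- by rewrite rmorphM gf pureM phiZ.
Qed.

Inductive hgen (d : nat) (W : {group 'S_d}) :=
  | HN of [subg W]
  | HE of 'I_d.
Arguments HN {d W}.
Arguments HE {d W}.

Section HeckeDef.
Variables (A : comNzRingType) (d : nat) (W : {group 'S_d}).
Local Notation term := (term A (hgen W)).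

(* The linear form $\xi = \sum_k x_k \epsilon_k$; one has
   $\langle \xi, \alpha_i^\vee \rangle = x_i - x_{i+1}$, and $s_i(\xi)$ has
   coefficients $x_{s_i(k)}$. *)
Definition lform (x : 'I_d -> A) : term :=
  \big[@TAdd A (hgen W)/TCst 0]_(k < d) TMul (TCst (x k)) (TGen (HE k)).

Inductive hrel : term -> term -> Prop :=
  | hrel_N1 : hrel (TGen (HN 1%g)) (TCst 1)
  | hrel_NM u v :
      hrel (TMul (TGen (HN u)) (TGen (HN v))) (TGen (HN (u * v)%g))
  | hrel_EC i j :
      hrel (TMul (TGen (HE i)) (TGen (HE j))) (TMul (TGen (HE j)) (TGen (HE i)))
  | hrel_cross (i j : 'I_d) (s : [subg W]) (x : 'I_d -> A) of
      j = i.+1 :> nat & sgval s = tperm i j :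
      hrel (TMul (lform x) (TGen (HN s)))
           (TAdd (TMul (TGen (HN s)) (lform (fun k => x (tperm i j k))))
                 (TCst (x i - x j))).

(* The graded affine Hecke algebra over [A] of the Levi subgroup of $GL_d$ whose
   Weyl group is the standard parabolic (Young) subgroup [W] of $S_d$: only the
   simple reflections in [W] occur in the cross relations.  The product of 'S_d
   is read as [(u * v) x = v (u x)]; the opposite convention amounts to the
   relabelling $w \mapsto w^{-1}$ of the $N_w$, which fixes the $N_{s_i}$.  For [W] the whole of
   $S_d$ this is $\mathbb{H}_d \otimes_{\mathbb C} A$. *)
Definition hecke : pzRingType := pres hrel.

Definition hN (w : [subg W]) : hecke := pgen hrel (HN w).
Definition hE (i : 'I_d) : hecke := pgen hrel (HE i).
Definition hcst : {rmorphism A -> hecke} := pcst hrel.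

Lemma teval_lform (B : pzRingType) (c : {rmorphism A -> B})
    (g : hgen W -> B) x :
  teval c g (lform x) = \sum_(k < d) c (x k) * g (HE k).
Proof.
rewrite /lform; elim/big_rec2: _ => [|i y t _ <- //]; first exact: rmorph0.
Qed.

Lemma hN1 : hN 1%g = 1.
Proof. by have /= := pgen_rel hrel_N1. Qed.
Lemma hNM u v : hN u * hN v = hN (u * v)%g.
Proof. by have /= := pgen_rel (hrel_NM u v). Qed.
Lemma hEC i j : hE i * hE j = hE j * hE i.
Proof. by have /= := pgen_rel (hrel_EC i j). Qed.
Lemma hcross (i j : 'I_d) (s : [subg W]) (x : 'I_d -> A) :
  j = i.+1 :> nat -> sgval s = tperm i j ->
  (\sum_k hcst (x k) * hE k) * hN s -
     hN s * (\sum_k hcst (x (tperm i j k)) * hE k) = hcst (x i - x j).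
Proof.
move=> ji sij; have /= := pgen_rel (hrel_cross x ji sij).
by rewrite !(teval_lform hcst) => ->; rewrite addrAC subrr add0r.
Qed.
Lemma hcstC a x : hcst a * x = x * hcst a. Proof. exact: pcstC. Qed.

End HeckeDef.

Arguments hcst {A d W}.

Section HeckeMaps.
Variables (A B : comNzRingType) (d : nat) (W V : {group 'S_d}).
Hypothesis WV : W \subset V.
Variable phi : {rmorphism A -> B}.

Definition hmap_gen (g : hgen W) : hecke B V :=
  match g with
  | HN w => hN B (subg V (sgval w))
  | HE i => hE B V i
  end.

Fact subgWK (w : [subg W]) : sgval (subg V (sgval w)) = sgval w.
Proof. by rewrite subgK // (subsetP WV) // subgP. Qed.

Fact hmap_central a g :
  (hcst \o phi) a * hmap_gen g = hmap_gen g * (hcst \o phi) a.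
Proof. exact: hcstC. Qed.

Fact hmap_rel x y : hrel x y ->
  teval (hcst \o phi) hmap_gen x = teval (hcst \o phi) hmap_gen y.
Proof.
have Wm (w : [subg W]) : sgval w \in V by rewrite (subsetP WV) // subgP.
case=> [|u v|i j|i j s {}x ji sij] /=.
- have -> : subg V 1%g = 1%g by apply: val_inj; rewrite /= subgK ?group1.
  by rewrite !rmorph1 hN1.
- rewrite hNM; congr hN; apply: val_inj.
  by rewrite /= !subgWK subgK ?groupM.
- exact: hEC.
- rewrite !(teval_lform (hcst \o phi)) /=.
  have := @hcross B d V i j (subg V (sgval s)) (phi \o x) ji.
  rewrite subgWK => /(_ sij) /(canRL (subrK _)) /= ->.
  by rewrite addrC -rmorphB.
Qed.

Definition hmap : {rmorphism hecke A W -> hecke B V} :=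
  plift (PHom hmap_central hmap_rel).

Lemma hmap_cst a : hmap (pcst _ a) = hcst (phi a).
Proof. exact: (plift_cst (PHom hmap_central hmap_rel)). Qed.
Lemma hmap_gen_E g : hmap (pgen _ g) = hmap_gen g.
Proof. exact: (plift_gen (PHom hmap_central hmap_rel)). Qed.

End HeckeMaps.

(* The anti-involution $N_w^* = N_{w^{-1}}$, $\epsilon_i^* = \epsilon_i$. *)
Section Star.
Variables (A : comNzRingType) (d : nat) (W : {group 'S_d}).
Local Notation H := (hecke A W).

Definition hstar_cst : A -> H^c := fun a => @hcst A d W a.
Fact hstar_cst_zmod : zmod_morphism hstar_cst.
Proof. by move=> a b; rewrite /hstar_cst rmorphB. Qed.
Fact hstar_cst_monoid : monoid_morphism hstar_cst.
Proof.
split=> [|a b]; first exact: (rmorph1 (@hcst A d W)).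
by rewrite /hstar_cst mulrC; exact: (rmorphM (@hcst A d W)).
Qed.
HB.instance Definition _ := GRing.isZmodMorphism.Build A H^c hstar_cst
  hstar_cst_zmod.
HB.instance Definition _ := GRing.isMonoidMorphism.Build A H^c hstar_cst
  hstar_cst_monoid.

Definition hstar_gen (g : hgen W) : H^c :=
  match g with
  | HN w => hN A w^-1%g
  | HE i => hE A W i
  end.

Fact hstar_central a g :
  hstar_cst a * hstar_gen g = hstar_gen g * hstar_cst a.
Proof. exact: (esym (hcstC _ _)). Qed.

Fact hstar_rel x y : hrel x y ->
  teval hstar_cst hstar_gen x = teval hstar_cst hstar_gen y.
Proof.
case=> [|u v|i j|i j s {}x ji sij] /=.
- by rewrite invg1 (hN1 A W) rmorph1.
- rewrite invMg; exact: (hNM A v^-1%g u^-1%g).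
- exact: (hEC A W j i).
- rewrite !(teval_lform hstar_cst) /=.
  have sV : s^-1%g = s by apply: val_inj; rewrite /= sij tpermV.
  have sumE (z : 'I_d -> A) :
      \sum_k hstar_cst (z k) * hstar_gen (HE k) =
      \sum_k hcst (z k) * hE A W k :> H.
    by apply: eq_bigr => k _; apply: (esym (hcstC _ _)).
  rewrite sV !sumE.
  have := @hcross A d W i j s (fun k => x (tperm i j k)) ji sij.
  rewrite tpermL tpermR.
  have -> : \sum_k hcst (x (tperm i j (tperm i j k))) * hE A W k =
            \sum_k hcst (x k) * hE A W k :> H.
    by apply: eq_bigr => k _; rewrite tpermK.
  move=> E.
  have {E} E : hN A s * (\sum_k hcst (x k) * hE A W k) =
     (\sum_k hcst (x (tperm i j k)) * hE A W k) * hN A s + hcst (x i - x j).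
    by rewrite -[x i - x j]opprB rmorphN -E opprB addrC subrK.
  exact: E.
Qed.

Definition hstar (x : H) : H := plift (PHom hstar_central hstar_rel) x.

Lemma hstarN w : hstar (hN A w) = hN A w^-1%g.
Proof. exact: (plift_gen (PHom hstar_central hstar_rel) (HN w)). Qed.
Lemma hstarE i : hstar (hE A W i) = hE A W i.
Proof. exact: (plift_gen (PHom hstar_central hstar_rel) (HE i)). Qed.
Lemma hstar_hcst a : hstar (hcst a) = hcst a.
Proof. exact: (plift_cst (PHom hstar_central hstar_rel)). Qed.
Lemma hstarD x y : hstar (x + y) = hstar x + hstar y.
Proof. exact: (rmorphD (plift (PHom hstar_central hstar_rel))). Qed.
Lemma hstar1 : hstar 1 = 1.
Proof. exact: (rmorph1 (plift (PHom hstar_central hstar_rel))). Qed.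
Lemma hstarM x y : hstar (x * y) = hstar y * hstar x.
Proof. exact: (rmorphM (plift (PHom hstar_central hstar_rel)) x y). Qed.

End Star.

Section Contragredient.
Variables (A : comNzRingType) (d : nat) (W : {group 'S_d}).
Local Notation H := (hecke A W).
Variable M : lmodType H.

Record contra := Contra {
  contra_fun :> M -> A;
  contra_lin : forall a u v,
    contra_fun (hcst a *: u + v) = a * contra_fun u + contra_fun v }.

Lemma contraP (f g : contra) : f =1 g -> f = g.
Proof.
case: f g => [f fP] [g gP] /= /funext fg; subst g.
by congr Contra; apply: Prop_irrelevance.
Qed.

HB.instance Definition _ := gen_eqMixin contra.
HB.instance Definition _ := gen_choiceMixin contra.

Fact contra_lin_add (f g : contra) a u v :
  f (hcst a *: u + v) + g (hcst a *: u + v) = a * (f u + g u) + (f v + g v).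
Proof. by rewrite !contra_lin mulrDr addrACA. Qed.
Fact contra_lin_zero a (u v : M) : 0 = a * 0 + 0 :> A.
Proof. by rewrite mulr0 addr0. Qed.
Fact contra_lin_opp (f : contra) a u v :
  - f (hcst a *: u + v) = a * - f u + - f v.
Proof. by rewrite contra_lin opprD mulrN. Qed.
Fact contra_lin_scale (h : H) (f : contra) a u v :
  f (hstar h *: (hcst a *: u + v)) = a * f (hstar h *: u) + f (hstar h *: v).
Proof. by rewrite scalerDr scalerA -hcstC -scalerA contra_lin. Qed.

Definition contra_add f g := Contra (contra_lin_add f g).
Definition contra_zero := Contra contra_lin_zero.
Definition contra_opp f := Contra (contra_lin_opp f).
Definition contra_scale h f := Contra (contra_lin_scale h f).

Fact contra_addA : associative contra_add.
Proof. by move=> f g h; apply: contraP => v /=; rewrite addrA. Qed.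
Fact contra_addC : commutative contra_add.
Proof. by move=> f g; apply: contraP => v /=; rewrite addrC. Qed.
Fact contra_add0 : left_id contra_zero contra_add.
Proof. by move=> f; apply: contraP => v /=; rewrite add0r. Qed.
Fact contra_addN : left_inverse contra_zero contra_opp contra_add.
Proof. by move=> f; apply: contraP => v /=; rewrite addNr. Qed.
HB.instance Definition _ := GRing.isZmodule.Build contra
  contra_addA contra_addC contra_add0 contra_addN.

Lemma contraD (f : contra) u v : f (u + v) = f u + f v.
Proof.
by have := contra_lin f 1 u v; rewrite rmorph1 scale1r mul1r.
Qed.

Fact contra_scaleA a b f :
  contra_scale a (contra_scale b f) = contra_scale (a * b) f.
Proof. by apply: contraP => v /=; rewrite scalerA hstarM. Qed.
Fact contra_scale1 : left_id 1 contra_scale.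
Proof. by move=> f; apply: contraP => v /=; rewrite hstar1 scale1r. Qed.
Fact contra_scaleDr : right_distributive contra_scale +%R.
Proof. by move=> a f g; apply: contraP. Qed.
Fact contra_scaleDl f : {morph contra_scale^~ f : a b / a + b}.
Proof.
by move=> a b; apply: contraP => v /=; rewrite hstarD scalerDl contraD.
Qed.
HB.instance Definition _ := GRing.Zmodule_isLmodule.Build H contra
  contra_scaleA contra_scale1 contra_scaleDr contra_scaleDl.

Lemma contra_scaleE (h : H) (f : contra) v : (h *: f) v = f (hstar h *: v).
Proof. by []. Qed.

End Contragredient.

Definition blk (i : 'I_16) : 'I_4 := inord (i %/ 4).

Definition young_set : {set 'S_16} := [set w : 'S_16 | [forall i, blk (w i) == blk i]].
Fact young_group_set : group_set young_set.
Proof.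
apply/group_setP; split=> [|u v]; rewrite !inE.
  by apply/forallP => i; rewrite perm1.
by move=> /forallP uP /forallP vP; apply/forallP => i; rewrite permM (eqP (vP _)).
Qed.
(* $S_4^4 \subset S_{16}$ *)
Definition young : {group 'S_16} := Group young_group_set.

Section Standard.
Variable A : comNzRingType.

Definition H16 : pzRingType := hecke A [set: 'S_16]%G.
(* $\mathbb{H}_4^{\otimes 4}$, the parabolic subalgebra of $\mathbb{H}_{16}$ *)
Definition H4x4 : pzRingType := hecke A young.
Definition parabolic_incl : {rmorphism H4x4 -> H16} :=
  hmap (subsetT young) (@idfun A).

(* The character of $\mathbb{H}_4^{\otimes 4}$ on the rank-one module
   $Z_{an}([a_0,a_0+3]) \boxtimes \dots \boxtimes Z_{an}([a_3,a_3+3])$: the group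
   $S_4^4$ acts by sign, and $\epsilon_{4b+r+1}$ (indexed here from 0, by
   $4b+r$) acts by $a_b + r$. *)
Variable a : 'I_4 -> A.

Definition seg_gen (g : hgen young) : A :=
  match g with
  | HN w => (-1) ^+ (sgval w)
  | HE i => a (blk i) + (i %% 4)%:R
  end.

Fact seg_central c g : idfun c * seg_gen g = seg_gen g * idfun c.
Proof. exact: mulrC. Qed.

Fact seg_rel x y : hrel x y ->
  teval (@idfun A) seg_gen x = teval (@idfun A) seg_gen y.
Proof.
case=> [|u v|i j|i j s {}x ji sij] /=.
- by rewrite odd_perm1.
- by rewrite odd_permM signr_addb.
- exact: mulrC.
rewrite !(teval_lform (@idfun A)) /=.
have ij : i != j by apply: contra_eq_neq ji => ->; rewrite neq_ltn leqnn.
rewrite sij odd_tperm ij expr1 mulrN1 mulN1r.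
have blkE : blk j = blk i.
  have := subgP s; rewrite sij inE => /forallP /(_ i) /eqP.
  by rewrite tpermL.
have modE : (j %% 4 = (i %% 4).+1)%N.
  have dE : (j %/ 4 = i %/ 4)%N.
    by have /(congr1 (@nat_of_ord 4)) := blkE; rewrite /blk !inordK // ltn_divLR // ltn_ord.
  have := divn_eq j 4; rewrite {1}ji {1}(divn_eq i 4) dE -addnS.
  by move/addnI.
set F := fun k : 'I_16 => a (blk k) + (k %% 4)%:R.
have FE (z : 'I_16 -> A) :
    \sum_k z k * (a (blk k) + (k %% 4)%:R) =
    z i * F i + (z j * F j + \sum_(k | (k != i) && (k != j)) z k * F k).
  by rewrite (bigD1 i) //= (bigD1 j) //= eq_sym.
rewrite !FE tpermL tpermR.
rewrite [in RHS](eq_bigr (fun k => x k * F k)); last first.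
  by move=> k /andP[ki kj]; rewrite tpermD // eq_sym.
have -> : F j = F i + 1 by rewrite /F blkE modE -addn1 natrD addrA.
by ring.
Qed.

Definition seg_char : {rmorphism H4x4 -> A} := plift (PHom seg_central seg_rel).

Lemma seg_char_cst c : seg_char (pcst _ c) = c.
Proof. exact: (plift_cst (PHom seg_central seg_rel)). Qed.
Lemma seg_char_gen g : seg_char (pgen _ g) = seg_gen g.
Proof. exact: (plift_gen (PHom seg_central seg_rel)). Qed.

Definition seg_mod : lmodType H4x4 := restr seg_char A^o.

Definition standard : lmodType H16 := ext parabolic_incl seg_mod.

End Standard.

Section Jantzen.
Variable R : realType.
Local Notation C := R[i].
Local Notation PS := (fps C).

(* The scalar extension of a module to $\mathbb{C}((t)) = \mathrm{Frac}\,
   \mathbb{C}[[t]]$, and of a $\mathbb{C}[[t]]$-linear map. *)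
Definition to_laurent : {rmorphism PS -> {fraction PS}} :=
  @FracField.tofrac PS.
Definition generic_fibre (M : lmodType (H16 PS)) : lmodType {fraction PS} :=
  ext to_laurent (restr hcst M).
Definition generic_map (M N : lmodType (H16 PS)) (I : M -> N) :
    generic_fibre M -> generic_fibre N :=
  @ext_map _ _ _ _ to_laurent to_laurent (restr hcst M) (restr hcst N) idfun I.

Lemma generic_map_balanced (M N : lmodType (H16 PS)) (I : {linear M -> N}) :
  balanced to_laurent
    (fun h (l : restr hcst M) =>
       pure to_laurent (L := restr hcst N) h (I l)).
Proof.
split=> [h h' l|h l l'|h p l]; first exact: pureDl.
  by rewrite (raddfD I) pureDr.
by rewrite pureM !restr_scaleE linearZ.
Qed.
Lemma generic_map_pure (M N : lmodType (H16 PS)) (I : {linear M -> N}) c v :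
  generic_map I (pure to_laurent (L := restr hcst M) c v) =
  pure to_laurent (L := restr hcst N) c (I v).
Proof. exact: (elift_pure (generic_map_balanced I)). Qed.
Lemma generic_mapD (M N : lmodType (H16 PS)) (I : {linear M -> N}) x y :
  generic_map I (x + y) = generic_map I x + generic_map I y.
Proof. exact: (eliftD (generic_map_balanced I)). Qed.

(* Blocks, and the entries of directions, are numbered in the order of
   $E_4 \boxtimes E_3 \boxtimes E_2 \boxtimes E_1$: block [b] carries $E_{4-b}$,
   of segment $[3-b, 6-b]$, and [eta b] is $\eta_{4-b}$. *)
Definition start_an (b : 'I_4) : C := (3 - b)%N%:R.
Definition X_an : lmodType (H16 C) := standard start_an.

Definition regular (eta : 'I_4 -> R) : Prop := injective eta.

Variable eta : 'I_4 -> R.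

Definition start_t (b : 'I_4) : PS :=
  (3 - b)%N%:R + fps_t C * fps_cst (eta b)%:C%C.
Definition X_t : lmodType (H16 PS) := standard start_t.

(* The canonical map $X_t \to X_t / t X_t = X_{an}$,
   $h \otimes l \mapsto h|_{t=0} \otimes l|_{t=0}$. *)
Definition hspec : {rmorphism H16 PS -> H16 C} :=
  hmap (subxx [set: 'S_16]) (@fps_eval0 C).
Definition seg_spec (l : seg_mod start_t) : seg_mod start_an :=
  fps_eval0 (l : PS).
Definition reduction : X_t -> X_an := ext_map hspec seg_spec.

Fact seg_spec_zmod : zmod_morphism seg_spec.
Proof. exact: fps_eval0_zmod. Qed.
HB.instance Definition _ := GRing.isZmodMorphism.Build
  (seg_mod start_t) (seg_mod start_an) seg_spec seg_spec_zmod.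

Definition hspec4 : {rmorphism H4x4 PS -> H4x4 C} :=
  hmap (subxx young) (@fps_eval0 C).

Lemma reduction_balanced :
  balanced (parabolic_incl PS)
    (fun h (l : seg_mod start_t) => pure (parabolic_incl C) (hspec h) (seg_spec l)).
Proof.
apply: (@ext_map_balanced _ _ _ _ _ _ _ _ hspec4) => [p|p l].
  pose f : {rmorphism H4x4 PS -> H16 C} := hspec \o parabolic_incl PS.
  pose g : {rmorphism H4x4 PS -> H16 C} := parabolic_incl C \o hspec4.
  apply: (@pres_hom_ext _ _ _ _ f g) => [a|i].
    by rewrite /f /g /= !plift_cst.
  rewrite /f /g /=; rewrite !plift_gen /=.
  case: i => [w|i] /=; rewrite !plift_gen //=.
  congr hN; apply: val_inj => /=.
  by rewrite !subgK ?in_setT ?subgP.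
pose f : {rmorphism H4x4 PS -> C} := @fps_eval0 C \o seg_char start_t.
pose g : {rmorphism H4x4 PS -> C} := seg_char start_an \o hspec4.
have fg : f =1 g.
  apply: pres_hom_ext => [a|i].
    by rewrite /f /g /= !plift_cst.
  rewrite /f /g /= !plift_gen /=.
  case: i => [w|i] /=; rewrite plift_gen /=.
    by rewrite rmorphXn rmorphN1 subgK ?subgP.
  rewrite big_ord1 mul0r addr0.
  by congr (_ + _); apply: (rmorph_nat (@fps_eval0 C)).
have E := rmorphM (@fps_eval0 C) (seg_char start_t p) (l : PS).
exact: (etrans E (congr1 (fun c => c * fps_eval0 (l : PS)) (fg p))).
Qed.

Lemma reduction_pure h l :
  reduction (pure _ h l) = pure _ (hspec h) (seg_spec l).
Proof. exact: (elift_pure reduction_balanced). Qed.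
Lemma reductionD x y : reduction (x + y) = reduction x + reduction y.
Proof. exact: (eliftD reduction_balanced). Qed.

Definition X_dual : lmodType (H16 PS) := contra X_t.

Definition primitive_intertwiner (I : {linear X_t -> X_dual}) : Prop :=
  bijective (generic_map I) /\
  ~ (forall x, exists f : X_dual, I x = hcst (fps_t C) *: f).

(* [(I^{-1}(t^n X_dual) + t X_t) / t X_t] for $n \ge 0$ *)
Definition jantzen (I : X_t -> X_dual) (n : int) : set X_an :=
  match n with
  | Posz m => (fun y => exists2 x : X_t,
      (exists f : X_dual, I x = hcst (fps_t C ^+ m) *: f) & reduction x = y)
  | Negz _ => classical_sets.setT
  end.

End Jantzen.

(* Main.v *)
From HB Require Import structures.
Require Import Defs.
From mathcomp Require Import boolp classical_sets reals.
From mathcomp Require Import all_boot all_order all_algebra all_fingroup.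
From mathcomp Require Import complex ring zify.

Set Implicit Arguments.
Unset Strict Implicit.
Unset Printing Implicit Defensive.

Import Order.TTheory GRing.Theory Num.Theory.
Local Open Scope ring_scope.

(** Blocks 0, 1, 2, 3 carry the segments A = [3,6], B = [2,5], C = [1,4],
    D = [0,3], moved by ta, tb, tc, td.  An intertwiner I is the same thing as a
    contravariant form <x,y> = I x y on the lattice X_t, and J^n consists of the
    reductions of those x with <x, X_t> in (t^n).

    Reading the eigenvalues of the epsilon_k at t = 0, a weight is a word in the
    letters 0..6, and a labelling of the 16 places by A..D is a way to write the
    word as a shuffle of the four segments.  The word
    2 1 0 1 2 3 4 3 2 5 4 3 6 5 4 3 is a shuffle in exactly two ways; they differ
    only in which of the last two letters 2 belongs to C and which to D.  (This is
    a weight of a composition factor of multiplicity two, the one that a singular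
    Schubert variety of GL_4 produces.)  The corresponding rank two piece of X_t
    has a basis y1, e2, where y1 is an eigenvector got from the generator by
    intertwining elements phi, and e2 is got in the same way, except that the two
    strands with the equal letters 2 are crossed by N instead of phi.  With
    x = t(c - d) one has x e2 = y1 - y2 for a second eigenvector y2, and y1, y2
    are orthogonal with norms that are explicit products over the crossings of
    strands.  The result is

      <y1,y1> ~ t^5,   <y1,e2> ~ t^4,
      <e2,e2> = u (a - b)(c - d)(c + d - a - b) t^3 + O(t^4),

    u a nonzero number.  Besides the walls a = b, ..., the last coefficient has the
    zero a + b = c + d.  Hence the reduction of e2 lies in J^4 for
    (a,b,c,d) = (0,3,1,2) and not for (0,1,2,3), while as an element of X_an it
    does not depend on the direction ([reduction_gen]).  A shift k of the indices
    is excluded since the generator lies in J^0 and not in J^1.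

    Three points need work.  That <e2, X_t> and not only <e2, e2> is divisible
    ([e2_bound]): X_t is filtered by the number of label inversions, the
    epsilon_k act triangularly on this filtration ([lead_EE]), and so
    divisibility of a functional that is an epsilon-eigenvector only has to be
    tested on vectors whose word is the one of the functional
    ([contra_ideal]).  The existence of an integral intertwiner with
    <generator, generator> a unit: by the same triangularity a product of
    factors epsilon_k - c projects X_t onto the line of the generator, whose
    coefficient is the functional wanted ([proj_fun]); that this line is not
    zero, and that X_t has no torsion that the argument would miss, is seen in
    an explicit principal series module ([embed]).  Bijectivity of the
    intertwiner over the field of Laurent series: the eigenvectors obtained from
    the generator by all sequences of phi form an orthogonal family that spans
    after inverting t ([form_onto]). *)

(** * Inversions of a labelled permutation *)

Section Inversions.
Variables (n : nat) (b : 'I_n -> nat).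
Implicit Types (w : 'S_n) (i j k l p q : 'I_n).

(** Pairs of places whose labels are in the wrong order.  For the labelling by
    blocks this is the length of the shortest element of the coset of [w] modulo
    the Young subgroup; for [b] the identity it is the length of [w]. *)
Definition inv w : nat :=
  (\sum_(pq : 'I_n * 'I_n) ((pq.1 < pq.2) && (b (w pq.2) < b (w pq.1))))%N.

Lemma adj_ltn i j k l : j = i.+1 :> nat ->
  (k, l) != (i, j) -> (k, l) != (j, i) ->
  (tperm i j k < tperm i j l)%N = (k < l)%N.
Proof.
move=> ji; rewrite !xpair_eqE.
case: tpermP => [->|->|/eqP ki /eqP kj];
  case: tpermP => [->|->|/eqP li /eqP lj]; rewrite ?eqxx ?ltnn //=.
- by move=> _ _; move: li lj; rewrite -!val_eqE /= ji; case: ltngtP => //; lia.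
- by move=> _ _; move: li lj; rewrite -!val_eqE /= ji; case: ltngtP => //; lia.
- by move=> _ _; move: ki kj; rewrite -!val_eqE /= ji; case: ltngtP => //; lia.
- by move=> _ _; move: ki kj; rewrite -!val_eqE /= ji; case: ltngtP => //; lia.
Qed.

Lemma inv_ascent w i j : j = i.+1 :> nat -> (b (w i) < b (w j))%N ->
  inv (tperm i j * w)%g = (inv w).+1.
Proof.
move=> ji wij; set s := tperm i j.
have ij : i != j by rewrite -val_eqE /= ji neq_ltn leqnn.
have sK : involutive s by move=> k; rewrite /s tpermK.
have -> : inv (s * w)%g = (\sum_(pq : 'I_n * 'I_n)
    ((s pq.1 < s pq.2) && (b (w pq.2) < b (w pq.1))))%N.
  rewrite /inv (reindex_inj (h := fun pq => (s pq.1, s pq.2))) /=.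
    by apply: eq_bigr => -[p q] _ /=; rewrite !permM !sK.
  by move=> [p q] [p' q'] [/perm_inj -> /perm_inj ->].
rewrite /inv (bigD1 (j, i)) //= (bigD1 (i, j)) /=; last first.
  by rewrite xpair_eqE (negPf ij).
rewrite [in RHS](bigD1 (j, i)) //= [in RHS](bigD1 (i, j)) /=; last first.
  by rewrite xpair_eqE (negPf ij).
rewrite /s tpermL tpermR wij ji ltnS leqnn (ltnNge (b (w j))) (ltnW wij) andbF.
rewrite ltnNge leqnSn /= add0n add0n add1n; congr _.+1.
by apply: eq_bigr => -[p q] /= /andP[pj pi]; rewrite adj_ltn.
Qed.

Lemma adj_monotone w :
  (forall i j, j = i.+1 :> nat -> (b (w i) <= b (w j))%N) ->
  forall p q, (p <= q)%N -> (b (w p) <= b (w q))%N.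
Proof.
move=> wS p q; move: {2}(q - p)%N (erefl (q - p)%N) => m.
elim: m p q => [|m IH] p q qp pq.
  by rewrite (_ : p = q) //; apply: val_inj => /=; lia.
have pn : (p.+1 < n)%N by have := ltn_ord q; lia.
apply: leq_trans (wS p (Ordinal pn) erefl) _.
by apply: IH => /=; lia.
Qed.

(** Every permutation is reached from one that is monotone for the labels by
    adjacent transpositions each of which creates one inversion. *)
Lemma inv_ind (P : 'S_n -> Prop) :
  (forall w, (forall p q, (p <= q)%N -> (b (w p) <= b (w q))%N) -> P w) ->
  (forall w i j, j = i.+1 :> nat -> (b (w i) < b (w j))%N -> P w ->
     P (tperm i j * w)%g) ->
  forall w, P w.
Proof.
move=> P0 PS w; move: {2}(inv w) (leqnn (inv w)) => m.
elim: m w => [|m IH] w wm.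
all: case: (pselect (forall i j, j = i.+1 :> nat -> (b (w i) <= b (w j))%N))
  => [/adj_monotone /P0 // | NP].
all: have /existsNP[i /existsNP[j /not_implyP[ji /negP]]] := NP.
all: rewrite -ltnNge => wji.
all: have wE : w = (tperm i j * (tperm i j * w))%g by rewrite mulgA tperm2 mul1g.
all: have := @inv_ascent (tperm i j * w)%g i j ji.
all: rewrite !permM tpermL tpermR -wE => /(_ wji) invE.
  by rewrite invE in wm.
by rewrite wE; apply: PS => //; rewrite ?permM ?tpermL ?tpermR //; apply: IH; lia.
Qed.

Lemma monotone_perm w :
  (forall p q, (p <= q)%N -> (b p <= b q)%N) ->
  (forall p q, (p <= q)%N -> (b (w p) <= b (w q))%N) ->
  forall p, b (w p) = b p.
Proof.
move=> bP bwP p.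
have sorted_enum (f : 'I_n -> nat) : (forall p q, (p <= q)%N -> (f p <= f q)%N) ->
    sorted leq [seq f p | p <- enum 'I_n].
  move=> fP; rewrite sorted_map; apply: (@sub_sorted _ (relpre val leq)).
    by move=> x y /fP.
  by rewrite -sorted_map val_enum_ord iota_sorted.
have E : [seq b (w p) | p <- enum 'I_n] = [seq b p | p <- enum 'I_n].
  apply: (sorted_eq leq_trans anti_leq); rewrite ?sorted_enum //.
  rewrite (map_comp b w); apply: perm_map; apply: uniq_perm.
  - by rewrite map_inj_uniq ?enum_uniq //; apply: perm_inj.
  - exact: enum_uniq.
  - move=> q; rewrite mem_enum; apply/mapP; exists (w^-1 q)%g.
      by rewrite mem_enum.
    by rewrite permKV.
have nthE (f : 'I_n -> nat) : nth 0%N [seq f q | q <- enum 'I_n] p = f p.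
  by rewrite (nth_map p) ?size_enum_ord // nth_ord_enum.
by have := nthE (b \o w); rewrite E nthE => ->.
Qed.

End Inversions.

(** * The ring of additive endomorphisms *)

Section Endomorphisms.
Variable V : zmodType.

Record endo := Endo { endo_fun :> V -> V; endoB : zmod_morphism endo_fun }.

Lemma endoP (f g : endo) : f =1 g -> f = g.
Proof.
case: f g => [f fP] [g gP] /= /funext fg; subst g.
by congr Endo; apply: Prop_irrelevance.
Qed.

HB.instance Definition _ := gen_eqMixin endo.
HB.instance Definition _ := gen_choiceMixin endo.

Lemma endo0 (f : endo) : f 0 = 0.
Proof. by have := endoB f 0 0; rewrite !subrr. Qed.
Lemma endoD (f : endo) x y : f (x + y) = f x + f y.
Proof. by rewrite -{1}(opprK y) -(sub0r y) !endoB endo0 sub0r opprK. Qed.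

Fact endo_add_zmod (f g : endo) : zmod_morphism (fun x => f x + g x).
Proof. by move=> x y; rewrite !endoB opprD addrACA. Qed.
Fact endo_zero_zmod : zmod_morphism (fun _ : V => 0 : V).
Proof. by move=> x y; rewrite subrr. Qed.
Fact endo_opp_zmod (f : endo) : zmod_morphism (fun x => - f x).
Proof. by move=> x y; rewrite endoB opprB addrC opprK. Qed.
Fact endo_one_zmod : zmod_morphism (@id V). Proof. by []. Qed.
Fact endo_mul_zmod (f g : endo) : zmod_morphism (fun x => f (g x)).
Proof. by move=> x y; rewrite !endoB. Qed.

Definition endo_add f g := Endo (endo_add_zmod f g).
Definition endo_zero := Endo endo_zero_zmod.
Definition endo_opp f := Endo (endo_opp_zmod f).
Definition endo_one := Endo endo_one_zmod.
Definition endo_mul f g := Endo (endo_mul_zmod f g).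

Fact endo_addA : associative endo_add.
Proof. by move=> f g h; apply: endoP => x /=; rewrite addrA. Qed.
Fact endo_addC : commutative endo_add.
Proof. by move=> f g; apply: endoP => x /=; rewrite addrC. Qed.
Fact endo_add0 : left_id endo_zero endo_add.
Proof. by move=> f; apply: endoP => x /=; rewrite add0r. Qed.
Fact endo_addN : left_inverse endo_zero endo_opp endo_add.
Proof. by move=> f; apply: endoP => x /=; rewrite addNr. Qed.
HB.instance Definition _ := GRing.isZmodule.Build endo
  endo_addA endo_addC endo_add0 endo_addN.

Fact endo_mulA : associative endo_mul.
Proof. by move=> f g h; apply: endoP. Qed.
Fact endo_mul1l : left_id endo_one endo_mul.
Proof. by move=> f; apply: endoP. Qed.
Fact endo_mul1r : right_id endo_one endo_mul.
Proof. by move=> f; apply: endoP. Qed.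
Fact endo_mulDl : left_distributive endo_mul endo_add.
Proof. by move=> f g h; apply: endoP. Qed.
Fact endo_mulDr : right_distributive endo_mul endo_add.
Proof. by move=> f g h; apply: endoP => x /=; rewrite endoD. Qed.
HB.instance Definition _ := GRing.Zmodule_isPzRing.Build endo
  endo_mulA endo_mul1l endo_mul1r endo_mulDl endo_mulDr.

Lemma endo_addE (f g : endo) x : (f + g) x = f x + g x. Proof. by []. Qed.
Lemma endo_mulE (f g : endo) x : (f * g) x = f (g x). Proof. by []. Qed.

End Endomorphisms.

Section EndModule.
Variables (H : pzRingType) (V : zmodType) (rho : {rmorphism H -> endo V}).

(** The additive group [V] as a module through [rho], which is kept in the type
    so that different actions give different modules. *)
Definition endmod of {rmorphism H -> endo V} : Type := V.
HB.instance Definition _ := GRing.Zmodule.on (endmod rho).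

Definition endmod_scale (h : H) (x : endmod rho) : endmod rho := rho h x.
Fact endmod_scaleA a b x :
  endmod_scale a (endmod_scale b x) = endmod_scale (a * b) x.
Proof. by rewrite /endmod_scale rmorphM. Qed.
Fact endmod_scale1 : left_id 1 endmod_scale.
Proof. by move=> x; rewrite /endmod_scale rmorph1. Qed.
Fact endmod_scaleDr : right_distributive endmod_scale +%R.
Proof. by move=> a x y; exact: (endoD (rho a) x y). Qed.
Fact endmod_scaleDl x : {morph endmod_scale^~ x : a b / a + b}.
Proof. by move=> a b; rewrite /endmod_scale rmorphD. Qed.
HB.instance Definition _ := GRing.Zmodule_isLmodule.Build H (endmod rho)
  endmod_scaleA endmod_scale1 endmod_scaleDr endmod_scaleDl.

End EndModule.

(** * The principal series *)

Section PrincipalSeries.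
Variables (A : comNzRingType) (n : nat) (b : 'I_n -> A).
Local Notation V := {ffun 'S_n -> A}.
Local Notation G := [set: 'S_n]%G.
Implicit Types (psi : V) (u v w : 'S_n) (i j k l : 'I_n).

(** The coefficient that moving epsilon_k past N_w produces at the transposition of
    the places k and j. *)
Definition straighten w k j : A :=
  ((k < j) && (w k < w j))%N%:R - ((j < k) && (w j < w k))%N%:R.

Definition ps_cst_fun (c : A) psi : V := [ffun w : 'S_n => c * psi w].
Definition ps_N_fun u psi : V := [ffun w : 'S_n => psi (u^-1 * w)%g].
(** On functions on the symmetric group, N_u acts by translation.  The formula is
    forced: epsilon_k has to multiply the delta function at 1 by [b k] and to
    satisfy the cross relations. *)
Definition ps_E_fun k psi : V := [ffun w : 'S_n => b (w k) * psi w +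
  \sum_j straighten w k j * psi (tperm k j * w)%g].

Fact ps_cst_zmod c : zmod_morphism (ps_cst_fun c).
Proof. by move=> f g; apply/ffunP => w; rewrite !ffunE mulrBr. Qed.
Fact ps_N_zmod u : zmod_morphism (ps_N_fun u).
Proof. by move=> f g; apply/ffunP => w; rewrite !ffunE. Qed.
Fact ps_E_zmod k : zmod_morphism (ps_E_fun k).
Proof.
move=> f g; apply/ffunP => w; rewrite !ffunE mulrBr opprD addrACA; congr (_ + _).
by rewrite -sumrB; apply: eq_bigr => j _; rewrite !ffunE mulrBr.
Qed.
Definition ps_cst c := Endo (ps_cst_zmod c).
Definition ps_N u := Endo (ps_N_zmod u).
Definition ps_E k := Endo (ps_E_zmod k).

Fact ps_cst_is_zmod : zmod_morphism ps_cst.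
Proof.
by move=> c d; apply: endoP => f; apply/ffunP => w; rewrite !ffunE mulrBl.
Qed.
Fact ps_cst_is_monoid : monoid_morphism ps_cst.
Proof.
split; first by apply: endoP => f; apply/ffunP => w; rewrite !ffunE mul1r.
by move=> c d; apply: endoP => f; apply/ffunP => w; rewrite !ffunE mulrA.
Qed.
HB.instance Definition _ := GRing.isZmodMorphism.Build A (endo V) ps_cst
  ps_cst_is_zmod.
HB.instance Definition _ := GRing.isMonoidMorphism.Build A (endo V) ps_cst
  ps_cst_is_monoid.

Definition ps_gen (g : hgen G) : endo V :=
  match g with HN w => ps_N (sgval w) | HE k => ps_E k end.

Lemma ps_NM u v : ps_N u * ps_N v = ps_N (u * v)%g.
Proof. by apply: endoP => f; apply/ffunP => w; rewrite !ffunE invMg mulgA. Qed.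

Fact ps_central c g : ps_cst c * ps_gen g = ps_gen g * ps_cst c.
Proof.
case: g => [u|k]; apply: endoP => f; apply/ffunP => w; rewrite !ffunE //.
rewrite mulrDr mulr_sumr mulrCA; congr (_ + _); apply: eq_bigr => j _.
by rewrite !ffunE mulrCA.
Qed.

(** The one pair whose order changes accounts for the constant of the cross
    relation. *)
Lemma straighten_adj i j w k l : j = i.+1 :> nat ->
  straighten w k l =
  straighten (tperm i j * w)%g (tperm i j k) (tperm i j l) +
    (((k, l) == (i, j))%:R - ((k, l) == (j, i))%:R).
Proof.
move=> ji; have ij : i != j by rewrite -val_eqE /= ji neq_ltn leqnn.
have ltij : (i < j)%N by rewrite ji.
have ltji : (j < i)%N = false by rewrite ji ltnNge leqnSn.
have wij : w i != w j :> nat by rewrite (inj_eq val_inj) (inj_eq perm_inj).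
rewrite /straighten !permM !tpermK.
have [[-> ->]|kl1] := eqVneq (k, l) (i, j).
  rewrite tpermL tpermR ltij ltji xpair_eqE (negPf ij) /=.
  by move: wij; case: ltngtP => //= _ _; ring.
have [[-> ->]|kl2] := eqVneq (k, l) (j, i).
  rewrite tpermL tpermR ltij ltji /=.
  by move: wij; case: ltngtP => //= _ _; ring.
rewrite subrr addr0 !adj_ltn //.
  by apply: contraNneq kl2 => -[-> ->].
by apply: contraNneq kl1 => -[-> ->].
Qed.

Lemma ps_cross i j k : j = i.+1 :> nat ->
  ps_E k * ps_N (tperm i j) =
  ps_N (tperm i j) * ps_E (tperm i j k) + ps_cst ((k == i)%:R - (k == j)%:R).
Proof.
move=> ji; have ij : i != j by rewrite -val_eqE /= ji neq_ltn leqnn.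
set s := tperm i j.
apply: endoP => f; apply/ffunP => w; rewrite endo_addE !endo_mulE !ffunE.
rewrite tpermV permM tpermK -addrA; congr (_ + _).
rewrite [X in _ = X + _](reindex_inj (@perm_inj _ s)) /=.
under eq_bigr => l _ do
  rewrite ffunE (@straighten_adj i j) // -/s mulrDl tpermV -/s mulgA.
rewrite big_split /=; congr (_ + _).
  have sK (z : 'S_n) : (s * (s * z) = z)%g by rewrite mulgA tperm2 mul1g.
  by apply: eq_bigr => l _; rewrite -tpermJ /conjg tpermV -/s -!mulgA sK.
have [->|ki] := eqVneq k i.
  rewrite (negPf ij) subr0 mul1r (bigD1 j) //= big1 => [|l lj].
    by rewrite eqxx xpair_eqE (negPf ij) subr0 mul1r addr0 /s tperm2 mul1g.
  by rewrite !xpair_eqE (negPf lj) (negPf ij) andbF subrr mul0r.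
have [->|kj] := eqVneq k j.
  rewrite sub0r (bigD1 i) //= big1 => [|l li].
    rewrite eqxx xpair_eqE (eq_sym j) (negPf ij) sub0r addr0.
    by rewrite (tpermC j i) /s tperm2 mul1g.
  by rewrite !xpair_eqE (negPf li) (eq_sym j) (negPf ij) andbF subrr mul0r.
rewrite big1 ?subrr ?mul0r // => l _.
by rewrite !xpair_eqE (negPf ki) (negPf kj) subrr mul0r.
Qed.

Definition ps_delta u : V := [ffun w : 'S_n => (w == u)%:R].

Lemma ps_N_delta u v : ps_N u (ps_delta v) = ps_delta (u * v)%g.
Proof.
apply/ffunP => w; rewrite !ffunE; congr (nat_of_bool _)%:R.
by rewrite -(inj_eq (mulgI u^-1%g) w) mulKg.
Qed.

Lemma ps_delta_span psi :
  psi = \sum_w ps_cst (psi w) (ps_N w (ps_delta 1%g)).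
Proof.
under eq_bigr => u _ do rewrite ps_N_delta mulg1.
apply/ffunP => w; rewrite sum_ffunE (bigD1 w) //= big1 => [|u uw].
  by rewrite !ffunE eqxx mulr1 addr0.
by rewrite !ffunE eq_sym (negPf uw) mulr0.
Qed.

Lemma ps_E_delta k : ps_E k (ps_delta 1%g) = ps_cst (b k) (ps_delta 1%g).
Proof.
apply/ffunP => w; rewrite !ffunE big1 ?addr0 => [|j _].
  by have [->|] := eqVneq w 1%g; rewrite ?mulr0 // perm1.
rewrite !ffunE; have [wE|] := eqVneq (tperm k j * w)%g 1%g; rewrite ?mulr0 //.
have -> : w = tperm k j by rewrite -[RHS]mulg1 -wE mulgA tperm2 mul1g.
rewrite /straighten tpermL tpermR.
by case: ltngtP => _ /=; rewrite subrr mul0r.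
Qed.

Let shift i j k : A := (k == i)%:R - (k == j)%:R.

Lemma ps_E_tperm i j k :
  ps_E (tperm i j k) = ps_E k - ps_cst (shift i j k) * (ps_E i - ps_E j).
Proof.
rewrite /shift; have [->|ij] := eqVneq i j.
  by rewrite tperm1 perm1 subrr rmorph0 mul0r subr0.
have [->|ki] := eqVneq k i.
  by rewrite tpermL (negPf ij) subr0 rmorph1 mul1r subKr.
have [->|kj] := eqVneq k j.
  by rewrite tpermR sub0r rmorphN1 mulN1r opprK addrC subrK.
by rewrite tpermD 1?eq_sym // subrr rmorph0 mul0r subr0.
Qed.

(** By the cross relations the commutator of epsilon_k and epsilon_l satisfies
    [D k l * N_s = N_s * D (s k) (s l)] with no further term, and it kills the delta
    function at 1, which generates. *)
Lemma ps_EC k l : ps_E k * ps_E l = ps_E l * ps_E k.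
Proof.
pose D k l := ps_E k * ps_E l - ps_E l * ps_E k.
suff DN w : forall k l, D k l (ps_N w (ps_delta 1%g)) = 0.
  apply/eqP; rewrite -subr_eq0 -/(D k l); apply/eqP/endoP => psi.
  rewrite [psi in LHS]ps_delta_span.
  elim/big_rec: _ => [|w x _ IH]; first exact: endo0.
  rewrite endoD IH addr0 -endo_mulE /D mulrBl -!mulrA.
  have cE c m : ps_E m * ps_cst c = ps_cst c * ps_E m.
    by rewrite (ps_central c (HE m)).
  by rewrite !cE !mulrA !cE -!mulrA -mulrBr endo_mulE -/(D k l) DN endo0.
elim/(@inv_ind n (@nat_of_ord n)): w => [w wP|w i j ji _ IH] {}k {}l.
  have -> : w = 1%g.
    apply/permP => i; rewrite perm1; apply: val_inj.
    exact: (@monotone_perm n (@nat_of_ord n)).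
  have Ecst m c x : ps_E m (ps_cst c x) = ps_cst c (ps_E m x).
    by rewrite -!endo_mulE (ps_central _ (HE m)).
  have -> : D k l (ps_N 1%g (ps_delta 1%g)) =
      ps_E k (ps_E l (ps_delta 1%g)) - ps_E l (ps_E k (ps_delta 1%g)).
    by rewrite ps_N_delta mulg1.
  rewrite !ps_E_delta !Ecst !ps_E_delta -!endo_mulE -!rmorphM mulrC.
  exact: subrr.
set s := tperm i j; pose c m := ps_cst (shift i j m).
have cE m p : ps_E p * c m = c m * ps_E p by rewrite (ps_central _ (HE p)).
have EEN m p : ps_E m * ps_E p * ps_N s =
    ps_N s * (ps_E (s m) * ps_E (s p)) +
    (c m * ps_E (s p) + c p * ps_E m).
  rewrite -mulrA (ps_cross _ ji) -/(shift i j p) mulrDr mulrA (ps_cross _ ji).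
  by rewrite -/(shift i j m) mulrDl mulrA -/(c p) -/(c m) cE addrA.
have -> : D k l (ps_N (s * w)%g (ps_delta 1%g)) =
    (D k l * ps_N s) (ps_N w (ps_delta 1%g)) by rewrite -ps_NM.
have -> : D k l * ps_N s = ps_N s * D (s k) (s l).
  rewrite /D mulrBl mulrBr !EEN opprD addrACA [X in _ + X](_ : _ = 0) ?addr0 //.
  rewrite /s !ps_E_tperm -/(c k) -/(c l); move: (ps_E i - ps_E j) => xi.
  have ckl : c l * (c k * xi) = c k * (c l * xi).
    by rewrite !mulrA -!rmorphM mulrC.
  rewrite !mulrBr ckl; apply/eqP; rewrite subr_eq0; apply/eqP.
  by rewrite addrAC [RHS]addrC addrA.
by rewrite endo_mulE IH endo0.
Qed.

Fact ps_rel x y : hrel x y -> teval ps_cst ps_gen x = teval ps_cst ps_gen y.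
Proof.
case=> [|u v|i j|i j s {}x ji sij] /=.
- rewrite rmorph1; apply: endoP => f; apply/ffunP => w.
  by rewrite ffunE invg1 mul1g.
- exact: ps_NM.
- exact: ps_EC.
rewrite !(teval_lform ps_cst) /= sij.
have cE c k : ps_N (tperm i j) * ps_cst c = ps_cst c * ps_N (tperm i j).
  by have /= := ps_central c (HN (subg G (tperm i j))); rewrite subgK ?in_setT // => ->.
rewrite mulr_suml mulr_sumr.
under eq_bigr => k _ do rewrite -mulrA (ps_cross _ ji) mulrDr.
rewrite big_split /= [in RHS](reindex_inj (@perm_inj _ (tperm i j))) /=.
congr (_ + _).
  by apply: eq_bigr => k _; rewrite tpermK !mulrA cE.
under eq_bigr => k _ do rewrite -rmorphM /=.
rewrite -rmorph_sum /=; congr (ps_cst _).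
under eq_bigr => k _ do rewrite mulrBr !mulr_natr !mulrb.
by rewrite sumrB -!big_mkcond /= !big_pred1_eq.
Qed.

Definition ps_rep : {rmorphism hecke A G -> endo V} :=
  plift (PHom ps_central ps_rel).

Definition principal : lmodType (hecke A G) := endmod ps_rep.

Lemma principal_N (u : [subg G]) (psi : principal) : hN A u *: psi = ps_N (sgval u) psi.
Proof.
exact: (congr1 (fun f : endo V => f psi)
  (plift_gen (PHom ps_central ps_rel) (HN u))).
Qed.
Lemma principal_E k (psi : principal) : @hE A n G k *: psi = ps_E k psi.
Proof.
exact: (congr1 (fun f : endo V => f psi)
  (plift_gen (PHom ps_central ps_rel) (HE k))).
Qed.
Lemma principal_cst c (psi : principal) : hcst c *: psi = ps_cst c psi.
Proof.
exact: (congr1 (fun f : endo V => f psi)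
  (plift_cst (PHom ps_central ps_rel) c)).
Qed.

End PrincipalSeries.

(** * Labellings of the sixteen places *)

Section Labels.
Implicit Types (w u : 'S_16) (i j k p q : 'I_16).

(** The label at place [p] of the coset of [w]: the block from which the strand at
    place [p] comes. *)
Definition lab w p : 'I_4 := blk (w p).
Definition ninv : 'S_16 -> nat := inv (fun p => nat_of_ord (blk p)).

(** How many strands with the same label lie before place [k].  On a shuffle this
    is the position of the letter at [k] in its segment. *)
Definition pos (c : 'I_16 -> 'I_4) (k : 'I_16) : nat :=
  (\sum_(p < 16) ((p < k) && (c p == c k)))%N.

Lemma blkE p : blk p = (p %/ 4)%N :> nat.
Proof. by rewrite inordK // ltn_divLR. Qed.

Lemma blk_mono p q : (p <= q)%N -> (blk p <= blk q)%N.
Proof. by rewrite !blkE => /leq_div2r ->. Qed.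

Lemma youngP u : reflect (forall p, blk (u p) = blk p) (u \in young).
Proof. by rewrite inE; apply: (iffP forallP) => uP p; apply/eqP; rewrite uP. Qed.

(** Labels determine the coset modulo the Young subgroup. *)
Lemma lab_young w w' : lab w =1 lab w' -> (w^-1 * w')%g \in young.
Proof.
by move=> ww'; apply/youngP => p; rewrite permM -[in RHS](permKV w p) -/(lab w _) ww'.
Qed.

Lemma tperm_young p q : blk p = blk q -> tperm p q \in young.
Proof.
by move=> pq; apply/youngP => r; case: tpermP => [->|->|//]; rewrite pq.
Qed.

Lemma mono_young w :
  (forall p q, (p <= q)%N -> (blk (w p) <= blk (w q))%N) -> w \in young.
Proof.
move=> wP; apply/youngP => p; apply: val_inj.
exact: (@monotone_perm _ (fun p => nat_of_ord (blk p)) w blk_mono wP).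
Qed.

Lemma lab_tperm w i j k : lab (tperm i j * w)%g k = lab w (tperm i j k).
Proof. by rewrite /lab permM. Qed.

Lemma pos_tperm w i j k : j = i.+1 :> nat -> lab w i != lab w j ->
  pos (lab (tperm i j * w)%g) k = pos (lab w) (tperm i j k).
Proof.
move=> ji wij; have [l ->] : exists l, k = tperm i j l.
  by exists (tperm i j k); rewrite tpermK.
rewrite tpermK /pos (reindex_inj (@perm_inj _ (tperm i j))) /=.
apply: eq_bigr => p _; rewrite !lab_tperm !tpermK.
have [[-> ->]|pl1] := eqVneq (p, l) (i, j); first by rewrite (negPf wij) !andbF.
have [[-> ->]|pl2] := eqVneq (p, l) (j, i).
  by rewrite eq_sym (negPf wij) !andbF.
by rewrite adj_ltn.
Qed.

Lemma pos_blk k : pos blk k = (k %% 4)%N.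
Proof.
rewrite /pos; under eq_bigr => p _ do rewrite -val_eqE /= !blkE.
rewrite -(big_mkord xpredT (fun m : nat => nat_of_bool ((m < k) && (m %/ 4 == k %/ 4))%N)).
by case: k => m; do 16 (case: m => [|m]; first by rewrite unlock).
Qed.

End Labels.

(** * Relations in the Hecke algebra *)

Section HeckeRelations.
Variable A : comNzRingType.
Local Notation H := (H16 A).
Implicit Types (w u : 'S_16) (i j k : 'I_16).

(** The elements N_w and, below, epsilon_k of the algebra, indexed by the
    permutations themselves. *)
Definition NN w : H := hN A (subg [set: 'S_16]%G w).
Definition EE k : H := @hE A 16 [set: 'S_16]%G k.

Lemma NN1 : NN 1%g = 1.
Proof.
rewrite /NN -(hN1 A [set: 'S_16]%G); congr hN; apply: val_inj.
by rewrite /= subgK ?in_setT.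
Qed.

Lemma NNM u w : NN u * NN w = NN (u * w)%g.
Proof.
rewrite /NN hNM; congr hN; apply: val_inj.
by rewrite /= !subgK ?in_setT.
Qed.

Lemma EE_comm k l : EE k * EE l = EE l * EE k. Proof. exact: hEC. Qed.

Lemma EE_NN i j k : j = i.+1 :> nat ->
  EE k * NN (tperm i j) =
  NN (tperm i j) * EE (tperm i j k) + hcst ((k == i)%:R - (k == j)%:R).
Proof.
move=> ji; have sgE : sgval (subg [set: 'S_16]%G (tperm i j)) = tperm i j.
  by rewrite subgK ?in_setT.
have := @hcross A 16 [set: 'S_16]%G i j _ (fun l => (l == k)%:R) ji sgE.
have sumE l : \sum_m hcst (m == l)%:R * EE m = EE l.
  rewrite (bigD1 l) //= eqxx rmorph1 mul1r big1 ?addr0 // => m /negPf ->.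
  by rewrite rmorph0 mul0r.
rewrite sumE => /(canRL (subrK _)) ->; rewrite addrC (eq_sym k) (eq_sym k).
congr (_ * _ + _); rewrite -[RHS]sumE; apply: eq_bigr => m _.
by rewrite -(inj_eq (@perm_inj _ (tperm i j))) tpermK.
Qed.

(** Induction over ring expressions in the generators. *)
Lemma hecke_stable (M : lmodType H) (S : M -> Prop) :
  (forall x y, S x -> S y -> S (x + y)) ->
  (forall c x, S x -> S (hcst c *: x)) -> (forall w x, S x -> S (NN w *: x)) ->
  (forall k x, S x -> S (EE k *: x)) -> forall h x, S x -> S (h *: x).
Proof.
move=> SD Sc SN SE; elim/presW.
elim=> [c|[w|k]|h IHh h' IHh'|h IHh h' IHh'] x Sx.
- exact: Sc.
- by rewrite (_ : pcls _ _ = NN (sgval w)); [apply: SN|rewrite /NN sgvalK].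
- exact: SE.
- by rewrite pclsD scalerDl; apply: SD; [apply: IHh|apply: IHh'].
- by rewrite pclsM -scalerA; apply/IHh/IHh'.
Qed.

End HeckeRelations.

Local Notation "c ** x" := (hcst c *: x) (at level 40, left associativity).

Lemma scale_cst (A : comNzRingType) (M : lmodType (H16 A)) c h (x : M) :
  c ** (h *: x) = h *: (c ** x).
Proof. by rewrite !scalerA hcstC. Qed.

(** * The standard module and its inversion filtration *)

Section StandardModule.
Variables (A : comNzRingType) (a : 'I_4 -> A).
Local Notation H := (H16 A).
Local Notation X := (standard a).
Local Notation incl := (parabolic_incl A).
Implicit Types (w u : 'S_16) (i j : 'I_16).

Definition gen_vec : X := pure incl (L := seg_mod a) 1 (1 : A).
Local Notation v0 := gen_vec.

(** The eigenvalue of epsilon_k on the weight vector with labelling [c]. *)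
Definition wt (c : 'I_16 -> 'I_4) k : A := a (c k) + (pos c k)%:R.

Lemma incl_cst c : incl (hcst c) = hcst c.
Proof. exact: hmap_cst. Qed.

Lemma pure_gen h (l : A) :
  pure incl h (l : seg_mod a) = (h * hcst l) *: v0 :> X.
Proof.
rewrite /gen_vec scale_pure mulr1 -incl_cst pureM; congr pure.
rewrite restr_scaleE; have -> : seg_char a (hcst l) = l.
  exact: (seg_char_cst a l).
exact/esym/mulr1.
Qed.

Lemma gen_char p : incl p *: v0 = seg_char a p ** v0.
Proof.
have := @pure_gen 1 (seg_char a p); rewrite mul1r => <-.
rewrite /gen_vec scale_pure mulr1 -[incl p]mul1r pureM; congr pure.
rewrite restr_scaleE; exact: mulr1.
Qed.

Lemma gen_NN u : u \in young -> NN A u *: v0 = (-1) ^+ u ** v0.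
Proof.
move=> uy; have <- : incl (pgen _ (HN (subg young u))) = NN A u.
  rewrite /parabolic_incl hmap_gen_E /= /NN; congr hN.
  by rewrite subgK.
by rewrite gen_char seg_char_gen /= subgK.
Qed.

Lemma gen_EE k : EE A k *: v0 = wt blk k ** v0.
Proof.
have <- : incl (pgen _ (HE k)) = EE A k.
  by rewrite /parabolic_incl hmap_gen_E.
by rewrite gen_char seg_char_gen /= /wt pos_blk.
Qed.

Lemma standard_gen (x : X) : exists h, x = h *: v0.
Proof.
elim/(@ext_ind _ _ incl): x => [|h l|x y [h ->] [h' ->]].
- by exists 0; rewrite scale0r.
- by exists (h * hcst (l : A)); rewrite -pure_gen.
- by exists (h + h'); rewrite scalerDl.
Qed.

Section Universal.
Variables (M : lmodType H) (m : M).
Hypothesis mN : forall u, u \in young -> NN A u *: m = (-1) ^+ u ** m.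
Hypothesis mE : forall k, EE A k *: m = wt blk k ** m.

(** Frobenius reciprocity: a vector on which the generators of the parabolic
    subalgebra act by the inducing character spans a copy of that character. *)
Lemma universal_char p : incl p *: m = seg_char a p ** m.
Proof.
elim/presW: p; elim=> [c|[w|k]|x IHx y IHy|x IHx y IHy].
- have -> : incl (pcls _ (TCst c)) = hcst c by apply: hmap_cst.
  by rewrite (seg_char_cst a c : seg_char a (pcls _ (TCst c)) = c).
- have -> : incl (pcls _ (TGen (HN w))) = NN A (sgval w).
    by rewrite /parabolic_incl (hmap_gen_E _ _ (HN w)).
  by rewrite (seg_char_gen a (HN w) :
    seg_char a (pcls _ (TGen (HN w))) = _) mN ?subgP.
- have -> : incl (pcls _ (TGen (HE k))) = EE A k.
    by rewrite /parabolic_incl (hmap_gen_E _ _ (HE k)).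
  by rewrite (seg_char_gen a (HE k) :
    seg_char a (pcls _ (TGen (HE k))) = _) mE /wt pos_blk.
- by rewrite pclsD !rmorphD !scalerDl IHx IHy.
- rewrite pclsM [incl _]rmorphM -scalerA IHy scalerA -hcstC -scalerA IHx.
  by rewrite scalerA -rmorphM [in RHS]rmorphM /= mulrC.
Qed.

Definition universal_fun : X -> M :=
  elift (fun h (l : seg_mod a) => (h * hcst (l : A)) *: m).

Lemma universal_balanced :
  balanced incl (fun h (l : seg_mod a) => (h * hcst (l : A)) *: m).
Proof.
split=> [h h' l|h l l'|h p l].
- by rewrite mulrDl scalerDl.
- by rewrite rmorphD mulrDr scalerDl.
- rewrite restr_scaleE /= -!scalerA; congr (h *: _).
  rewrite scalerA -hcstC -scalerA universal_char !scalerA -!rmorphM.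
  by rewrite mulrC.
Qed.

Fact universal_linear : linear universal_fun.
Proof.
move=> h x y; rewrite /universal_fun (eliftD universal_balanced); congr (_ + _).
elim/(@ext_ind _ _ incl): x => [|h' l|x x' IHx IHx'].
- have e0 : universal_fun 0 = 0.
    apply: (addIr (universal_fun 0)); rewrite add0r.
    by rewrite -[LHS](eliftD universal_balanced 0 0) addr0.
  by rewrite scaler0 -/(universal_fun 0) e0 scaler0.
- by rewrite scale_pure !(elift_pure universal_balanced) scalerA mulrA.
- by rewrite scalerDr !(eliftD universal_balanced) IHx IHx' scalerDr.
Qed.
HB.instance Definition _ := GRing.isLinear.Build H X M _ universal_fun
  universal_linear.

Definition universal_map : {linear X -> M} := universal_fun.

Lemma universal_gen h : universal_map (h *: v0) = h *: m.
Proof.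
rewrite linearZ /=; congr (h *: _).
by rewrite /universal_fun (elift_pure universal_balanced) mul1r rmorph1 scale1r.
Qed.

End Universal.

Local Notation nn w := (NN A w *: v0).

Lemma nn_mul_young w u : u \in young ->
  nn (w * u)%g = (-1) ^+ u ** nn w.
Proof.
by move=> uy; rewrite -NNM -scalerA gen_NN // scalerA -hcstC scalerA.
Qed.

(** Since the Young subgroup acts on the generator by sign, N_w applied to the
    generator depends up to sign on the labels only. *)
Lemma nn_lab w w' : lab w =1 lab w' -> exists e : bool, nn w' = (-1) ^+ e ** nn w.
Proof.
move=> /lab_young uy; exists (w^-1 * w')%g; rewrite -nn_mul_young //.
by rewrite mulgA mulgV mul1g.
Qed.

(** The span of the N_w applied to the generator with fewer than [k] label
    inversions. *)
Inductive filt (k : nat) : X -> Prop :=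
  | filt0 : filt k 0
  | filt_nn c w of (ninv w < k)%N : filt k (c ** nn w)
  | filtD x y of filt k x & filt k y : filt k (x + y).

Lemma filt_cst k c x : filt k x -> filt k (c ** x).
Proof.
elim=> [|d w wk|y z _ IHy _ IHz].
- by rewrite scaler0; apply: filt0.
- by rewrite scalerA -rmorphM; apply: filt_nn.
- by rewrite scalerDr; apply: filtD.
Qed.

Lemma filt_le k l x : (k <= l)%N -> filt k x -> filt l x.
Proof.
move=> kl; elim=> [|d w wk|y z _ IHy _ IHz].
- exact: filt0.
- exact/filt_nn/(leq_trans wk).
- exact: filtD.
Qed.

Lemma filt_nn1 k w : (ninv w < k)%N -> filt k (nn w).
Proof. by rewrite -(scale1r (nn w)) -(rmorph1 hcst); apply: filt_nn. Qed.

Lemma filtB k x y : filt k x -> filt k y -> filt k (x - y).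
Proof.
move=> xk yk; apply: filtD => //.
by rewrite -scaleN1r -(rmorphN1 hcst); apply: filt_cst.
Qed.

(** If the two places carry the same label, then N_s only changes the sign of the
    vector; otherwise it changes the number of inversions by one. *)
Lemma filt_NN k x i j : j = i.+1 :> nat ->
  filt k x -> filt k.+1 (NN A (tperm i j) *: x).
Proof.
move=> ji; elim=> [|c w wk|y z _ IHy _ IHz].
- by rewrite scaler0; apply: filt0.
- rewrite scalerA -hcstC -scalerA; apply: filt_cst.
  rewrite scalerA NNM; case: (ltngtP (blk (w i)) (blk (w j))) => wij.
  + by apply: filt_nn1; rewrite /ninv (inv_ascent ji wij).
  + apply: filt_nn1; have := @inv_ascent _ (fun p => blk p) (tperm i j * w)%g i j ji.
    rewrite !permM tpermL tpermR => /(_ wij).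
    rewrite mulgA tperm2 mul1g => wE; rewrite /ninv in wk *.
    by apply: leqW; apply: ltnW; rewrite wE in wk.
  + have -> : (tperm i j * w = w * tperm (w i) (w j))%g.
      by rewrite -tpermJ /conjg mulKVg.
    rewrite nn_mul_young ?tperm_young //; last exact: val_inj.
    exact/filt_nn/ltnW.
- by rewrite scalerDr; apply: filtD.
Qed.

(** The basic triangularity.  Moving epsilon_k past the last N_s costs a constant,
    which has one inversion less; the leading term follows the strands. *)
Lemma lead_EE w k : filt (ninv w) (EE A k *: nn w - wt (lab w) k ** nn w).
Proof.
elim/(@inv_ind _ (fun p => nat_of_ord (blk p))): w k => [w wP|w i j ji wij IH] k.
  have wy := mono_young wP; rewrite gen_NN // scalerA -hcstC -scalerA gen_EE.
  rewrite scalerA [X in _ - X]scalerA -!rmorphM mulrC.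
  rewrite (_ : wt (lab w) k = wt blk k) ?subrr; first exact: filt0.
  have lw : lab w =1 blk by move=> p; apply: (youngP _ wy).
  by rewrite /wt /pos lw; congr (_ + _%:R); apply: eq_bigr => p _; rewrite lw.
have lwij : lab w i != lab w j by rewrite -val_eqE neq_ltn wij.
rewrite -NNM -scalerA scalerA (EE_NN _ _ ji) scalerDl -scalerA.
have -> : wt (lab (tperm i j * w)%g) k = wt (lab w) (tperm i j k).
  by rewrite /wt lab_tperm pos_tperm.
rewrite addrAC (scale_cst _ (NN A _)) -scalerBr.
rewrite /ninv (inv_ascent ji wij) -/(ninv w); apply: filtD.
  by apply: filt_NN.
by apply: filt_nn.
Qed.

Lemma filt_EE k x l : filt k x -> filt k (EE A l *: x).
Proof.
elim=> [|c w wk|y z _ IHy _ IHz].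
- by rewrite scaler0; apply: filt0.
- rewrite scalerA -hcstC -scalerA; apply: filt_cst.
  rewrite -(subrK (wt (lab w) l ** nn w) (EE A l *: _)); apply: filtD.
    exact: filt_le (ltnW wk) (lead_EE w l).
  exact: filt_nn.
- by rewrite scalerDr; apply: filtD.
Qed.

(** There are 256 pairs of places, whence the bound. *)
Lemma filt_all x : filt 257 x.
Proof.
have ninv256 w : (ninv w < 257)%N.
  rewrite ltnS /ninv /inv (@leq_trans (\sum_(pq : 'I_16 * 'I_16) 1)%N) //.
    by apply: leq_sum => pq _; case: andb.
  by rewrite sum1_card card_prod !card_ord.
have [h ->] := standard_gen x; apply: hecke_stable => {h x}.
- by move=> x y; apply: filtD.
- by move=> c x; apply: filt_cst.
- move=> u x; elim=> [|c w wk|y z _ IHy _ IHz].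
  + by rewrite scaler0; apply: filt0.
  + by rewrite -scale_cst [NN A u *: _]scalerA NNM; apply: filt_nn.
  + by rewrite scalerDr; apply: filtD.
- by move=> l x; apply: filt_EE.
- by rewrite -(scale1r v0) -NN1; apply: filt_nn1.
Qed.

End StandardModule.

(** * The standard module inside the principal series *)

Section Embedding.
Variables (A : comNzRingType) (a : 'I_4 -> A).
Local Notation H := (H16 A).
Local Notation X := (standard a).
Local Notation v0 := (gen_vec a).
Implicit Types (w u g : 'S_16) (i j k : 'I_16).

(** The segments are read backwards here: the sign vector of a principal series has
    increasing eigenvalues if the starting weight decreases in each block. *)
Definition rev_wt k : A := a (blk k) + (3 - k %% 4)%N%:R.
Local Notation P := (principal rev_wt).

Definition sign_vec : {ffun 'S_16 -> A} :=
  [ffun w : 'S_16 => (w \in young)%:R * (-1) ^+ w].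

(** On a pair of places, counting the pairs in order before and after and
    counting the order before minus the reverse order after is the same. *)
Lemma straightenE w k j :
  straighten A w k j = (k < j)%N%:R - (w j < w k)%N%:R.
Proof.
rewrite /straighten; have [->|kj] := eqVneq k j; first by rewrite !ltnn subrr.
have : k != j :> nat by rewrite (inj_eq val_inj).
have : w k != w j :> nat by rewrite (inj_eq val_inj) (inj_eq perm_inj).
by case: (ltngtP (w k)) => // _ _; case: (ltngtP k) => // _ _ /=; ring.
Qed.

Lemma block_above k : (\sum_(j < 16) ((k < j) && (blk j == blk k)) = 3 - k %% 4)%N.
Proof.
under eq_bigr => p _ do rewrite -val_eqE /= !blkE.
rewrite -(big_mkord xpredT
  (fun m : nat => nat_of_bool ((k < m) && (m %/ 4 == k %/ 4))%N)).
by case: k => m; do 16 (case: m => [|m]; first by rewrite unlock).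
Qed.

Lemma block_straighten w k : w \in young ->
  \sum_(j | blk j == blk k) straighten A w k j =
  (3 - k %% 4)%N%:R - (w k %% 4)%N%:R.
Proof.
move=> wy; under eq_bigr => j _ do rewrite straightenE.
rewrite sumrB -block_above -(pos_blk (w k)) /pos !natr_sum; congr (_ - _).
  by rewrite big_mkcond; apply: eq_bigr => j _; rewrite andbC; case: eqP.
rewrite [in RHS](reindex_inj (@perm_inj _ w)) big_mkcond.
by apply: eq_bigr => j _ /=; rewrite !(youngP _ wy) andbC; case: eqP.
Qed.

Lemma sign_vec_NN u : u \in young -> NN A u *: (sign_vec : P) = (-1) ^+ u ** (sign_vec : P).
Proof.
move=> uy; rewrite /NN principal_N principal_cst subgK ?in_setT //.
apply/ffunP => w; rewrite !ffunE groupMl ?groupV // mulrCA; congr (_ * _).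
by rewrite odd_permM odd_permV signr_addb.
Qed.

(** Outside the Young subgroup the terms vanish one by one.  Inside, each transposition
    of the block changes the sign, and the sum of the coefficients is
    (3 - r) - q, where r and q are the ranks of k and w k in their block. *)
Lemma sign_vec_EE k : EE A k *: (sign_vec : P) = wt a blk k ** (sign_vec : P).
Proof.
rewrite /EE principal_E principal_cst.
apply/ffunP => w; rewrite !ffunE /wt pos_blk.
have [wy|wy] := boolP (w \in young); last first.
  rewrite !mul0r !mulr0 add0r big1 // => j _; rewrite !ffunE.
  have [vy|] := boolP (tperm k j * w \in young)%g; last by rewrite mul0r mulr0.
  have vE : w = (tperm k j * (tperm k j * w))%g by rewrite mulgA tperm2 mul1g.
  have kj : blk k != blk j.
    by apply: contraNneq wy => kj; rewrite vE groupM // tperm_young.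
  have wj : blk (w j) = blk k by rewrite vE permM tpermR (youngP _ vy).
  have wk : blk (w k) = blk j by rewrite vE permM tpermL (youngP _ vy).
  have ltb p q : (blk p < blk q)%N -> (p < q)%N.
    by apply: contraTltn; rewrite -leqNgt; apply: blk_mono.
  suff -> : straighten A w k j = 0 by rewrite mul0r.
  rewrite straightenE; move: kj; rewrite -val_eqE neq_ltn => /orP[] kj.
    by rewrite (ltb _ _ kj) (ltb (w j)) ?wj ?wk // subrr.
  rewrite [in X in X - _]ltnNge (ltnW (ltb _ _ kj)).
  by rewrite [in X in _ - X]ltnNge (ltnW (ltb (w k) (w j) _)) ?wj ?wk // subrr.
transitivity ((rev_wt (w k) - \sum_(j | blk j == blk k) straighten A w k j) *
    (-1) ^+ w).
  rewrite mul1r mulrBl; congr (_ + _); rewrite mulr_suml -sumrN.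
  rewrite [RHS]big_mkcond; apply: eq_bigr => j _; rewrite !ffunE.
  case: eqP => [kj|kj]; last first.
    rewrite groupMr // (_ : tperm k j \in young = false) ?mul0r ?mulr0 //.
    apply/negP => /youngP/(_ k); rewrite tpermL => /esym; exact/nesym.
  rewrite groupM ?tperm_young // mul1r odd_permM odd_tperm signr_addb.
  have [<-|_] := eqVneq k j; last by rewrite expr1 mulN1r mulrN.
  by rewrite straightenE !ltnn subrr !mul0r oppr0.
rewrite block_straighten // /rev_wt (youngP _ wy) mul1r; congr (_ * _).
have r3 m : ((3 - m %% 4)%N%:R : A) = 3 - (m %% 4)%N%:R.
  by rewrite natrB // -ltnS ltn_pmod.
by rewrite !r3; ring.
Qed.

(** The standard module maps to the principal series by sending the generator to the
    sign vector. *)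
Definition embed : {linear X -> P} := universal_map sign_vec_NN sign_vec_EE.

Lemma embed_nn c w g : embed (c ** (NN A w *: v0)) g = c * sign_vec (w^-1 * g)%g.
Proof.
rewrite linearZ /= (universal_gen sign_vec_NN sign_vec_EE).
by rewrite /NN principal_N principal_cst subgK ?in_setT // !ffunE.
Qed.

(** The map [embed] has a left inverse up to the order of the Young subgroup, an
    averaging over cosets.  So it loses nothing as soon as this order is
    invertible or cancellable. *)
Lemma embedK x :
  (#|young|)%:R ** x = \sum_(g : 'S_16) embed x g ** (NN A g *: v0).
Proof.
elim: (filt_all x) => [|c w _|y z _ IHy _ IHz].
- rewrite scaler0 big1 // => g _; rewrite raddf0.
  by rewrite (_ : (0 : P) g = 0) ?rmorph0 ?scale0r //; apply: ffunE.
- rewrite (reindex_inj (mulgI w)) /=.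
  under eq_bigr => u _ do rewrite embed_nn mulKg ffunE.
  rewrite (bigID (mem young)) /= [X in _ + X]big1 ?addr0; last first.
    by move=> u /negPf ->; rewrite mul0r mulr0 rmorph0 scale0r.
  rewrite (eq_bigr (fun _ => c ** (NN A w *: v0))).
    by rewrite sumr_const -scaler_nat rmorph_nat.
  move=> u uy; rewrite uy mul1r nn_mul_young // scalerA -rmorphM -mulrA.
  by rewrite -expr2 sqrr_sign mulr1.
- rewrite scalerDr IHy IHz -big_split; apply: eq_bigr => g _.
  rewrite [RHS](_ : _ = (embed y g + embed z g) ** (NN A g *: v0)).
    by rewrite rmorphD scalerDl.
  by rewrite raddfD; congr (_ ** _); apply: ffunE.
Qed.

End Embedding.

(** * Intertwining elements, functionals and contravariant forms *)

Section Intertwiners.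
Variables (A : comNzRingType).
Local Notation H := (H16 A).
Implicit Types (w u : 'S_16) (i j k : 'I_16).

Lemma hstar_NN w : hstar (NN A w) = NN A w^-1%g.
Proof.
rewrite /NN hstarN; congr hN; apply: val_inj.
by rewrite /= !subgK ?in_setT.
Qed.

Lemma hstar_EE k : hstar (EE A k) = EE A k. Proof. exact: hstarE. Qed.

Lemma hstar_opp x : @hstar A 16 [set: 'S_16]%G (- x) = - hstar x.
Proof. exact: (raddfN (plift (PHom (@hstar_central A _ _) (@hstar_rel A _ _)))). Qed.

(** The intertwining element: it exchanges the weights at two adjacent places
    ([EE_phi]), and its square is the scalar 1 - x^2 on a weight space, x being the
    difference of the two weights ([phi_sq]). *)
Definition phi i j : H := (EE A i - EE A j) * NN A (tperm i j) - 1.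

Section Adjacent.
Variables (i j : 'I_16).
Hypothesis ji : j = i.+1 :> nat.
Local Notation N := (NN A (tperm i j)).
Local Notation xi := (EE A i - EE A j).

Let ij : i == j = false. Proof. by rewrite -val_eqE /= ji ltn_eqF. Qed.
Let jiF : j == i = false. Proof. by rewrite eq_sym ij. Qed.

Lemma NN_xi : N * xi = 2%:R - xi * N.
Proof.
rewrite mulrBl !(EE_NN _ _ ji) tpermL tpermR !eqxx ij jiF subr0 sub0r.
rewrite rmorphN1 rmorph1 mulrBr; move: (N * EE A i) (N * EE A j) (1 : H) => x y o.
have -> t : t - (y + o - (x - o)) = t + (x - y - o *+ 2).
  by rewrite mulr2n opprB !opprD addrACA.
by rewrite [RHS]addrC subrK.
Qed.

Lemma EE_phi k : EE A k * phi i j = phi i j * EE A (tperm i j k).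
Proof.
pose c : A := (k == i)%:R - (k == j)%:R.
have Es : EE A (tperm i j k) = EE A k - hcst c * xi.
  rewrite /c; have [->|ki] := eqVneq k i.
    by rewrite tpermL ij subr0 rmorph1 mul1r subKr.
  have [->|kj] := eqVneq k j.
    by rewrite tpermR sub0r rmorphN1 mulN1r opprK addrC subrK.
  by rewrite tpermD 1?eq_sym // subrr rmorph0 mul0r subr0.
have Exi : EE A k * xi = xi * EE A k by rewrite mulrBr mulrBl !(EE_comm _ k).
rewrite /phi mulrBr [RHS]mulrBl mulr1 mul1r mulrA Exi -[LHS]/(_ - _) -mulrA.
rewrite (EE_NN _ _ ji) -/c mulrDr -addrA mulrA; congr (_ + _).
by rewrite Es opprB hcstC.
Qed.

Lemma hstar_phi : hstar (phi i j) = - phi i j.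
Proof.
rewrite /phi hstarD hstar_opp hstar1 hstarM hstar_NN tpermV hstarD hstar_opp !hstar_EE.
rewrite NN_xi opprB addrAC; congr (_ - _).
by rewrite mulr2n addrK.
Qed.

Lemma phi_sq : phi i j * phi i j = 1 - xi * xi.
Proof.
rewrite /phi; move: (EE A i - EE A j) NN_xi => x Nx.
have pp : x * N * (x * N) = x * N + x * N - x * x.
  rewrite -mulrA (mulrA N) Nx mulrBl mulrBr -!mulrA NNM tperm2 NN1 mulr1.
  by rewrite mulr_natl mulrnAr mulr2n.
rewrite mulrBr mulr1 mulrBl mul1r pp; move: (x * N) (x * x) => p q.
by rewrite opprB [X in X + _]addrAC addrK [LHS]addrC addrA subrK.
Qed.

End Adjacent.

Variable a : 'I_4 -> A.
Local Notation X := (standard a).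
Local Notation v0 := (gen_vec a).
Local Notation nn w := (NN A w *: v0).
Implicit Types (x y z : X).

Definition eigen (c : 'I_16 -> 'I_4) x := forall k, EE A k *: x = wt a c k ** x.

Section Step.
Variables (i j : 'I_16) (w : 'S_16).
Hypothesis ji : j = i.+1 :> nat.
Local Notation s := (tperm i j).

Lemma eigen_xi c x : eigen c x ->
  (EE A i - EE A j) *: x = (wt a c i - wt a c j) ** x.
Proof. by move=> xE; rewrite scalerBl !xE -scalerBl -rmorphB. Qed.

Lemma eigen_phi x : lab w i != lab w j ->
  eigen (lab w) x -> eigen (lab (s * w)%g) (phi i j *: x).
Proof.
move=> wij xE k; rewrite scalerA (EE_phi ji) -scalerA xE -scale_cst.
by rewrite /wt lab_tperm pos_tperm.
Qed.

Hypothesis wij : (lab w i < lab w j)%N.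

Lemma lead_NN (u : A) x : filt (ninv w) (x - u ** nn w) ->
  filt (ninv (s * w)%g) (NN A s *: x - u ** nn (s * w)%g).
Proof.
move=> xw; rewrite -NNM -scalerA (scale_cst u) -scalerBr.
by rewrite /ninv (inv_ascent ji wij); apply: filt_NN.
Qed.

(** The leading coefficient is multiplied by the difference of the weights after
    the crossing; -1 and lower terms of N only contribute to the smaller filtration
    step. *)
Lemma lead_phi (u : A) x : filt (ninv w) (x - u ** nn w) ->
  let d := wt a (lab w) j - wt a (lab w) i in
  filt (ninv (s * w)%g) (phi i j *: x - (u * d) ** nn (s * w)%g).
Proof.
move=> xw d; have ltw : (ninv w < ninv (s * w)%g)%N.
  by rewrite /ninv (inv_ascent ji wij).
have lw : lab w i != lab w j by rewrite -val_eqE /= neq_ltn wij.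
have dE : d = wt a (lab (s * w)%g) i - wt a (lab (s * w)%g) j.
  by rewrite /wt !lab_tperm !pos_tperm // tpermL tpermR.
have x1 : filt (ninv (s * w)%g) x.
  rewrite -(subrK (u ** nn w) x); apply: filtD; last exact: filt_nn.
  exact: filt_le (ltnW ltw) xw.
rewrite /phi scalerBl scale1r addrAC; apply: filtB => //.
rewrite -scalerA -(subrK (u ** nn (s * w)%g) (NN A s *: x)).
rewrite scalerDr -addrA; apply: filtD.
  by rewrite scalerBl; apply: filtB; apply: filt_EE; apply: lead_NN.
rewrite rmorphM -scalerA -(scale_cst u) -scalerBr; apply: filt_cst.
rewrite dE rmorphB !scalerBl.
rewrite opprD opprK addrACA -[X in _ + X]opprK opprD opprK.
by apply: filtB; apply: lead_EE.
Qed.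

End Step.

Section Functional.
Variable f : Defs.contra X.

Lemma contraZ c x : f (c ** x) = c * f x.
Proof.
have f0 : f 0 = 0 by apply: (addIr (f 0)); rewrite -contraD !add0r.
by rewrite -[c ** x]addr0 contra_lin f0 addr0.
Qed.

Lemma contra0 : f 0 = 0.
Proof. by rewrite -(scale0r v0) -(rmorph0 hcst) contraZ mul0r. Qed.

Lemma contraN x : f (- x) = - f x.
Proof. by rewrite -scaleN1r -(rmorphN1 hcst) contraZ mulN1r. Qed.

Lemma contraB x y : f (x - y) = f x - f y.
Proof. by rewrite contraD contraN. Qed.

(** Induction along the inversion filtration. *)
Lemma contra_filt (S : A -> Prop) :
  S 0 -> (forall c d, S c -> S d -> S (c + d)) -> (forall c d, S d -> S (c * d)) ->
  (forall w, (forall x, filt (ninv w) x -> S (f x)) -> S (f (nn w))) ->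
  forall x, S (f x).
Proof.
move=> S0 SD SM Sw x; have := filt_all x; move: (257%N) => m.
elim: m x => [|m IH] x; elim=> [|c w wm|y z _ IHy _ IHz].
- by rewrite contra0.
- by [].
- by rewrite contraD; apply: SD.
- by rewrite contra0.
- by rewrite contraZ; apply/(SM _)/Sw => z zw; apply: IH; apply: filt_le zw.
- by rewrite contraD; apply: SD.
Qed.

(** To show that all values of a functional lie in an ideal [S], it suffices to do so
    modulo smaller filtration steps on the vectors [nn w] whose weight cannot be
    separated from [mu] modulo [S].  Indeed, if epsilon_k acts through the functional
    by mu_k up to [S], then [(wt - mu_k) * f (nn w)] is a value of [f] on a smaller
    step, by [lead_EE]. *)
Lemma contra_ideal (S : A -> Prop) (mu : 'I_16 -> A) :
  S 0 -> (forall c d, S c -> S d -> S (c + d)) -> (forall c d, S d -> S (c * d)) ->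
  (forall k x, S (f (EE A k *: x) - mu k * f x)) ->
  (forall w, ((forall x, filt (ninv w) x -> S (f x)) -> S (f (nn w))) \/
     exists k, forall d, S ((wt a (lab w) k - mu k) * d) -> S d) ->
  forall x, S (f x).
Proof.
move=> S0 SD SM SE Sw; apply: contra_filt => // w IHw.
case: (Sw w) => [|[k]]; first exact.
apply; rewrite mulrBl -contraZ.
have -> : f (wt a (lab w) k ** nn w) - mu k * f (nn w) =
    f (EE A k *: nn w) - mu k * f (nn w)
    - f (EE A k *: nn w - wt a (lab w) k ** nn w).
  by rewrite contraB opprB [RHS]addrC addrA subrK.
apply: (SD _ _ (SE k (nn w))); rewrite -mulN1r; apply/(SM _)/IHw.
exact: lead_EE.
Qed.

End Functional.

Section Form.
Variable I : {linear X -> Defs.contra X}.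
Local Notation B x y := (I x y).

Lemma form_adj h x y : B (h *: x) y = B x (hstar h *: y).
Proof. by rewrite linearZ. Qed.

Lemma form_EE k x y : B (EE A k *: x) y = B x (EE A k *: y).
Proof. by rewrite form_adj hstar_EE. Qed.

Lemma formZl c x y : B (c ** x) y = c * B x y.
Proof. by rewrite form_adj hstar_hcst contraZ. Qed.

Lemma formDl x x' y : B (x + x') y = B x y + B x' y.
Proof. by rewrite linearD. Qed.

Lemma formBl x x' y : B (x - x') y = B x y - B x' y.
Proof. by rewrite linearB. Qed.

(** Contravariance turns phi into -phi on the other side, and phi^2 = 1 - x^2. *)
Lemma form_phi i j c x : j = i.+1 :> nat -> eigen c x ->
  B (phi i j *: x) (phi i j *: x) =
  ((wt a c i - wt a c j) ^+ 2 - 1) * B x x.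
Proof.
move=> ji xE; rewrite form_adj (hstar_phi ji) scaleNr scalerA (phi_sq ji).
rewrite scalerBl scale1r -scalerA (eigen_xi _ _ xE) -scale_cst (eigen_xi _ _ xE).
by rewrite contraN contraB !contraZ; ring.
Qed.

End Form.

End Intertwiners.

(** * Divisibility by powers of t *)

Section Valuation.
Variable F : fieldType.
Local Notation PS := (fps F).
Implicit Types (p q u : PS) (m n : nat).

Definition tdvd n p := forall m, (m < n)%N -> fcoef p m = 0.
Definition tval n p := tdvd n p /\ fcoef p n != 0.

Lemma fcoefB p q n : fcoef (p - q) n = fcoef p n - fcoef q n.
Proof. by []. Qed.

Lemma fcoef_sq_sub1 p :
  (fcoef (p ^+ 2 - 1) 0 = fcoef p 0 ^+ 2 - 1) *
  (fcoef (p ^+ 2 - 1) 1 = fcoef p 0 * fcoef p 1 *+ 2).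
Proof.
rewrite !fcoefB expr2 !fcoefM /= big_ord1 2!big_ord_recl big_ord0 /=.
by rewrite subr0 addr0 mulr2n [fcoef p 1 * _]mulrC -expr2.
Qed.

Lemma tdvd_zero n : tdvd n 0. Proof. by case=> [|m]. Qed.
Lemma tdvdD n p q : tdvd n p -> tdvd n q -> tdvd n (p + q).
Proof. by move=> np nq m mn; rewrite fcoefD np // nq // addr0. Qed.
Lemma tdvd_mul m n p q : tdvd m p -> tdvd n q -> tdvd (m + n) (p * q).
Proof.
move=> mp nq l lmn; rewrite fcoefM big1 // => i _.
have [im|mi] := ltnP i m; first by rewrite mp ?mul0r.
by rewrite nq ?mulr0 //; have := ltn_ord i; lia.
Qed.
Lemma tdvdMl n p q : tdvd n q -> tdvd n (p * q).
Proof. by move=> nq; rewrite -(add0n n); apply: tdvd_mul. Qed.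
Lemma tdvdB n p q : tdvd n p -> tdvd n q -> tdvd n (p - q).
Proof. by move=> np nq m mn; rewrite fcoefB np // nq // subr0. Qed.
Lemma tdvd_le m n p : (m <= n)%N -> tdvd n p -> tdvd m p.
Proof. by move=> mn np l lm; apply: np; apply: leq_trans mn. Qed.

Lemma tvalM m n p q : tval m p -> tval n q -> tval (m + n) (p * q).
Proof.
move=> [mp p0] [nq q0]; split; first exact: tdvd_mul.
have mmn : (m < (m + n).+1)%N by lia.
rewrite fcoefM (bigD1 (Ordinal mmn)) //= addKn big1 ?addr0 ?mulf_neq0 // => i.
rewrite -val_eqE /= neq_ltn => /orP[im|mi]; first by rewrite mp ?mul0r.
by rewrite nq ?mulr0 //; have := ltn_ord i; lia.
Qed.

(** The lowest coefficients of the factors multiply. *)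
Lemma tval_tdvd m n p q : tval m p -> tdvd (m + n) (p * q) -> tdvd n q.
Proof.
move=> [mp p0] mnpq l; elim/ltn_ind: l => l IH ln.
have := mnpq (m + l)%N; rewrite ltn_add2l => /(_ ln)/eqP.
have mml : (m < (m + l).+1)%N by lia.
rewrite fcoefM (bigD1 (Ordinal mml)) //= addKn big1 ?addr0; last first.
  move=> i; rewrite -val_eqE /= neq_ltn => /orP[im|mi]; first by rewrite mp ?mul0r.
  by have il := ltn_ord i; rewrite (IH (m + l - i)%N) ?mulr0 //; lia.
by rewrite mulf_eq0 (negPf p0) => /eqP.
Qed.

Lemma unit_tdvd n u q : fcoef u 0 != 0 -> tdvd n (u * q) -> tdvd n q.
Proof. by move=> u0; apply: (@tval_tdvd 0). Qed.

Lemma tval0 u : fcoef u 0 != 0 -> tval 0 u. Proof. by []. Qed.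

Lemma fcoef_t p n : fcoef (fps_t F * p) n = if n is m.+1 then fcoef p m else 0.
Proof.
rewrite fcoefM; case: n => [|n]; first by rewrite big_ord1 mul0r.
rewrite 2!big_ord_recl /= mul0r add0r mul1r subSS subn0 big1 ?addr0 // => i _.
by rewrite mul0r.
Qed.

Lemma tval_t : tval 1 (fps_t F).
Proof. by split=> [[]|] //=; rewrite oner_neq0. Qed.

Definition tdiv n p : PS := Fps (fun m => fcoef p (n + m)).

Lemma tdivK n p : tdvd n p -> p = fps_t F ^+ n * tdiv n p.
Proof.
elim: n p => [|n IH] p np; first by rewrite mul1r; apply: fpsP.
rewrite exprS -mulrA -[tdiv n.+1 p]/(tdiv n (tdiv 1 p)) -IH; last first.
  by move=> m mn; apply: np.
by apply: fpsP => -[|m]; rewrite fcoef_t // np.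
Qed.

Lemma tdvd_exp n p : tdvd n (fps_t F ^+ n * p).
Proof.
have tn : tdvd n (fps_t F ^+ n).
  elim: n => [|n IH]; first by [].
  by rewrite exprS -add1n; apply: tdvd_mul IH; case: tval_t.
by rewrite mulrC; apply: tdvdMl.
Qed.

Lemma fcoef_nat0 n : fcoef (n%:R : PS) 0 = n%:R.
Proof. exact: (rmorph_nat (@fps_eval0 F)). Qed.

Lemma fps_natE n : n%:R = fps_cst n%:R :> PS.
Proof. by rewrite rmorph_nat. Qed.

Lemma fps_expt_neq0 n : fps_t F ^+ n != 0.
Proof.
rewrite expf_neq0 //; apply/eqP => t0; have [_] := tval_t.
by rewrite t0 eqxx.
Qed.

End Valuation.

(** * Words and shuffles *)

Section Words.
Implicit Types (w : 'S_16) (c : 'I_16 -> 'I_4) (i j k : 'I_16) (l : seq nat).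

Definition letter c k : nat := (3 - c k + pos c k)%N.

(** All labellings of a word as a shuffle, where [pre] is the list of labels already
    used: the next letter of the segment with label [b] is [3 - b] plus the number of
    earlier occurrences of [b]. *)
Fixpoint fillings (word pre : seq nat) : seq (seq nat) :=
  if word is x :: word' then
    flatten [seq if (3 - b + count_mem b pre == x)%N
                 then [seq b :: l | l <- fillings word' (rcons pre b)] else [::]
            | b <- iota 0 4]
  else [:: [::]].

(** A labelling as a list, on which the combinatorics is done by computation. *)
Definition lseq c : seq nat := [seq nat_of_ord (c (inord m)) | m <- iota 0 16].

Lemma nth_lseq c k : nth 0%N (lseq c) k = c k.
Proof. by rewrite (nth_map 0%N) ?size_iota // nth_iota // add0n inord_val. Qed.

Lemma lseq_inj c c' : lseq c = lseq c' -> c =1 c'.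
Proof. by move=> cc' k; apply: val_inj; rewrite /= -!nth_lseq cc'. Qed.

Lemma pos_lseq c k : pos c k = count_mem (nat_of_ord (c k)) (take k (lseq c)).
Proof.
rewrite /pos /lseq -map_take take_iota (minn_idPl _); last exact: ltnW.
rewrite count_map -sum1_count big_mkcond.
rewrite -[X in iota 0 X]subn0 -/(index_iota 0 k) (big_nat_widen 0 k 16) //.
  rewrite big_mkord [RHS]big_mkcond; apply: eq_bigr => p _ /=.
  by rewrite inord_val -val_eqE; case: ltnP => //= _; case: eqP.
exact: ltnW.
Qed.

Lemma lseq_fillings c word : size word = 16 ->
  (forall k, letter c k = nth 0%N word k) -> lseq c \in fillings word [::].
Proof.
move=> sw cw; pose cn m := nat_of_ord (c (inord m)).
suff gen n m : (n + m = 16)%N ->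
    [seq cn p | p <- iota m n] \in fillings (drop m word) [seq cn p | p <- iota 0 m].
  by have := gen 16%N 0%N erefl; rewrite drop0.
elim: n m => [|n IH] m nm.
  by rewrite drop_oversize ?inE // sw; lia.
have m16 : (m < 16)%N by lia.
rewrite (drop_nth 0%N) ?sw //; apply/flatten_mapP; exists (cn m).
  by rewrite mem_iota add0n ltn_ord.
have := cw (Ordinal m16); rewrite /letter pos_lseq /= => <-.
rewrite /lseq -map_take take_iota (minn_idPl _); last exact: ltnW.
have -> : c (Ordinal m16) = c (inord m).
  by congr c; apply: val_inj; rewrite /= inordK.
rewrite eqxx; apply: map_f.
have := IH m.+1; rewrite -addSnnS => /(_ nm).
by rewrite -{3}[m.+1]addn1 iotaD map_cat cats1.
Qed.

Definition swap_labels m l := mkseq (fun p => nth 0%N l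
  (if p == m then m.+1 else if p == m.+1 then m else p)) 16.
Definition label_letter l m := (3 - nth 0 l m + count_mem (nth 0 l m) (take m l))%N.

Lemma letter_lseq c k : letter c k = label_letter (lseq c) k.
Proof. by rewrite /letter /label_letter pos_lseq nth_lseq. Qed.

Definition ix m : 'I_16 := inord m.
Definition simple_refl m : 'S_16 := tperm (ix m) (ix m.+1).

Lemma ix_succ m : (m < 15)%N -> ix m.+1 = (ix m).+1 :> nat.
Proof. by move=> m15; rewrite !inordK // ltnW. Qed.

Lemma lseq_simple_refl m w : (m < 15)%N ->
  lseq (lab (simple_refl m * w)%g) = swap_labels m (lseq (lab w)).
Proof.
move=> m15; apply: (@eq_from_nth _ 0%N); first by rewrite size_map size_mkseq size_iota.
move=> p; rewrite size_map size_iota => p16.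
rewrite nth_mkseq //; have pE : p = Ordinal p16 by [].
rewrite {1}pE nth_lseq lab_tperm.
have ixE q (q16 : (q < 16)%N) : ix q = Ordinal q16.
  by apply: val_inj; rewrite /= inordK.
rewrite /simple_refl; case: tpermP => [/(congr1 val)|/(congr1 val)|] /=.
- by rewrite inordK ?ltnS 1?ltnW // => ->; rewrite eqxx -nth_lseq inordK.
- rewrite inordK // => ->; rewrite eqn_leq ltnn /= eqxx -nth_lseq inordK //.
  exact: ltnW.
move=> pm pm1; rewrite -nth_lseq /=; case: eqP => [pE'|_].
  by case: pm; apply: val_inj; rewrite /= inordK -?pE'.
case: eqP => [pE'|//].
by case: pm1; apply: val_inj; rewrite /= inordK -?pE'.
Qed.

End Words.

(** * Deformed weights *)

Section Weights.
Variables (R : realType) (eta : 'I_4 -> R).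
Local Notation C := R[i].
Local Notation PS := (fps C).
Implicit Types (c : 'I_16 -> 'I_4) (k : 'I_16).

Lemma wtE c k : wt (start_t eta) c k =
  fps_cst (letter c k)%:R + fps_t C * fps_cst (eta (c k))%:C%C.
Proof. by rewrite /wt /start_t addrAC -natrD fps_natE. Qed.

Lemma wt_coef0 c k : fcoef (wt (start_t eta) c k) 0 = (letter c k)%:R.
Proof. by rewrite wtE fcoefD fcoef_t addr0. Qed.

Lemma wt_coef1 c k : fcoef (wt (start_t eta) c k) 1 = (eta (c k))%:C%C.
Proof. by rewrite wtE fcoefD fcoef_t add0r. Qed.

Lemma wt_letter c c' k : letter c k != letter c' k ->
  fcoef (wt (start_t eta) c k - wt (start_t eta) c' k) 0 != 0.
Proof.
by move=> cc'; rewrite fcoefB !wt_coef0 subr_eq0 eqr_nat.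
Qed.

Hypothesis eta_reg : regular eta.

(** The coefficients of t of the weights recover the labels, the direction being
    regular. *)
Lemma wt_inj c c' : wt (start_t eta) c =1 wt (start_t eta) c' -> c =1 c'.
Proof.
move=> cc' k; apply: eta_reg; apply: complexI.
by rewrite -!wt_coef1 cc'.
Qed.

(** Crossing two strands with letters that differ by one costs one power of t in the
    norm; all other crossings cost a unit. *)
Lemma tval_wt_sq c k k' : c k != c k' ->
  tval ((letter c k == (letter c k').+1) || (letter c k' == (letter c k).+1))
    ((wt (start_t eta) c k - wt (start_t eta) c k') ^+ 2 - 1).
Proof.
move=> ckk'; set x := wt _ _ _ - wt _ _ _.
have x0 : fcoef x 0 = (letter c k)%:R - (letter c k')%:R.
  by rewrite fcoefB !wt_coef0.
have x1 : fcoef x 1 != 0.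
  rewrite fcoefB !wt_coef1 subr_eq0; apply: contra_neq ckk' => /complexI.
  exact: eta_reg.
have natS (m n : nat) : (m%:R - n%:R == 1 :> C) = (m == n.+1).
  by rewrite subr_eq nat1r eqr_nat.
have natN (m n : nat) : (m%:R - n%:R == -1 :> C) = (n == m.+1).
  by rewrite -eqr_oppLR opprB natS.
have x01 : (fcoef x 0 ^+ 2 == 1) =
    (letter c k == (letter c k').+1) || (letter c k' == (letter c k).+1).
  by rewrite sqrf_eq1 x0 natS natN.
rewrite -x01; case: eqP => [x0E|/eqP x0N]; last first.
  by apply: tval0; rewrite fcoef_sq_sub1 subr_eq0.
split=> [[|//] _|]; first by rewrite fcoef_sq_sub1 x0E subrr.
rewrite fcoef_sq_sub1 -mulr_natr; apply: mulf_neq0; last by rewrite pnatr_eq0.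
apply: mulf_neq0 => //; apply/eqP => x00.
by move/eqP: x0E; rewrite x00 expr0n eq_sym oner_eq0.
Qed.

End Weights.

(** * Paths of eigenvectors and divisibility on a block *)

Section Block.
Variables (R : realType) (eta : 'I_4 -> R).
Local Notation C := R[i].
Local Notation PS := (fps C).
Local Notation H := (H16 PS).
Local Notation X := (X_t eta).
Local Notation a := (start_t eta).
Local Notation v0 := (gen_vec a : X).
Local Notation nn w := (NN PS w *: v0).
Implicit Types (w : 'S_16) (x y z : X) (k : 'I_16) (p l : seq nat).

(** The leading term is a unit multiple of [nn w]: such a vector can replace
    [nn w] in the filtration. *)
Definition lead w x :=
  exists2 u : PS, fcoef u 0 != 0 & filt (ninv w) (x - u ** nn w).

Lemma contra_lead (f : Defs.contra X) n w w1 x : lab w1 =1 lab w -> lead w1 x ->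
  (forall z, filt (ninv w) z -> tdvd n (f z)) -> tdvd n (f x) ->
  tdvd n (f (nn w)).
Proof.
move=> lw [u u0 xu] fz fx; have ninvE : ninv w1 = ninv w.
  by apply: eq_bigr => pq _; rewrite -!/(lab _ _) !lw.
have [e ->] := nn_lab a lw; rewrite contraZ; apply: tdvdMl.
apply: (unit_tdvd u0); rewrite -contraZ -(subKr x (u ** _)) contraB.
by apply: tdvdB => //; apply: fz; rewrite -ninvE.
Qed.

Lemma lab1_blk : lab 1%g =1 blk. Proof. by move=> q; rewrite /lab perm1. Qed.

Lemma wt_lab1 k : wt a (lab 1%g) k = wt a blk k.
Proof.
rewrite /wt lab1_blk; congr (_ + _%:R).
by apply: eq_bigr => q _; rewrite !lab1_blk.
Qed.

Lemma gen_eigen : eigen (lab 1%g) v0.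
Proof. by move=> k; rewrite wt_lab1; apply: gen_EE. Qed.

Lemma gen_lead : lead 1%g v0.
Proof.
exists 1; first by rewrite oner_neq0.
by rewrite NN1 rmorph1 !scale1r subrr; apply: filt0.
Qed.

Section Form.
Variable I : {linear X -> Defs.contra X}.

(** [contra_ideal] for a block of rank one. *)
Lemma gen_bound (f : Defs.contra X) n w1 x1 :
  (forall w, (forall k, letter (lab w) k = letter (lab w1) k) -> lab w1 =1 lab w) ->
  lead w1 x1 -> (forall k x, f (EE PS k *: x) = wt a (lab w1) k * f x) ->
  tdvd n (f x1) -> forall x, tdvd n (f x).
Proof.
move=> words lx fE fx1; apply: (contra_ideal (mu := wt a (lab w1))).
- exact: tdvd_zero.
- by move=> c d; apply: tdvdD.
- by move=> c d; apply: tdvdMl.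
- by move=> k x; rewrite fE subrr; apply: tdvd_zero.
move=> w; have [ww1|/existsNP[k /eqP kw]] :=
    pselect (forall k, letter (lab w) k = letter (lab w1) k).
  by left=> fz; apply: (contra_lead (words _ ww1) lx fz).
by right; exists k => d; apply: unit_tdvd; apply: wt_letter.
Qed.

(** [contra_ideal] for a block of rank two spanned by an eigenvector [x1] and a
    generalized one [x2]; divisibility of the Gram matrix of [x1], [x2] extends to
    the pairing with the whole lattice. *)
Lemma block_bound n w1 w2 x1 x2 :
  (forall k, letter (lab w2) k = letter (lab w1) k) ->
  (forall w, (forall k, letter (lab w) k = letter (lab w1) k) ->
     lab w1 =1 lab w \/ lab w2 =1 lab w) ->
  lead w1 x1 -> lead w2 x2 -> eigen (lab w1) x1 ->
  (forall k z, exists r, I x2 (EE PS k *: z) - wt a (lab w2) k * I x2 z =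
     r * I x1 z) ->
  tdvd n (I x1 x1) -> tdvd n (I x1 x2) -> tdvd n (I x2 x1) -> tdvd n (I x2 x2) ->
  forall z, tdvd n (I x1 z) /\ tdvd n (I x2 z).
Proof.
move=> l21 words lx1 lx2 e1 e2 I11 I12 I21 I22.
have bound (f : Defs.contra X) w0 : (forall k, letter (lab w0) k = letter (lab w1) k) ->
    (forall k x, tdvd n (f (EE PS k *: x) - wt a (lab w0) k * f x)) ->
    tdvd n (f x1) -> tdvd n (f x2) -> forall x, tdvd n (f x).
  move=> l0 fE f1 f2; apply: (contra_ideal (mu := wt a (lab w0))) => //.
  - exact: tdvd_zero.
  - by move=> c d; apply: tdvdD.
  - by move=> c d; apply: tdvdMl.
  move=> w; have [ww1|/existsNP[k /eqP kw]] :=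
      pselect (forall k, letter (lab w) k = letter (lab w1) k).
    left=> fz; case: (words _ ww1) => lw; first exact: (contra_lead lw lx1 fz).
    exact: (contra_lead lw lx2 fz).
  by right; exists k => d; apply: unit_tdvd; apply: wt_letter; rewrite l0.
have B1 : forall z, tdvd n (I x1 z).
  apply: (bound _ w1) => // k z.
  by rewrite -form_EE e1 formZl subrr; apply: tdvd_zero.
move=> z; split=> //; move: z; apply: (bound _ w2) => // k z.
by have [r ->] := e2 k z; apply/tdvdMl/B1.
Qed.

(** The epsilon_k are self-adjoint. *)
Lemma eigen_orth c c' x y k : wt a c k != wt a c' k ->
  eigen c x -> eigen c' y -> I x y = 0.
Proof.
move=> cc' xE yE; have := form_EE I k x y.
rewrite xE yE formZl contraZ => /eqP; rewrite -subr_eq0 -mulrBl mulf_eq0.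
by rewrite subr_eq0 (negPf cc') => /eqP.
Qed.

End Form.

Definition phi_at m : H := phi PS (ix m) (ix m.+1).

(** The elements phi at the places listed in [p], the first of the list applied
    first. *)
Definition path_act p x : X := foldl (fun y m => phi_at m *: y) x p.
Definition path_perm p w : 'S_16 := foldl (fun v m => simple_refl m * v)%g w p.
Definition path_labels p l := foldl (fun l' m => swap_labels m l') l p.

(** Each crossing of the path creates an inversion. *)
Fixpoint ascents p l :=
  if p is m :: p' then
    [&& (m < 15)%N, (nth 0 l m < nth 0 l m.+1)%N & ascents p' (swap_labels m l)]
  else true.

(** The crossings keep a unit leading coefficient: see [lead_phi]. *)
Fixpoint letters_differ p l :=
  if p is m :: p' then
    (label_letter l m != label_letter l m.+1) && letters_differ p' (swap_labels m l)
  else true.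

Lemma lab_ix w m : (m < 16)%N -> lab w (ix m) = nth 0%N (lseq (lab w)) m :> nat.
Proof. by move=> m16; rewrite -nth_lseq inordK. Qed.

Lemma letter_ix w m : (m < 16)%N -> letter (lab w) (ix m) = label_letter (lseq (lab w)) m.
Proof. by move=> m16; rewrite letter_lseq inordK. Qed.

Lemma path_perm_lseq p w : ascents p (lseq (lab w)) ->
  lseq (lab (path_perm p w)) = path_labels p (lseq (lab w)).
Proof.
elim: p w => //= m p IH w /and3P[m15 _ pP].
by rewrite IH ?lseq_simple_refl.
Qed.

Lemma path_act_lead p w x : ascents p (lseq (lab w)) ->
  letters_differ p (lseq (lab w)) -> lead w x -> lead (path_perm p w) (path_act p x).
Proof.
elim: p w x => //= m p IH w x /and3P[m15 asc pP] /andP[lm pl] [u u0 xu].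
apply: IH; rewrite ?lseq_simple_refl //.
have ascw : (lab w (ix m) < lab w (ix m.+1))%N.
  by rewrite !lab_ix // ltnW.
exists (u * (wt a (lab w) (ix m.+1) - wt a (lab w) (ix m))).
  have [_] : tval (0 + 0) (u * (wt a (lab w) (ix m.+1) - wt a (lab w) (ix m))).
    apply: tvalM; apply: tval0 => //.
    rewrite fcoefB !wt_coef0 subr_eq0 eqr_nat !letter_ix ?ltnS //; last exact: ltnW.
    by rewrite eq_sym.
  by [].
exact: (lead_phi (ix_succ m15)).
Qed.

Lemma path_act_eigen p w x : ascents p (lseq (lab w)) ->
  eigen (lab w) x -> eigen (lab (path_perm p w)) (path_act p x).
Proof.
elim: p w x => //= m p IH w x /and3P[m15 asc pP] xE.
have lwm : lab w (ix m) != lab w (ix m.+1).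
  by rewrite -val_eqE /= !lab_ix ?neq_ltn ?asc // ltnW.
apply: IH; rewrite ?lseq_simple_refl //; exact: (eigen_phi (ix_succ m15) lwm xE).
Qed.

Lemma path_actZ p (c : PS) x : path_act p (c ** x) = c ** path_act p x.
Proof. by elim: p x => //= m p IH x; rewrite -scale_cst IH. Qed.

Lemma path_actB p x y : path_act p (x - y) = path_act p x - path_act p y.
Proof. by elim: p x y => //= m p IH x y; rewrite scalerBr IH. Qed.

Definition path_op p (h : H) : H := foldl (fun g m => phi_at m * g) h p.
Lemma path_act_op p h x : path_act p (h *: x) = path_op p h *: x.
Proof. by elim: p h => //= m p IH h; rewrite scalerA IH. Qed.

Section FormPath.
Variable I : {linear X -> Defs.contra X}.

Fixpoint norm_factor p w : PS :=
  if p is m :: p' then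
    norm_factor p' (simple_refl m * w)%g *
    ((wt a (lab w) (ix m) - wt a (lab w) (ix m.+1)) ^+ 2 - 1)
  else 1.

Lemma path_act_form p w x : ascents p (lseq (lab w)) -> eigen (lab w) x ->
  I (path_act p x) (path_act p x) = norm_factor p w * I x x.
Proof.
elim: p w x => [|m p IH] w x /=; first by rewrite mul1r.
move=> /and3P[m15 asc pP] xE.
have pw : ascents p (lseq (lab (simple_refl m * w)%g)) by rewrite lseq_simple_refl.
have lwm : lab w (ix m) != lab w (ix m.+1).
  by rewrite -val_eqE /= !lab_ix ?neq_ltn ?asc // ltnW.
rewrite (IH _ _ pw); last exact: (eigen_phi (ix_succ m15) lwm xE).
by rewrite (form_phi I (ix_succ m15) xE) mulrA.
Qed.

End FormPath.

(** Counts the crossings of strands whose letters differ by one, the only ones that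
    change the valuation of the norm ([tval_wt_sq]). *)
Fixpoint linked_crossings p l : nat :=
  if p is m :: p' then
    (((label_letter l m == (label_letter l m.+1).+1) || (label_letter l m.+1 == (label_letter l m).+1))
       + linked_crossings p' (swap_labels m l))%N
  else 0.

Lemma tval_norm_factor p w : regular eta -> ascents p (lseq (lab w)) ->
  tval (linked_crossings p (lseq (lab w))) (norm_factor p w).
Proof.
move=> reg; elim: p w => [|m p IH] w /=; first by move=> _; apply: tval0; rewrite oner_neq0.
move=> /and3P[m15 asc pP]; rewrite addnC; apply: tvalM.
  by rewrite -lseq_simple_refl //; apply: IH; rewrite lseq_simple_refl.
rewrite -!letter_ix ?ltnS //; last exact: ltnW.
apply: tval_wt_sq => //.
by rewrite -val_eqE /= !lab_ix ?neq_ltn ?asc // ltnW.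
Qed.

End Block.

(** * The rank two block *)

Definition labels_id : seq nat := [:: 0; 0; 0; 0; 1; 1; 1; 1; 2; 2; 2; 2; 3; 3; 3; 3]%N.
(** The state just before the two letters 2, at places 7 and 8, cross. *)
Definition labels_b : seq nat := [:: 1; 2; 3; 3; 0; 0; 1; 2; 3; 0; 1; 2; 0; 1; 2; 3]%N.
(** The two shuffles of the word [word_lambda]. *)
Definition labels_c1 : seq nat := [:: 1; 2; 3; 3; 2; 0; 0; 1; 3; 0; 1; 2; 0; 1; 2; 3]%N.
Definition labels_c2 : seq nat := [:: 1; 2; 3; 3; 3; 0; 0; 1; 2; 0; 1; 2; 0; 1; 2; 3]%N.
Definition word_lambda : seq nat := [:: 2; 1; 0; 1; 2; 3; 4; 3; 2; 5; 4; 3; 6; 5; 4; 3]%N.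
(** A reduced path from [labels_id] to [labels_b]. *)
Definition path_b : seq nat :=
  [:: 11; 12; 13; 7; 8; 9; 10; 11; 12; 3; 4; 5; 6; 7; 8; 9; 10; 11; 8; 9; 10;
      5; 6; 7; 8; 9; 2; 3; 4; 5; 6; 7; 8; 5; 6; 3; 4; 5; 1; 2; 3; 4; 0; 1; 2; 3]%N.
(** The left one of the two strands that were at places 7 and 8 moves to place 4. *)
Definition path_c : seq nat := [:: 6; 5; 4]%N.

Lemma path_b_check :
  [&& ascents path_b labels_id, letters_differ path_b labels_id,
    path_labels path_b labels_id == labels_b & linked_crossings path_b labels_id == 3]%N.
Proof. by vm_compute. Qed.

Lemma path_c_check1 :
  [&& ascents path_c labels_b, letters_differ path_c labels_b,
    path_labels path_c labels_b == labels_c1 & linked_crossings path_c labels_b == 2]%N.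
Proof. by vm_compute. Qed.

(** Here the letters at places 7 and 8 are equal, so the first crossing does not
    keep a unit leading coefficient; N is used for it below. *)
Lemma path_c_check2 :
  [&& ascents (7%N :: path_c) labels_b, letters_differ path_c (swap_labels 7 labels_b) &
   path_labels (7%N :: path_c) labels_b == labels_c2].
Proof. by vm_compute. Qed.

(** Without the condition on the number of labels there are more fillings, in which
    a segment continues beyond its end. *)
Lemma lambda_fillings :
  [seq l <- fillings word_lambda [::] | perm_eq l labels_id] = [:: labels_c1; labels_c2] \/
  [seq l <- fillings word_lambda [::] | perm_eq l labels_id] = [:: labels_c2; labels_c1].
Proof. by vm_compute; first [left; reflexivity|right; reflexivity]. Qed.

Lemma labels_c_letters m : (m < 16)%N ->
  label_letter labels_c1 m = nth 0%N word_lambda m /\ label_letter labels_c2 m = nth 0%N word_lambda m.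
Proof.
have /allP lP : all (fun m => (label_letter labels_c1 m == nth 0 word_lambda m) &&
    (label_letter labels_c2 m == nth 0 word_lambda m))%N (iota 0 16) by vm_compute.
by move=> m16; have := lP m; rewrite mem_iota m16 => /(_ isT)/andP[/eqP -> /eqP ->].
Qed.

Lemma chi_fillings : fillings [seq label_letter labels_id m | m <- iota 0 16] [::] = [:: labels_id].
Proof. by vm_compute. Qed.

Lemma lseq_enum c : lseq c = [seq nat_of_ord (c k) | k <- enum 'I_16].
Proof.
apply: (@eq_from_nth _ 0%N); first by rewrite [LHS]size_map [RHS]size_map size_iota size_enum_ord.
move=> m; rewrite size_map size_iota => m16.
rewrite (nth_lseq c (Ordinal m16)).
rewrite (nth_map (Ordinal m16)) ?size_enum_ord //.
by rewrite (nth_ord_enum _ (Ordinal m16)).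
Qed.

Lemma lseq_blk : lseq blk = labels_id.
Proof.
rewrite /lseq (_ : labels_id = [seq (m %/ 4)%N | m <- iota 0 16]) //.
apply/eq_in_map => m; rewrite mem_iota add0n => /andP[_ m16].
by rewrite blkE inordK.
Qed.

Lemma lseq1 : lseq (lab 1%g) = labels_id.
Proof. by rewrite -lseq_blk; apply: eq_map => m; rewrite /lab perm1. Qed.

Lemma lseq_perm w : perm_eq (lseq (lab w)) labels_id.
Proof.
rewrite -lseq_blk !lseq_enum (map_comp (fun k => nat_of_ord (blk k)) w).
apply: perm_map; apply: uniq_perm.
- by rewrite map_inj_uniq ?enum_uniq //; apply: perm_inj.
- exact: enum_uniq.
- move=> q; rewrite mem_enum; apply/mapP; exists (w^-1 q)%g; last by rewrite permKV.
  by rewrite mem_enum.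
Qed.

(** The weight of the generator is a shuffle in one way only. *)
Lemma chi_words c : (forall k, letter c k = letter (lab 1%g) k) -> lab 1%g =1 c.
Proof.
move=> cE; apply/lseq_inj/esym/eqP; rewrite lseq1 -mem_seq1 -chi_fillings.
apply: lseq_fillings; first by rewrite size_map size_iota.
by move=> k; rewrite cE letter_lseq lseq1 (nth_map 0%N) ?size_iota // nth_iota.
Qed.

Lemma lambda_words w : (forall k : 'I_16, letter (lab w) k = nth 0%N word_lambda k) ->
  lseq (lab w) = labels_c1 \/ lseq (lab w) = labels_c2.
Proof.
move=> wE; have : lseq (lab w) \in [seq l <- fillings word_lambda [::] | perm_eq l labels_id].
  by rewrite mem_filter lseq_perm lseq_fillings.
by case: lambda_fillings => ->; rewrite !inE => /orP[]/eqP; [left|right|right|left].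
Qed.

Section LambdaBlock.
Variables (R : realType) (s : seq nat).
Local Notation C := R[i].
Local Notation PS := (fps C).
Definition eta_of : 'I_4 -> R := fun b => (nth 0%N s b)%:R.
Hypothesis reg : regular eta_of.
Local Notation X := (X_t eta_of).
Local Notation a := (start_t eta_of).
Local Notation v0 := (gen_vec a : X).
Local Notation t := (fps_t C).
Implicit Types (w : 'S_16).

Definition label_wt l m : PS := (label_letter l m)%:R + t * (nth 0 s (nth 0 l m))%:R.

Lemma wt_label w m : (m < 16)%N -> wt a (lab w) (ix m) = label_wt (lseq (lab w)) m.
Proof.
move=> m16; rewrite wtE letter_ix // /label_wt /eta_of lab_ix //.
congr (_ + t * _); first exact/esym/fps_natE.
by rewrite (fps_natE C); congr fps_cst; apply: (rmorph_nat (real_complex R)).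
Qed.

Fixpoint label_factor p l : PS :=
  if p is m :: p' then
    label_factor p' (swap_labels m l) * ((label_wt l m - label_wt l m.+1) ^+ 2 - 1)
  else 1.

Lemma norm_factorE p w : ascents p (lseq (lab w)) ->
  norm_factor eta_of p w = label_factor p (lseq (lab w)).
Proof.
elim: p w => //= m p IH w /and3P[m15 _ pP].
by rewrite IH lseq_simple_refl // !wt_label // ltnW.
Qed.

Definition wb := path_perm path_b 1%g.
Definition yb : X := path_act path_b v0.
Definition w1 := path_perm path_c wb.
Definition y1 : X := path_act path_c yb.
Definition w2 := path_perm (7%N :: path_c) wb.
Definition y2 : X := path_act (7%N :: path_c) yb.
Definition e2_op : H16 PS := path_op path_c (NN PS (simple_refl 7) * path_op path_b 1).
Definition e2 : X := e2_op *: v0.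

Lemma lseq_wb : lseq (lab wb) = labels_b.
Proof.
by case/and4P: path_b_check => asc _ /eqP lbE _; rewrite path_perm_lseq lseq1.
Qed.

Lemma lseq_w1 : lseq (lab w1) = labels_c1.
Proof.
by case/and4P: path_c_check1 => asc _ /eqP lE _; rewrite path_perm_lseq lseq_wb.
Qed.

Lemma lseq_w2 : lseq (lab w2) = labels_c2.
Proof.
by case/and3P: path_c_check2 => asc _ /eqP lE; rewrite path_perm_lseq lseq_wb.
Qed.

Lemma e2E : e2 = path_act path_c (NN PS (simple_refl 7) *: yb).
Proof.
have preE := @path_act_op R eta_of path_b 1 v0; rewrite scale1r in preE.
by rewrite /yb preE scalerA (@path_act_op R eta_of path_c).
Qed.

Lemma yb_eigen : eigen (lab wb) yb.
Proof.
by case/and4P: path_b_check => asc _ _ _; apply: path_act_eigen (gen_eigen _); rewrite lseq1.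
Qed.

Lemma yb_lead : lead wb yb.
Proof.
by case/and4P: path_b_check => asc ld _ _; apply: path_act_lead (gen_lead _); rewrite lseq1.
Qed.

Lemma y1_eigen : eigen (lab w1) y1.
Proof.
by case/and4P: path_c_check1 => asc _ _ _; apply: path_act_eigen yb_eigen; rewrite lseq_wb.
Qed.

Lemma y1_lead : lead w1 y1.
Proof.
by case/and4P: path_c_check1 => asc ld _ _; apply: path_act_lead yb_lead; rewrite lseq_wb.
Qed.

Lemma y2_eigen : eigen (lab w2) y2.
Proof.
by case/and3P: path_c_check2 => asc _ _; apply: path_act_eigen yb_eigen; rewrite lseq_wb.
Qed.

Lemma e2_lead : lead w2 e2.
Proof.
rewrite e2E; case/and3P: path_c_check2 => /and3P[_ asc7 asc] ld _.
have w7 : lseq (lab (simple_refl 7 * wb)%g) = swap_labels 7 labels_b by rewrite lseq_simple_refl ?lseq_wb.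
apply: (@path_act_lead _ eta_of path_c (simple_refl 7 * wb)%g); rewrite ?w7 //.
have [u u0 yu] := yb_lead; exists u => //; apply: (lead_NN (ix_succ _)) => //.
by rewrite !lab_ix ?lseq_wb.
Qed.

Local Notation d := (label_wt labels_b 7 - label_wt labels_b 8).

(** On the eigenvector [yb] one has phi = 1 - N x, x = t(c - d) being the difference
    of the weights at places 7 and 8. *)
Lemma e2_scaled : d ** e2 = y1 - y2.
Proof.
rewrite e2E -path_actZ -[y2]/(path_act path_c (@phi_at R 7 *: yb)) -path_actB; congr (path_act path_c _).
have ji : ix 8 = (ix 7).+1 :> nat by apply: ix_succ.
have -> : @phi_at R 7 = 1 - NN PS (simple_refl 7) * (EE PS (ix 7) - EE PS (ix 8)).
  rewrite (NN_xi _ ji) /phi_at /phi -/(simple_refl 7); move: (_ * NN _ _) => p.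
  by rewrite opprB addrCA; congr (_ + _); rewrite mulr2n opprD addrA subrr add0r.
rewrite scalerBl scale1r subKr -scalerA (eigen_xi _ _ yb_eigen) !wt_label //.
by rewrite lseq_wb scale_cst.
Qed.

Variable I : {linear X -> Defs.contra X}.
Hypothesis U0 : fcoef (I v0 v0) 0 != 0.

(** On three of the crossings on the way to [labels_b] the letters differ by one. *)
Lemma yb_val : tval 3 (I yb yb).
Proof.
case/and4P: path_b_check => asc _ _ /eqP lk.
have asc1 : ascents path_b (lseq (lab 1%g)) by rewrite lseq1.
have -> : I yb yb = norm_factor eta_of path_b 1%g * I v0 v0.
  exact: (path_act_form I asc1 (gen_eigen _)).
apply: (@tvalM _ 3 0); last exact: tval0.
by move: (@tval_norm_factor _ _ path_b 1%g reg); rewrite lseq1 lk; apply.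
Qed.

Lemma y1_form : I y1 y1 = label_factor path_c labels_b * I yb yb.
Proof.
case/and4P: path_c_check1 => asc _ _ _.
rewrite (@path_act_form _ _ I path_c wb) ?lseq_wb //; last exact: yb_eigen.
by rewrite norm_factorE lseq_wb.
Qed.

Lemma y1_val : tval 5 (I y1 y1).
Proof.
case/and4P: path_c_check1 => asc _ _ /eqP lk.
rewrite (@path_act_form _ _ I path_c wb) ?lseq_wb //; last exact: yb_eigen.
apply: (@tvalM _ 2 3); last exact: yb_val.
by move: (@tval_norm_factor _ _ path_c wb reg); rewrite lseq_wb lk; apply.
Qed.

Lemma y2_form : I y2 y2 = label_factor (7%N :: path_c) labels_b * I yb yb.
Proof.
case/and3P: path_c_check2 => asc _ _.
rewrite (@path_act_form _ _ I (7%N :: path_c) wb) ?lseq_wb //; last exact: yb_eigen.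
by rewrite norm_factorE lseq_wb.
Qed.

Hypothesis s23 : nth 0%N s 3 = (nth 0%N s 2).+1.

Lemma dE : d = - t.
Proof.
rewrite -[label_wt labels_b 7]/(2%:R + t * (nth 0 s 2)%:R).
by rewrite -[label_wt labels_b 8]/(2%:R + t * (nth 0 s 3)%:R) s23 -natr1; ring.
Qed.

Lemma y12_orth : I y1 y2 = 0 /\ I y2 y1 = 0.
Proof.
have ne : wt a (lab w1) (ix 4) != wt a (lab w2) (ix 4).
  rewrite !wt_label // lseq_w1 lseq_w2 -subr_eq0.
  rewrite -[label_wt labels_c1 4]/(label_wt labels_b 7) -[label_wt labels_c2 4]/(label_wt labels_b 8) dE oppr_eq0.
  by rewrite -[t]expr1 fps_expt_neq0.
split; first exact: (eigen_orth I ne y1_eigen y2_eigen).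
by apply: (eigen_orth I _ y2_eigen y1_eigen); rewrite eq_sym; apply: ne.
Qed.

Lemma t_cancel (p q : PS) : t * p = t * q -> p = q.
Proof. by apply: mulfI; rewrite -[t]expr1 fps_expt_neq0. Qed.

Lemma I_y1_e2 : tdvd 4 (I y1 e2).
Proof.
apply: (@tval_tdvd _ 1 4 t); first exact: tval_t.
have := congr1 (I y1) e2_scaled; rewrite contraZ contraB y12_orth.1 subr0 dE mulNr.
by move/eqP; rewrite eqr_oppLR => /eqP ->; rewrite -sub0r; apply: tdvdB;
  [apply: tdvd_zero|case: y1_val].
Qed.

Lemma I_e2_scaled z : t * I e2 z = I y2 z - I y1 z.
Proof.
have := congr1 (fun x => I x z) e2_scaled; rewrite formZl formBl dE mulNr => /eqP.
by rewrite eqr_oppLR opprB => /eqP.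
Qed.

Lemma I_e2_y1 : tdvd 4 (I e2 y1).
Proof.
apply: (@tval_tdvd _ 1 4 t); first exact: tval_t.
by rewrite I_e2_scaled y12_orth.2; apply: tdvdB; [apply: tdvd_zero|case: y1_val].
Qed.

Variable S : PS.
Hypothesis SE : label_factor path_c labels_b + label_factor (7%N :: path_c) labels_b = t ^+ 2 * S.

(** From x e2 = y1 - y2 and orthogonality, x^2 <e2,e2> = <y1,y1> + <y2,y2>. *)
Lemma I_e2_e2 : I e2 e2 = S * I yb yb.
Proof.
apply: t_cancel; apply: t_cancel.
have e2r z : t * I z e2 = I z y2 - I z y1.
  have := congr1 (I z) e2_scaled; rewrite contraZ contraB dE mulNr => /eqP.
  by rewrite eqr_oppLR opprB => /eqP.
rewrite I_e2_scaled mulrBr !e2r y12_orth.1 y12_orth.2 sub0r opprK subr0.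
by rewrite y1_form y2_form -mulrDl addrC SE expr2 !mulrA.
Qed.

Lemma label_wt_diff m : (m < 16)%N -> exists r : PS, label_wt labels_c1 m = label_wt labels_c2 m - r * t.
Proof.
have eq0 p q : p = q -> exists r : PS, p = q - r * t.
  by move=> ->; exists 0; rewrite mul0r subr0.
move=> m16; do 4 (case: m m16 => [|m] m16; first exact: eq0).
case: m m16 => [|m] m16.
  exists 1; rewrite mul1r -dE.
  by rewrite -[label_wt labels_c1 4]/(label_wt labels_b 7) -[label_wt labels_c2 4]/(label_wt labels_b 8); ring.
do 3 (case: m m16 => [|m] m16; first exact: eq0).
case: m m16 => [|m] m16.
  exists (-1); rewrite mulN1r -dE.
  by rewrite -[label_wt labels_c1 8]/(label_wt labels_b 8) -[label_wt labels_c2 8]/(label_wt labels_b 7); ring.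
by do 7 (case: m m16 => [|m] m16; first exact: eq0).
Qed.

(** On the block, epsilon_k - wt acts on [e2] by a multiple of [y1], since the
    weights of [y1] and [y2] differ by multiples of x.  So [block_bound] applies. *)
Lemma e2_bound n : (n <= 4)%N -> tdvd n (I e2 e2) -> forall z, tdvd n (I e2 z).
Proof.
move=> n4 I22; have le4 p : tdvd 4 p -> tdvd n p by apply: tdvd_le.
have l1 k : letter (lab w1) k = nth 0%N word_lambda k.
  by rewrite letter_lseq lseq_w1 (labels_c_letters (ltn_ord k)).1.
have l2 k : letter (lab w2) k = nth 0%N word_lambda k.
  by rewrite letter_lseq lseq_w2 (labels_c_letters (ltn_ord k)).2.
suff bd : forall z, tdvd n (I y1 z) /\ tdvd n (I e2 z).
  by move=> z; case: (bd z).
apply: (@block_bound _ _ I n w1 w2 y1 e2) => //.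
- by move=> k; rewrite l1 l2.
- move=> w wl; have := @lambda_words w; case=> [k|lw|lw]; first by rewrite wl l1.
    by left; apply: lseq_inj; rewrite lseq_w1 lw.
  by right; apply: lseq_inj; rewrite lseq_w2 lw.
- exact: y1_lead.
- exact: e2_lead.
- exact: y1_eigen.
- move=> k z; have [r rE] := label_wt_diff (ltn_ord k); exists r.
  have wtk w : wt a (lab w) k = label_wt (lseq (lab w)) k.
    by rewrite -wt_label // /ix inord_val.
  apply: t_cancel; rewrite mulrBr mulrCA !I_e2_scaled.
  rewrite -(form_EE I k y1) -(form_EE I k y2) y1_eigen y2_eigen !formZl !wtk.
  by rewrite lseq_w1 lseq_w2 rE; ring.
- by apply: le4; apply: tdvd_le y1_val.1.
- exact/le4/I_y1_e2.
- exact/le4/I_e2_y1.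
Qed.

End LambdaBlock.

(** * Symmetry of the contravariant form *)

Section Symmetry.
Variables (R : realType) (eta : 'I_4 -> R).
Local Notation C := R[i].
Local Notation PS := (fps C).
Local Notation H := (H16 PS).
Local Notation X := (X_t eta).
Local Notation a := (start_t eta).
Local Notation v0 := (gen_vec a : X).
Local Notation nn w := (NN PS w *: v0).
Local Notation t := (fps_t C).
Implicit Types (w : 'S_16) (x y z : X).

(** The star operation reverses products and inverts the N_w. *)
Lemma hstarK : involutive (@hstar PS 16 [set: 'S_16]%G).
Proof.
elim/presW; elim=> [c|[w|k]|x IHx y IHy|x IHx y IHy].
- by rewrite !(hstar_hcst _ c).
- by rewrite !(hstarN _ _) invgK.
- by rewrite !(hstarE _ _ k).
- by rewrite pclsD !hstarD IHx IHy.
- by rewrite pclsM !hstarM IHx IHy.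
Qed.

(** The weight of the generator occurs once in X_t, so a functional of this weight is
    determined by its value on the generator. *)
Lemma gen_fun0 (f : Defs.contra X) : regular eta ->
  (forall k x, f (EE PS k *: x) = wt a (lab 1%g) k * f x) -> f v0 = 0 ->
  forall x, f x = 0.
Proof.
move=> reg fE fv; apply: (contra_ideal (S := fun c => c = 0) (mu := wt a (lab 1%g))).
- by [].
- by move=> c d -> ->; rewrite addr0.
- by move=> c d ->; rewrite mulr0.
- by move=> k x; rewrite fE subrr.
move=> w; have [ww|/existsNP[k /eqP kw]] :=
    pselect (forall k, wt a (lab w) k = wt a (lab 1%g) k).
  left=> _; have [e ->] := nn_lab a (fun k => esym (wt_inj reg ww k)).
  by rewrite contraZ NN1 scale1r fv mulr0.
by right; exists k => d /eqP; rewrite mulf_eq0 subr_eq0 (negPf kw) => /eqP.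
Qed.

Variable I : {linear X -> Defs.contra X}.

Lemma right_form_lin y c u v : I (c ** u + v) y = c * I u y + I v y.
Proof. by rewrite formDl formZl. Qed.
Definition right_form y : Defs.contra X := Contra (right_form_lin y).

Lemma form_gen_eigen k x : I v0 (EE PS k *: x) = wt a (lab 1%g) k * I v0 x.
Proof. by rewrite -form_EE (gen_EE a) formZl wt_lab1. Qed.

(** Both x -> <v0,x> and x -> <x,v0> are functionals of the weight of the generator
    v0, and they agree on v0; contravariance extends the equality. *)
Lemma form_sym : regular eta -> forall x y, I x y = I y x.
Proof.
move=> reg; have sym0 x : I v0 x = I x v0.
  apply/eqP; rewrite -subr_eq0; apply/eqP.
  apply: (gen_fun0 (f := (I v0 - right_form v0 : Defs.contra X)) reg) => /=; last exact: subrr.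
  move=> k z; rewrite form_gen_eigen form_EE (gen_EE a) contraZ wt_lab1.
  exact/esym/mulrBr.
move=> x y; have [h ->] := standard_gen x.
by rewrite form_adj sym0 form_adj hstarK.
Qed.

End Symmetry.

(** * Reduction modulo t and the Jantzen filtration *)

Section Reduction.
Variables (R : realType) (eta : 'I_4 -> R).
Local Notation C := R[i].
Local Notation PS := (fps C).
Local Notation X := (X_t eta).
Local Notation a := (start_t eta).
Local Notation v0 := (gen_vec a : X).
Local Notation t := (fps_t C).
Implicit Types (w : 'S_16) (x y z : X).

Lemma reduction_gen h : reduction (h *: v0) = hspec R h *: gen_vec (@start_an R).
Proof.
rewrite /gen_vec !scale_pure !mulr1 reduction_pure; congr pure.
Qed.

Lemma reductionB x y : reduction (x - y) = reduction x - reduction y.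
Proof. by apply: (canRL (addrK _)); rewrite -reductionD subrK. Qed.

(** The coordinates in the principal series reduce modulo t to the coordinates of the
    reduction. *)
Lemma embed_reduction x g :
  embed (@start_an R) (reduction x) g = fps_eval0 (embed a x g).
Proof.
have E0 (A : comNzRingType) (b : 'I_4 -> A) : embed b 0 g = 0.
  by rewrite raddf0; apply: ffunE.
have ED (A : comNzRingType) (b : 'I_4 -> A) u v : embed b (u + v) g = embed b u g + embed b v g.
  by rewrite raddfD; apply: ffunE.
elim: (filt_all x) => [|c w _|y z _ IHy _ IHz].
- by rewrite -(subrr v0) reductionB !subrr !E0.
- rewrite scalerA reduction_gen rmorphM -scalerA.
  have -> : hspec R (hcst c) = hcst (fps_eval0 c) by apply: hmap_cst.
  have -> : hspec R (NN PS w) = NN C w.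
    rewrite /NN /hspec (hmap_gen_E _ _ (HN _)) /=; congr hN; apply: val_inj.
    by rewrite /= !subgK ?in_setT.
  rewrite embed_nn -scalerA embed_nn rmorphM; congr (_ * _).
  by rewrite !ffunE rmorphM rmorph_nat rmorphXn rmorphN1.
- by rewrite reductionD !ED IHy IHz rmorphD.
Qed.

(** An element with reduction 0 has all coordinates divisible by t, hence is divisible
    by t up to the order of the Young subgroup by [embedK]. *)
Lemma reduction_kernel x y : reduction x = reduction y ->
  exists z, (#|young|)%:R ** x = (#|young|)%:R ** y + t ** z.
Proof.
move=> xy; exists (\sum_(g : 'S_16) tdiv 1 (embed a (x - y) g) ** (NN PS g *: v0)).
apply: (canRL (subrKC _)); rewrite -scalerBr embedK scaler_sumr.
apply: eq_bigr => g _; rewrite [RHS]scalerA -rmorphM; congr (_ ** _).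
rewrite -[t]expr1; apply: tdivK => -[_|//].
rewrite -[fcoef _ 0]/(fps_eval0 _) -embed_reduction reductionB xy subrr raddf0.
exact: ffunE.
Qed.

(** A functional with all values divisible by t^n is t^n times a functional. *)
Lemma divide (f : X_dual eta) n : (forall z, tdvd n (f z)) ->
  exists g : X_dual eta, f = hcst (t ^+ n) *: g.
Proof.
move=> fn.
have lin c u v : tdiv n (f (c ** u + v)) = c * tdiv n (f u) + tdiv n (f v).
  apply: (mulfI (fps_expt_neq0 C n)); rewrite mulrDr mulrCA -!tdivK //.
  exact: contra_lin.
exists (Contra lin); apply: contraP => z.
by rewrite contra_scaleE hstar_hcst contraZ -tdivK.
Qed.

Lemma divideP (f : X_dual eta) n : (exists g : X_dual eta, f = hcst (t ^+ n) *: g) ->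
  forall z, tdvd n (f z).
Proof.
by move=> [g ->] z; rewrite contra_scaleE hstar_hcst contraZ; apply: tdvd_exp.
Qed.

Lemma young_neq0 : fcoef ((#|young|)%:R : PS) 0 != 0.
Proof.
rewrite fcoef_nat0 pnatr_eq0 -lt0n; apply/card_gt0P; exists 1%g.
exact: group1.
Qed.

Variable I : {linear X -> X_dual eta}.

Lemma jantzenW m n : (m <= n)%N -> forall y : X_an R, jantzen I (Posz n) y -> jantzen I (Posz m) y.
Proof.
move=> mn y [x xn <-]; exists x => //; apply: divide => z.
by apply: tdvd_le (divideP xn z).
Qed.

Lemma jantzen0 (y : X_an R) : (exists x : X, y = reduction x) -> jantzen I 0 y.
Proof. by move=> [x ->]; exists x => //; apply: divide => z m. Qed.

Lemma jantzen_mem n x : (forall z, tdvd n (I x z)) -> jantzen I (Posz n) (reduction x).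
Proof. by move=> xn; exists x => //; apply: divide. Qed.

(** Another lift of the reduction of [y] changes <y,y> by t <z,y>, which
    does not affect the coefficient of t^n. *)
Lemma jantzen_notin n y : regular eta -> (forall z, tdvd n (I y z)) ->
  fcoef (I y y) n != 0 -> ~ jantzen I (Posz n.+1) (reduction y).
Proof.
move=> reg yn yyn [x xn /reduction_kernel[z xyz]].
have := congr1 (fun u => I u y) xyz; rewrite /= formDl !formZl (form_sym I reg z).
move/(congr1 (fun p => fcoef p n)); rewrite fcoefD => xyE.
have yv : tval n (I y y) by split.
have [_] := tvalM (tval0 young_neq0) yv; rewrite add0n => /negP; case.
have xy : tdvd n.+1 ((#|young|)%:R * I x y) by apply/tdvdMl/divideP.
have ty : tdvd n.+1 (t * I y z) by rewrite -add1n; apply: tdvd_mul (tval_t C).1 _.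
by move: xyE; rewrite xy // ty // addr0 => <-.
Qed.

(** If <v0,v0> were divisible by t, then so would be all of <v0, X_t> by
    [gen_bound], and then the whole form, since v0 generates. *)
Lemma primitive_gen : primitive_intertwiner I -> fcoef (I v0 v0) 0 != 0.
Proof.
move=> [_ prim]; apply/eqP => v00; apply: prim => x.
suff : forall z, tdvd 1 (I x z) by move=> /divide; rewrite expr1.
have [h ->] := standard_gen x => z; rewrite form_adj; move: (hstar h *: z).
apply: (gen_bound (w1 := 1%g) (x1 := v0)).
- by move=> w /chi_words.
- exact: gen_lead.
- exact: form_gen_eigen.
- by case.
Qed.

End Reduction.

(** * The two directions *)

Section Directions.
Variable R : realType.
Local Notation C := R[i].
Local Notation PS := (fps C).
Local Notation t := (fps_t C).

Definition eta_special : seq nat := [:: 0; 3; 1; 2]%N.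
Definition eta_generic : seq nat := [:: 0; 1; 2; 3]%N.

Lemma eta_regular s : uniq s -> size s = 4 -> regular (@eta_of R s).
Proof.
move=> us s4 i j /eqP; rewrite eqr_nat nth_uniq ?s4 // => /eqP.
exact: val_inj.
Qed.

(** The constant term 12 (c - d)(c + d - a - b) is 0 here, and -48 below. *)
Definition gram_special : PS :=
  t * (- 56%:R + 48%:R * t + 72%:R * t ^+ 2 - 64%:R * t ^+ 3 - 16%:R * t ^+ 4
       + 16%:R * t ^+ 5).
Definition gram_generic : PS :=
  - 48%:R + t * (368%:R - 832%:R * t + 424%:R * t ^+ 2 + 736%:R * t ^+ 3
                 - 972%:R * t ^+ 4 + 324%:R * t ^+ 5).

(** x^2 <e2,e2> / <yb,yb>: each factor is the norm factor of one crossing with the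
    strand C, respectively D, that moves to the left, and the last one is that of the
    crossing of C and D. *)
Definition gram_poly (a b c d : PS) : PS :=
  1 * ((3%:R + t * a - (2%:R + t * c)) ^+ 2 - 1)
    * ((4%:R + t * a - (2%:R + t * c)) ^+ 2 - 1)
    * ((3%:R + t * b - (2%:R + t * c)) ^+ 2 - 1) +
  1 * ((3%:R + t * a - (2%:R + t * d)) ^+ 2 - 1)
    * ((4%:R + t * a - (2%:R + t * d)) ^+ 2 - 1)
    * ((3%:R + t * b - (2%:R + t * d)) ^+ 2 - 1)
    * ((2%:R + t * c - (2%:R + t * d)) ^+ 2 - 1).

Lemma gramE s : label_factor R s path_c labels_b + label_factor R s (7%N :: path_c) labels_b =
  gram_poly (nth 0 s 0)%:R (nth 0 s 1)%:R (nth 0 s 2)%:R (nth 0 s 3)%:R.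
Proof. by []. Qed.

Lemma gram_specialE : label_factor R eta_special path_c labels_b +
  label_factor R eta_special (7%N :: path_c) labels_b = t ^+ 2 * gram_special.
Proof. by rewrite gramE /gram_poly /gram_special /=; ring. Qed.

Lemma gram_genericE : label_factor R eta_generic path_c labels_b +
  label_factor R eta_generic (7%N :: path_c) labels_b = t ^+ 2 * gram_generic.
Proof. by rewrite gramE /gram_poly /gram_generic /=; ring. Qed.

End Directions.

(** * Existence of the intertwiner *)

Section Existence.
Variables (R : realType) (eta : 'I_4 -> R).
Local Notation C := R[i].
Local Notation PS := (fps C).
Local Notation H := (H16 PS).
Local Notation X := (X_t eta).
Local Notation a := (start_t eta).
Local Notation v0 := (gen_vec a : X).
Local Notation nn w := (NN PS w *: v0).
Implicit Types (w u : 'S_16) (i j k : 'I_16) (x y z : X) (r : seq ('I_16 * PS)).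

Definition sieve r x : X := foldr (fun kc y => EE PS kc.1 *: y - kc.2 ** y) x r.

Lemma sieveD r x y : sieve r (x + y) = sieve r x + sieve r y.
Proof.
by elim: r => //= kc r ->; rewrite !scalerDr opprD addrACA.
Qed.

Lemma sieveZ r c x : sieve r (c ** x) = c ** sieve r x.
Proof.
elim: r => //= kc r ->; rewrite scalerBr -scale_cst; congr (_ - _).
by rewrite !scalerA -!rmorphM mulrC.
Qed.

Lemma sieveE r k x : sieve r (EE PS k *: x) = EE PS k *: sieve r x.
Proof.
by elim: r => //= kc r ->; rewrite scalerBr scale_cst !scalerA EE_comm.
Qed.

Lemma sieve_filt r m x : filt m x -> filt m (sieve r x).
Proof.
by move=> xm; elim: r => //= kc r IH; apply: filtB; [apply: filt_EE|apply: filt_cst].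
Qed.

Lemma sieve_lead r w : exists s, filt (ninv w) (sieve r (nn w) - s ** nn w).
Proof.
elim: r => [|[k c] r [s IH]] /=.
  by exists 1; rewrite rmorph1 scale1r subrr; apply: filt0.
exists ((wt a (lab w) k - c) * s).
have -> : EE PS k *: sieve r (nn w) - c ** sieve r (nn w) -
    ((wt a (lab w) k - c) * s) ** nn w =
    (EE PS k *: (sieve r (nn w) - s ** nn w) - c ** (sieve r (nn w) - s ** nn w)) +
    s ** (EE PS k *: nn w - wt a (lab w) k ** nn w).
  have -> : ((wt a (lab w) k - c) * s) ** nn w =
      s ** (wt a (lab w) k ** nn w) - c ** (s ** nn w).
    move: (nn w) => n.
    by rewrite !scalerA -!rmorphM -scalerBl -rmorphB mulrBl (mulrC s).
  rewrite !scalerBr -(scale_cst s (EE _ _)).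
  move: (EE PS k *: sieve r _) (c ** sieve r _) (s ** (EE PS k *: _))
    (c ** (s ** _)) (s ** (_ ** _)).
  move=> p q e f g; rewrite [p - e - _]addrAC -[RHS]addrA addKr opprB addrA.
  by congr (_ - g); rewrite opprB addrA addrAC.
apply: filtD; first by apply: filtB; [apply: filt_EE|apply: filt_cst].
exact/filt_cst/lead_EE.
Qed.

(** One of the factors lowers the filtration, and the others preserve it. *)
Lemma sieve_drop r w k : (k, wt a (lab w) k) \in r -> filt (ninv w) (sieve r (nn w)).
Proof.
elim: r => // -[l c] r IH; rewrite inE => /orP[/eqP[<- <-]|/IH IHr] /=; last first.
  by apply: filtB; [apply: filt_EE|apply: filt_cst].
have [s sr] := sieve_lead r w; rewrite -(subrK (s ** nn w) (sieve r (nn w))).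
move: (sieve r (nn w) - _) sr => f fw.
rewrite !scalerDr opprD addrACA; apply: filtD.
  by apply: filtB; [apply: filt_EE|apply: filt_cst].
have -> : EE PS k *: (s ** nn w) - wt a (lab w) k ** (s ** nn w) =
    s ** (EE PS k *: nn w - wt a (lab w) k ** nn w).
  by rewrite scalerBr -scale_cst; congr (_ - _); rewrite !scalerA -!rmorphM mulrC.
exact/filt_cst/lead_EE.
Qed.

Lemma sieve_gen r :
  (forall k c, (k, c) \in r -> fcoef (wt a blk k - c) 0 != 0) ->
  exists2 s, fcoef s 0 != 0 & sieve r v0 = s ** v0.
Proof.
elim: r => [|[k c] r IH] rP.
  by exists 1; [rewrite oner_neq0|rewrite rmorph1 scale1r].
have [|s s0 /= ->] := IH; first by move=> l d ld; apply: rP; rewrite inE ld orbT.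
exists ((wt a blk k - c) * s).
  have kc0 := rP k c (mem_head _ _).
  by have [_] := tvalM (tval0 kc0) (tval0 s0).
rewrite -scale_cst (gen_EE a) !scalerA -!rmorphM -scalerBl -rmorphB.
by rewrite mulrBl (mulrC s).
Qed.

Definition away (c : 'I_16 -> 'I_4) : pred 'I_16 :=
  fun k => letter c k != letter (lab 1%g) k.

(** For each labelling with a word other than that of the generator, one place
    where they differ: the corresponding factor kills the leading term of the vectors
    with this labelling and multiplies the generator by a unit. *)
Definition sieve_list : seq ('I_16 * PS) :=
  flatten [seq (if [pick k | away c k] is Some k then [:: (k, wt a c k)] else [::])
          | c : {ffun 'I_16 -> 'I_4}].

(** Each application of the sieve lowers the filtration by one, up to multiples of the
    generator. *)
Definition gen_proj x : X := iter 257 (sieve sieve_list) x.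

Lemma wt_ext c c' k : c =1 c' -> wt a c k = wt a c' k.
Proof.
by move=> cc'; rewrite /wt /pos cc'; congr (_ + _%:R); apply: eq_bigr => p _; rewrite !cc'.
Qed.

Lemma sieve_listP w : lab 1%g =1 lab w \/
  exists k, (k, wt a (lab w) k) \in sieve_list.
Proof.
have cw : lab w =1 [ffun k => lab w k] by move=> k; rewrite ffunE.
set c := [ffun k => lab w k] in cw *.
case pk: [pick k | away c k] => [k|]; last first.
  left=> k; rewrite cw; apply: chi_words => {}k.
  by move: pk; case: pickP => // none _; apply/eqP/negPn/negbT/none.
right; exists k; apply/flatten_mapP; exists c; first by rewrite mem_enum.
by rewrite pk inE (wt_ext k cw).
Qed.

Lemma sieve_list_unit k c : (k, c) \in sieve_list ->
  fcoef (wt a blk k - c) 0 != 0.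
Proof.
move=> /flatten_mapP[d _]; case: pickP => // l al; rewrite inE => /eqP[-> ->].
rewrite -wt_lab1; apply: wt_letter; rewrite eq_sym; exact: al.
Qed.

Lemma sieve_step m x : filt m.+1 x ->
  exists s y, sieve sieve_list x = s ** v0 + y /\ filt m y.
Proof.
elim=> [|c w wm|y z _ [s [y' [yE y'm]]] _ [s' [z' [zE z'm]]]].
- exists 0, (sieve sieve_list 0); rewrite rmorph0 scale0r add0r; split=> //.
  exact/sieve_filt/filt0.
- rewrite sieveZ; have [w1|[k kw]] := sieve_listP w.
    have [e ->] := nn_lab a w1; rewrite NN1 scale1r.
    have [s _ sE] := sieve_gen sieve_list_unit.
    exists (c * ((-1) ^+ e * s)), 0; split; last exact: filt0.
    by rewrite sieveZ sE addr0 !rmorphM !scalerA !mulrA.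
  exists 0, (c ** sieve sieve_list (nn w)); rewrite rmorph0 scale0r add0r; split=> //.
  by apply/filt_cst/(filt_le _ (sieve_drop kw)); rewrite -ltnS.
- rewrite sieveD yE zE; exists (s + s'), (y' + z'); split; last exact: filtD.
  by rewrite rmorphD scalerDl addrACA.
Qed.

Lemma iter_sieveD m x y : iter m (sieve sieve_list) (x + y) =
  iter m (sieve sieve_list) x + iter m (sieve sieve_list) y.
Proof. by elim: m => //= m ->; rewrite sieveD. Qed.

Lemma iter_sieveZ m c x : iter m (sieve sieve_list) (c ** x) =
  c ** iter m (sieve sieve_list) x.
Proof. by elim: m => //= m ->; rewrite sieveZ. Qed.

Lemma iter_sieveE m k x : iter m (sieve sieve_list) (EE PS k *: x) =
  EE PS k *: iter m (sieve sieve_list) x.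
Proof. by elim: m => //= m ->; rewrite sieveE. Qed.

Lemma iter_sieve_gen m : exists2 s, fcoef s 0 != 0 &
  iter m (sieve sieve_list) v0 = s ** v0.
Proof.
elim: m => [|m [s s0 /= ->]].
  by exists 1; [rewrite oner_neq0|rewrite rmorph1 scale1r].
have [r r0 rE] := sieve_gen sieve_list_unit.
exists (s * r); last by rewrite sieveZ rE scalerA -rmorphM.
by have [_] := tvalM (tval0 s0) (tval0 r0).
Qed.

Lemma filt_zero x : filt 0 x -> x = 0.
Proof. by elim=> // y z _ -> _ ->; rewrite addr0. Qed.

Lemma iter_sieve_line m x : filt m x ->
  exists s, iter m (sieve sieve_list) x = s ** v0.
Proof.
elim: m x => [|m IH] x xm.
  by exists 0; rewrite rmorph0 scale0r /=; apply: filt_zero.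
have [s [y [xE ym]]] := sieve_step xm.
rewrite iterSr xE iter_sieveD iter_sieveZ; have [r ->] := IH _ ym.
have [q _ ->] := iter_sieve_gen m.
by exists (s * q + r); rewrite rmorphD rmorphM scalerDl scalerA.
Qed.

Definition proj_coef x : PS := embed a (gen_proj x) 1%g.

Lemma embed_genZ c : embed a (c ** v0) 1%g = c.
Proof.
rewrite -[v0]scale1r -NN1 embed_nn ffunE invg1 mulg1 group1 odd_perm1.
by rewrite !mulr1.
Qed.

Lemma gen_projE x : gen_proj x = proj_coef x ** v0.
Proof.
have [s sE] := iter_sieve_line (filt_all x : filt 257 x).
by rewrite /proj_coef /gen_proj sE embed_genZ.
Qed.

Lemma proj_coef_lin c x y : proj_coef (c ** x + y) = c * proj_coef x + proj_coef y.
Proof.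
rewrite -[LHS]embed_genZ -gen_projE /gen_proj iter_sieveD iter_sieveZ -!/(gen_proj _) !gen_projE.
by rewrite scalerA -rmorphM -scalerDl -rmorphD embed_genZ.
Qed.

(** The coefficient of the generator in [gen_proj]. *)
Definition proj_fun : X_dual eta := Contra proj_coef_lin.

Lemma proj_fun_EE k x : proj_fun (EE PS k *: x) = wt a blk k * proj_fun x.
Proof.
rewrite -[LHS]embed_genZ -gen_projE /gen_proj iter_sieveE -/(gen_proj x) gen_projE -scale_cst.
by rewrite (gen_EE a) scalerA -rmorphM embed_genZ mulrC.
Qed.

Lemma proj_fun_gen : fcoef (proj_fun v0) 0 != 0.
Proof.
have [s s0 sE] := iter_sieve_gen 257.
by rewrite /= /proj_coef /gen_proj sE embed_genZ.
Qed.

Hypothesis reg : regular eta.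

(** Otherwise x -> f(phi x) would be a nonzero functional with the weight of the
    generator permuted by s.  This is no weight of X_t: the coefficients of t in it
    force the labels of the generator, and then the weight at place i is wrong. *)
Lemma proj_fun_phi i j x : j = i.+1 :> nat -> blk i = blk j ->
  proj_fun (phi PS i j *: x) = 0.
Proof.
move=> ji bij; set s := tperm i j.
have sb k : blk (s k) = blk k by rewrite /s; case: tpermP => [->|->|].
pose f : X_dual eta := hstar (phi PS i j) *: proj_fun.
have fE z : f z = proj_fun (phi PS i j *: z) by rewrite contra_scaleE hstarK.
rewrite -fE; apply: (contra_ideal (S := fun c => c = 0) (f := f)
    (mu := fun k => wt a blk (s k))).
- by [].
- by move=> c d -> ->; rewrite addr0.
- by move=> c d ->; rewrite mulr0.
- move=> k z; rewrite !fE scalerA -[k in EE _ k](tpermK i j) -(EE_phi _ ji).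
  by rewrite -scalerA proj_fun_EE subrr.
move=> w; right.
case: (pselect (forall k, wt a (lab w) k = wt a blk (s k))) => [ww|/existsNP[k /eqP kw]].
  have lw : lab w =1 blk.
    move=> k; apply: reg; apply: complexI; rewrite -!wt_coef1 ww.
    by rewrite !wt_coef1 sb.
  have : fcoef (wt a (lab w) i) 0 = fcoef (wt a blk (s i)) 0 by rewrite ww.
  rewrite (wt_ext _ lw) !wt_coef0.
  move/eqP; rewrite eqr_nat /s tpermL /letter bij eqn_add2l !pos_blk => /eqP ijm.
  have := congr1 (@nat_of_ord 4) bij; rewrite !blkE => ijd.
  by exfalso; move: (divn_eq i 4) (divn_eq j 4); rewrite ijd ijm ji; lia.
by exists k => d /eqP; rewrite mulf_eq0 subr_eq0 (negPf kw) => /eqP.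
Qed.

(** The two weights in f(phi x) = 0 differ by 1. *)
Lemma proj_fun_simple_refl i j x : j = i.+1 :> nat -> blk i = blk j ->
  proj_fun (NN PS (tperm i j) *: x) = - proj_fun x.
Proof.
move=> ji bij; have := proj_fun_phi x ji bij.
rewrite /phi scalerBl scale1r contraB -scalerA scalerBl contraB !proj_fun_EE -mulrBl.
have -> : wt a blk i - wt a blk j = -1.
  have := congr1 (@nat_of_ord 4) bij; rewrite !blkE => ijd.
  have ijm : (j %% 4 = (i %% 4).+1)%N.
    have := divn_eq j 4; rewrite -ijd ji {1}(divn_eq i 4) -addnS => /eqP.
    by rewrite eqn_add2l => /eqP.
  by rewrite /wt bij !pos_blk ijm -natr1; ring.
by rewrite mulN1r => /eqP; rewrite subr_eq0 eqr_oppLR => /eqP.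
Qed.

Lemma proj_fun_NN u x : u \in young -> proj_fun (NN PS u *: x) = (-1) ^+ u * proj_fun x.
Proof.
elim/(@inv_ind _ (@nat_of_ord 16)): u x => [u uP|u i j ji uij IH] x uy.
  have -> : u = 1%g.
    apply/permP => i; rewrite perm1; apply: val_inj.
    exact: (@monotone_perm _ (@nat_of_ord 16)).
  by rewrite NN1 scale1r odd_perm1 mul1r.
have bij : blk i = blk j.
  apply: val_inj; apply/eqP; rewrite eqn_leq blk_mono ?ji //=.
  have bi := youngP _ uy i; have bj := youngP _ uy j.
  rewrite permM tpermL in bi; rewrite permM tpermR in bj.
  by rewrite -bi -bj blk_mono // ltnW.
have uy' : u \in young by rewrite -(groupMl _ (tperm_young bij)).
have ij : i != j by rewrite -val_eqE /= ji ltn_eqF.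
rewrite -NNM -scalerA proj_fun_simple_refl // IH // odd_permM odd_tperm ij signr_addb.
by rewrite expr1 mulN1r mulNr.
Qed.

Lemma proj_fun_sign u : u \in young -> NN PS u *: proj_fun = (-1) ^+ u ** proj_fun.
Proof.
move=> uy; apply: contraP => z; rewrite !contra_scaleE hstar_NN hstar_hcst contraZ.
by rewrite proj_fun_NN ?groupV // odd_permV.
Qed.

Lemma proj_fun_eigen k : EE PS k *: proj_fun = wt a blk k ** proj_fun.
Proof.
apply: contraP => z; rewrite !contra_scaleE hstar_EE hstar_hcst contraZ.
exact: proj_fun_EE.
Qed.

(** By Frobenius reciprocity, from a functional with the inducing character. *)
Definition intertwiner : {linear X -> X_dual eta} :=
  universal_map proj_fun_sign proj_fun_eigen.

Lemma intertwiner_gen : fcoef (intertwiner v0 v0) 0 != 0.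
Proof.
have := universal_gen proj_fun_sign proj_fun_eigen 1; rewrite !scale1r => E.
by rewrite /intertwiner E proj_fun_gen.
Qed.

End Existence.

(** * The generic fibre *)

Section GenericFibre.
Variables (R : realType).
Local Notation C := R[i].
Local Notation PS := (fps C).
Local Notation K := {fraction PS}.
Local Notation toK := (to_laurent R).

Lemma clear_denom (c : K) : exists2 p : PS, p != 0 & exists n : PS, toK p * c = toK n.
Proof.
elim/quotW: c => x; exists (\d_x); first exact: denom_ratioP.
exists (\n_x); rewrite /to_laurent /= -[_ * _]/(FracField.mul _ _) !piE.
apply/eqmodP; rewrite /= FracField.equivfE /FracField.mulf.
by rewrite !numden_Ratio ?mul1r ?oner_eq0 ?denom_ratioP // mulr1.
Qed.

Variable M : lmodType (H16 PS).
Local Notation G := (generic_fibre M).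
Local Notation tens c m := (pure toK (L := restr hcst M) c (m : M)).

Lemma tensZ (p : PS) (m : M) : toK p *: (tens 1 m : G) = tens 1 (p ** m).
Proof. by rewrite scale_pure mulr1 -[toK p]mul1r pureM. Qed.

Lemma generic_clear (u : G) : exists2 p : PS, p != 0 & exists m : M, toK p *: u = tens 1 m.
Proof.
elim/(@ext_ind _ _ toK): u => [|c l|u v [p p0 [m pm]] [q q0 [n qn]]].
- exists 1; first exact: oner_neq0.
  exists 0; rewrite scaler0; apply: (addIr (tens 1 0)); rewrite add0r.
  by rewrite -[RHS](pureDr toK 1 (0 : restr hcst M) 0) addr0.
- have [p p0 [n pc]] := clear_denom c; exists p => //; exists (n ** (l : M)).
  by rewrite scale_pure pc -tensZ scale_pure mulr1.
- exists (p * q); first exact: mulf_neq0.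
  exists (q ** m + p ** n).
  rewrite scalerDr {1}(mulrC p) !rmorphM -!scalerA pm qn !tensZ.
  exact/esym/pureDr.
Qed.

Lemma toK_inj0 (p : PS) (u : G) : p != 0 -> toK p *: u = 0 -> u = 0.
Proof.
move=> p0 pu; have pK : toK p != 0 by rewrite tofrac_eq0.
by rewrite -[u]scale1r -(mulVf pK) -scalerA pu scaler0.
Qed.

End GenericFibre.

(** * Generic bijectivity of the intertwiner *)

Section Bijectivity.
Variables (R : realType) (eta : 'I_4 -> R).
Local Notation C := R[i].
Local Notation PS := (fps C).
Local Notation K := {fraction PS}.
Local Notation toK := (to_laurent R).
Local Notation X := (X_t eta).
Local Notation a := (start_t eta).
Local Notation v0 := (gen_vec a : X).
Local Notation nn w := (NN PS w *: v0).
Local Notation T := {ffun 'I_16 -> 'I_4}.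
Implicit Types (w : 'S_16) (x y z : X).
Hypothesis reg : regular eta.
Variable I : {linear X -> X_dual eta}.
Hypothesis U0 : fcoef (I v0 v0) 0 != 0.

Lemma fcoef_neq0 (p : PS) n : fcoef p n != 0 -> p != 0.
Proof. by apply: contra_neq => ->; case: n. Qed.

Definition ortho_vec w y := [/\ eigen (lab w) y,
  exists2 u : PS, u != 0 & filt (ninv w) (y - u ** nn w) & I y y != 0].

Lemma ortho_vec_lab w w' y : lab w =1 lab w' -> ortho_vec w y -> ortho_vec w' y.
Proof.
move=> ww' [yE [u u0 yu] yy]; split=> //.
  by move=> k; rewrite yE; congr (_ ** _); apply: wt_ext.
have [e ne] := nn_lab a (fun k => esym (ww' k)).
exists (u * (-1) ^+ e); first by rewrite mulf_neq0 ?signr_eq0.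
rewrite rmorphM -scalerA -ne (_ : ninv w' = ninv w) //.
by apply: eq_bigr => pq _; rewrite -!/(lab _ _) !ww'.
Qed.

(** Each phi along a path of ascents multiplies leading term and norm by nonzero power
    series. *)
Lemma ortho_vec_exists w : exists y, ortho_vec w y.
Proof.
elim/(@inv_ind _ (fun p => nat_of_ord (blk p))): w => [w wP|w i j ji wij [y [yE [u u0 yu] yy]]].
  exists v0; apply: (@ortho_vec_lab 1%g) => [k|].
    by rewrite lab1_blk; apply/esym/youngP/mono_young.
  split; [exact: gen_eigen| |exact: fcoef_neq0 U0].
  exists 1; first exact: oner_neq0.
  by rewrite NN1 rmorph1 !scale1r subrr; apply: filt0.
have lwij : lab w i != lab w j by rewrite -val_eqE neq_ltn wij.
exists (phi PS i j *: y); split.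
- exact: (eigen_phi ji lwij yE).
- exists (u * (wt a (lab w) j - wt a (lab w) i)); last exact: (lead_phi ji).
  rewrite mulf_neq0 //; apply: (@fcoef_neq0 _ 1).
  rewrite fcoefB !wt_coef1 subr_eq0; apply: contra_neq lwij => /complexI.
  by move/reg/esym.
- rewrite (form_phi I ji yE) mulf_neq0 //.
  by have [_ /fcoef_neq0] := tval_wt_sq reg lwij.
Qed.

(** The eigenvectors are indexed by labellings, so that different ones are orthogonal;
    nothing is asked for labellings that do not come from a permutation. *)
Lemma ortho_family : exists y : T -> X, forall (c : T) w, lab w =1 c -> ortho_vec w (y c).
Proof.
have ex (c : T) : exists y, forall w, lab w =1 c -> ortho_vec w y.
  have [[w0 w0c]|none] := pselect (exists w, lab w =1 c).
    have [y yP] := ortho_vec_exists w0; exists y => w wc.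
    by apply: ortho_vec_lab yP => k; rewrite wc w0c.
  by exists 0 => w wc; case: none; exists w.
by have [y yP] := choice ex; exists y.
Qed.

(** Expand the functional in the orthogonal eigenvectors, with the product of their
    norms as common denominator. *)
Lemma form_onto (f : X_dual eta) :
  exists2 p : PS, p != 0 & exists x, forall z, I x z = p * f z.
Proof.
have [y yP] := ortho_family.
pose im (c : T) : bool := `[< exists w, lab w =1 c >].
have imP c : im c -> exists w, lab w =1 c by move/asboolP.
pose d c := I (y c) (y c).
exists (\prod_(c | im c) d c).
  by apply/prodf_neq0 => c /imP[w /yP[]].
pose x := \sum_(c | im c) (f (y c) * \prod_(c' | im c' && (c' != c)) d c') ** y c.
exists x.
have xy c : im c -> I x (y c) = (\prod_(c | im c) d c) * f (y c).
  move=> ic; have IxE : I x (y c) = \sum_(c' | im c')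
      (f (y c') * \prod_(c'' | im c'' && (c'' != c')) d c'') * I (y c') (y c).
    rewrite /x; elim/big_rec2: _ => [|c' s u _ <-].
      by rewrite linear0.
    by rewrite formDl formZl.
  rewrite IxE (bigD1 c) //= [X in _ + X]big1 ?addr0 => [|c' /andP[ic' c'c]].
    rewrite [in RHS](bigD1 c) //= -/(d c).
    by move: (f (y c)) (d c) => p q; rewrite mulrC [p * _]mulrC mulrA.
  have [w wc] := imP _ ic; have [w' wc'] := imP _ ic'.
  have [k ck] : exists k, lab w' k != lab w k.
    apply/existsP; apply: contraNT c'c => /existsPn same; apply/eqP/ffunP => k.
    by rewrite -wc -wc'; apply/eqP/negPn/same.
  have [yE _ _] := yP _ _ wc; have [yE' _ _] := yP _ _ wc'.
  rewrite (eigen_orth I (k := k) _ yE' yE) ?mulr0 //.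
  apply: contra_neq ck => wk; apply: reg; apply: complexI.
  by rewrite -!wt_coef1 wk.
move=> z; apply/eqP; rewrite -subr_eq0; apply/eqP.
pose p := \prod_(c | im c) d c.
have E u : (I x - hcst p *: f : X_dual eta) u = I x u - p * f u.
  have -> : p * f u = (hcst p *: f : X_dual eta) u.
    by rewrite contra_scaleE hstar_hcst contraZ.
  by [].
rewrite -E; apply: (contra_filt (S := fun c => c = 0)) => //.
- by move=> c e -> ->; rewrite addr0.
- by move=> c e ->; rewrite mulr0.
move=> w fw; pose c : T := [ffun k => lab w k].
have wc : lab w =1 c by move=> k; rewrite ffunE.
have ic : im c by apply/asboolP; exists w.
have [_ [u u0 yu] _] := yP _ _ wc.
apply: (mulfI u0); rewrite mulr0 -contraZ -(subKr (y c) (u ** _)) contraB.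
by rewrite (fw (y c - u ** nn w)) // subr0 E xy // subrr.
Qed.

Lemma embed_coord g c u v : embed a (c ** u + v) g = c * embed a u g + embed a v g.
Proof.
rewrite (linearP (embed a)) principal_cst.
by rewrite [LHS]ffunE; congr (_ + _); apply: ffunE.
Qed.

(** By symmetry and [form_onto], all functionals vanish on a vector of the radical, the
    coordinates in the principal series among them. *)
Lemma form_inj x : (forall z, I x z = 0) -> (#|young|)%:R ** x = 0.
Proof.
move=> x0; rewrite embedK big1 // => g _.
pose f : X_dual eta := Contra (embed_coord g).
have [p p0 [y yE]] := form_onto f.
have : p * f x = 0 by rewrite -yE form_sym // x0.
by move=> /eqP; rewrite mulf_eq0 (negPf p0) => /eqP /= ->; rewrite rmorph0 scale0r.
Qed.

Local Notation tens M c m := (pure toK (L := restr hcst M) c m).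

Lemma tens_dual_eq0 (f : X_dual eta) :
  (tens (X_dual eta) 1 f : generic_fibre (X_dual eta)) = 0 -> f = 0.
Proof.
move=> f0; apply: contraP => z; apply/eqP; rewrite -(tofrac_eq0 (f z)).
pose ev := fun (c : K) (g : restr hcst (X_dual eta)) => c * toK ((g : X_dual eta) z).
have bal : balanced toK ev.
  split=> [c c' l|c l l'|c p l]; rewrite /ev.
  - by rewrite mulrDl.
  - by rewrite -mulrDr -rmorphD.
  - rewrite restr_scaleE contra_scaleE hstar_hcst contraZ rmorphM mulrA //.
pose F := @elift _ _ toK (restr hcst (X_dual eta)) _ ev.
have F0 : F 0 = 0 by apply: (addIr (F 0)); rewrite -[LHS](eliftD bal) !add0r.
have := congr1 F f0; rewrite F0 /F (elift_pure bal) /ev mul1r => ->.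
exact: eqxx.
Qed.

Lemma generic_mapZ c u : generic_map I (c *: u) = c *: generic_map I u.
Proof.
elim/(@ext_ind _ _ toK): u => [|b l|u v IHu IHv].
- have e0 : generic_map I 0 = 0.
    by apply: (addIr (generic_map I 0)); rewrite -generic_mapD !add0r.
  by rewrite scaler0 e0 scaler0.
- by rewrite scale_pure !generic_map_pure scale_pure.
- by rewrite scalerDr !generic_mapD IHu IHv scalerDr.
Qed.

(** A fraction c (x) m is a scalar multiple of 1 (x) m', so [form_inj] and
    [form_onto] give injectivity and surjectivity. *)
Lemma generic_bijective : bijective (generic_map I).
Proof.
have inj : injective (generic_map I).
  move=> u v uv; apply/eqP; rewrite -subr_eq0; apply/eqP.
  have {uv} : generic_map I (u - v) = 0.
    apply: (addIr (generic_map I v)).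
    by rewrite -generic_mapD subrK uv add0r.
  move: (u - v) => {u v} u u0.
  have [p p0 [m pm]] := generic_clear u; apply: (toK_inj0 p0).
  have Im0 : I m = 0.
    by apply: tens_dual_eq0; rewrite -generic_map_pure -pm generic_mapZ u0 scaler0.
  have yn0 : (#|young|)%:R != 0 :> PS by apply: fcoef_neq0 (young_neq0 _).
  apply: (toK_inj0 yn0); rewrite pm tensZ form_inj => [|z]; last by rewrite Im0.
  apply: (addIr (tens X 1 0)); rewrite add0r.
  by rewrite -[LHS](pureDr toK 1 (0 : restr hcst X) 0) addr0.
have surj v : exists u, generic_map I u = v.
  have [p p0 [f pf]] := generic_clear v.
  have [q q0 [x xE]] := form_onto f.
  have pqK : toK (q * p) != 0 by rewrite tofrac_eq0 mulf_neq0.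
  exists ((toK (q * p))^-1 *: tens X 1 x).
  rewrite generic_mapZ generic_map_pure; have -> : I x = hcst q *: f.
    by apply: contraP => z; rewrite contra_scaleE hstar_hcst contraZ.
  by rewrite -tensZ -pf scalerA -rmorphM scalerA mulVf ?scale1r.
have [g gP] := choice surj.
by exists g => [u|//]; apply: inj.
Qed.

Lemma intertwiner_primitive : primitive_intertwiner I.
Proof.
split; first exact: generic_bijective.
move=> prim; have [f fE] := prim v0; have := U0.
have /divideP : exists g : X_dual eta, I v0 = hcst (fps_t C ^+ 1) *: g.
  by exists f; rewrite expr1.
by move=> /(_ v0 0%N isT) ->; rewrite eqxx.
Qed.

End Bijectivity.

Theorem theoremA4 (R : realType) :
  exists eta eta' : 'I_4 -> R,
    [/\ regular eta, regular eta',
        exists I : {linear X_t eta -> X_dual eta}, primitive_intertwiner I,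
        exists I' : {linear X_t eta' -> X_dual eta'}, primitive_intertwiner I' &
        forall (I : {linear X_t eta -> X_dual eta})
               (I' : {linear X_t eta' -> X_dual eta'}),
          primitive_intertwiner I -> primitive_intertwiner I' ->
          forall k : int, ~ (forall n : int, jantzen I n = jantzen I' (n + k))].
Proof.
have rs : regular (@eta_of R eta_special) by apply: eta_regular.
have rg : regular (@eta_of R eta_generic) by apply: eta_regular.
exists (@eta_of R eta_special), (@eta_of R eta_generic); split=> //.
- exists (intertwiner rs); apply: intertwiner_primitive => //.
  exact: intertwiner_gen.
- exists (intertwiner rg); apply: intertwiner_primitive => //.
  exact: intertwiner_gen.
move=> I I' /primitive_gen U0 /primitive_gen U0' k JJ.
have gen_in (eta : 'I_4 -> R) (J : {linear X_t eta -> X_dual eta}) :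
    jantzen J 0 (reduction (gen_vec (start_t eta) : X_t eta)).
  by apply: jantzen0; exists (gen_vec (start_t eta)).
have gen_notin (eta : 'I_4 -> R) (J : {linear X_t eta -> X_dual eta}) : regular eta ->
    fcoef (J (gen_vec (start_t eta)) (gen_vec (start_t eta))) 0 != 0 ->
    forall m : nat, ~ jantzen J (Posz m.+1) (reduction (gen_vec (start_t eta) : X_t eta)).
  move=> reg J0 m /(@jantzenW _ _ J 1 m.+1 isT).
  exact: (jantzen_notin (n := 0) reg).
have genE (s : seq nat) :
    reduction (gen_vec (start_t (@eta_of R s)) : X_t (@eta_of R s)) =
    1 *: gen_vec (@start_an R).
  by rewrite -[X in reduction X](scale1r (gen_vec _)) reduction_gen rmorph1.
have k0 : k = 0.
  case: k JJ => [[//|m]|m] JJ; exfalso.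
  - have := JJ 0; rewrite add0r => J0; apply: (gen_notin _ I' rg U0' m).
    by rewrite -J0 genE -(genE eta_special); apply: gen_in.
  - have := JJ (Posz m.+1); rewrite NegzE subrr => J0.
    apply: (gen_notin _ I rs U0 m).
    by rewrite J0 genE -(genE eta_generic); apply: gen_in.
have e2E : reduction (e2 R eta_special) = reduction (e2 R eta_generic).
  by rewrite !reduction_gen.
have spec_bound : forall z, tdvd 4 (I (e2 R eta_special) z).
  apply: (e2_bound rs U0 (erefl _) (leqnn 4)).
  rewrite (I_e2_e2 I (erefl _) (gram_specialE R)).
  apply: (@tdvd_mul _ 1 3 _ _ _ (yb_val rs U0).1).
  apply: (@tdvd_mul _ 1 0 _ _ (tval_t R[i]).1); exact.
have e2_in := jantzen_mem spec_bound.
have yv := yb_val rg U0'.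
have v22 : tval 3 (I' (e2 R eta_generic) (e2 R eta_generic)).
  rewrite (I_e2_e2 I' (erefl _) (gram_genericE R)); apply: (@tvalM _ 0 3 _ _ _ yv).
  apply: tval0; rewrite /gram_generic fcoefD fcoef_t addr0.
  rewrite -[fcoef _ 0]/(- fcoef (48%:R : fps R[i]) 0) fcoef_nat0.
  by rewrite oppr_eq0 pnatr_eq0.
have gnrc_bound : forall z, tdvd 3 (I' (e2 R eta_generic) z).
  by apply: (e2_bound rg U0' (erefl _) (ltnW (leqnn 4))); apply: v22.1.
apply: (jantzen_notin rg gnrc_bound v22.2).
by rewrite -e2E -[Posz 4]addr0 -k0 -JJ.
Qed.
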